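(* Let $q$ be a prime power, let $\ell,r\in\mathbb{N}$ with $r\ge3$, let $K$ be the algebraic closure of $\mathbb{F}_q$, and let $C=C_{\mathcal{L}}(D,G)$ be the functional AG code over $\mathbb{F}_{q^r}$ on the norm-trace curve $\mathcal{N}_{q,r}$ with $G=\sum_{P\in\Omega}\ell P$ and $D=\sum_{P\in\Theta}P$ (notation as in the context). Then the automorphism group $\mathrm{Aut}(C)$ of $C$ has a subgroup isomorphic to $$\big(\mathrm{Aut}_K(\mathcal{N}_{q,r})\rtimes\mathrm{Aut}(\mathbb{F}_{q^r})\big)\rtimes\mathbb{F}_{q^r}^*.$$
   Context: $\mathcal{N}_{q,r}$ is the curve with affine equation $X^{\frac{q^r-1}{q-1}}=Y^{q^{r-1}}+Y^{q^{r-2}}+\cdots+Y$, with coordinate functions $x,y$; $\mathrm{Aut}_K(\mathcal{N}_{q,r})$ is the group of $K$-automorphisms of its function field $K(x,y)$. The curve has $q^{2r-1}+1$ $\mathbb{F}_{q^r}$-rational places, one of which is the unique place at infinity $P_\infty$ (the unique pole of $x$ and $y$). $\Omega$ is the set of the $q^{r-1}$ $\mathbb{F}_{q^r}$-rational places that are the zeros of $x$, and $\Theta=\mathcal{N}_{q,r}(\mathbb{F}_{q^r})\setminus\Omega$ (so $P_\infty\in\Theta$). For an $\mathbb{F}_{q^r}$-rational divisor $E$, $\mathcal{L}(E)=\{f\in\mathbb{F}_{q^r}(\mathcal{N}_{q,r})\setminus\{0\}\mid (f)+E\ge0\}\cup\{0\}$. For $D=P_1+\cdots+P_n$ and $G$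 with disjoint support, $C_{\mathcal{L}}(D,G)\subseteq\mathbb{F}_{q^r}^n$ is the image of $\mathcal{L}(G)$ under $f\mapsto(f(P_1),\ldots,f(P_n))$; here $n=q^{2r-1}+1-q^{r-1}$. Automorphism group of a code $C\subseteq\mathbb{F}_{q^r}^n$: let $\mathcal{M}_{n,q^r}\le\mathrm{GL}(n,q^r)$ be the subgroup of matrices having exactly one nonzero entry in each row and column, and let $\mathcal{W}_{n,q^r}=\mathcal{M}_{n,q^r}\rtimes\mathrm{Aut}(\mathbb{F}_{q^r})$, where field automorphisms act on matrices entrywise. An element $M\gamma$ acts on row vectors by $v\mapsto(v\cdot M)^\gamma$ ($\gamma$ applied to each coordinate). $\mathrm{Aut}(C)$ is the subgroup of $\mathcal{W}_{n,q^r}$ of elements mapping $C$ into itself. In the semidirect products the natural actions are meant: $\mathrm{Aut}(\mathbb{F}_{q^r})$ acts on $\mathrm{Aut}_K(\mathcal{N}_{q,r})$ (whose elements are all defined over $\mathbb{F}_{q^r}$) through the coefficients, and on the group of scalars $\mathbb{F}_{q^r}^*$ in the obvious way, while $\mathrm{Aut}_K(\mathcal{N}_{q,r})$ acts trivially on $\mathbb{F}_{q^r}^*$. *)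

(* Defs.v *)
From HB Require Import structures.
From mathcomp Require Import all_boot all_order all_algebra all_fingroup.
From mathcomp Require Import boolp classical_sets.

Set Implicit Arguments.
Unset Strict Implicit.
Unset Printing Implicit Defensive.

Import Order.TTheory GRing.Theory Num.Theory.

Local Open Scope ring_scope.

(* Groups act on the right: products of maps are read from left to right      *)
(* (as for {perm T}), and the semidirect product of N by H for a right action *)
(* x ^ h of H on N is ruled by h^-1 x h = x ^ h, that is                      *)
(*   (x h) (x' h') = (x (x' ^ h^-1)) (h h').                                  *)

Record right_action (N H : groupType) := RightAction {
  ract :> N -> H -> N;
  ractM : forall h, {morph ract^~ h : x x' / (x * x')%g};
  ract1 : forall x, ract x 1%g = x;
  ractA : forall x h h', ract x (h * h')%g = ract (ract x h) h' }.

Record semidirect (N H : groupType) (A : right_action N H) := SDPair {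
  sdl : N;
  sdr : H }.

Section SemidirectProduct.
Variables (N H : groupType) (A : right_action N H).
Local Open Scope group_scope.

HB.instance Definition _ := gen_eqMixin (semidirect A).
HB.instance Definition _ := gen_choiceMixin (semidirect A).

Definition sdone : semidirect A := SDPair A 1 1.
Definition sdmul (u v : semidirect A) : semidirect A :=
  SDPair A (sdl u * A (sdl v) (sdr u)^-1) (sdr u * sdr v).
Definition sdinv (u : semidirect A) : semidirect A :=
  SDPair A (A (sdl u)^-1 (sdr u)) (sdr u)^-1.

Lemma ract1l h : A 1 h = 1.
Proof. by apply: (mulgI (A 1 h)); rewrite -(ractM A) !mulg1. Qed.

Lemma ractV h x : A x^-1 h = (A x h)^-1.
Proof. by apply: (mulgI (A x h)); rewrite -(ractM A) !mulgV ract1l. Qed.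

Lemma sdmulA : associative sdmul.
Proof.
move=> [a g] [b h] [c k]; rewrite /sdmul /=; congr SDPair; last exact: mulgA.
by rewrite (ractM A) -(ractA A) -invgM mulgA.
Qed.

Lemma sdmul1g : left_id sdone sdmul.
Proof. by move=> [a g]; rewrite /sdmul /= invg1 (ract1 A) !mul1g. Qed.

Lemma sdmulg1 : right_id sdone sdmul.
Proof. by move=> [a g]; rewrite /sdmul /= ract1l !mulg1. Qed.

Lemma sdmulVg : left_inverse sdone sdinv sdmul.
Proof.
by move=> [a g]; rewrite /sdmul /sdone /= invgK ractV !mulVg.
Qed.

Lemma sdmulgV : right_inverse sdone sdinv sdmul.
Proof.
by move=> [a g]; rewrite /sdmul /sdone /= -(ractA A) mulgV (ract1 A) !mulgV.
Qed.

HB.instance Definition _ :=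
  isGroup.Build (semidirect A) sdmulA sdmul1g sdmulg1 sdmulVg sdmulgV.

End SemidirectProduct.

Record ring_aut (R : nzRingType) := RingAut {
  raut :> R -> R;
  raut_zmod : zmod_morphism raut;
  raut_monoid : GRing.monoid_morphism raut;
  raut_bij : bijective raut }.

Section RingAutomorphisms.
Variable R : nzRingType.
Implicit Types s t : ring_aut R.

HB.instance Definition _ s := GRing.isZmodMorphism.Build R R s (raut_zmod s).
HB.instance Definition _ s :=
  GRing.isMonoidMorphism.Build R R s (raut_monoid s).

HB.instance Definition _ := gen_eqMixin (ring_aut R).
HB.instance Definition _ := gen_choiceMixin (ring_aut R).

Lemma raut_eq s t : (forall a, s a = t a) -> s = t.
Proof.
case: s t => [s s1 s2 s3] [t t1 t2 t3] /= /funext st.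
by case: t / st t1 t2 t3 => t1 t2 t3; congr RingAut; exact: Prop_irrelevance.
Qed.

Lemma raut_inv_subproof s : {t : ring_aut R | cancel s t /\ cancel t s}.
Proof.
apply/cid; have [t st ts] := raut_bij s.
have tz : zmod_morphism t.
  by move=> a b; apply: (can_inj st); rewrite rmorphB /= !ts.
have tm : GRing.monoid_morphism t.
  split; first by apply: (can_inj st); rewrite rmorph1 /= ts.
  by move=> a b; apply: (can_inj st); rewrite rmorphM /= !ts.
have tb : bijective t by exists s.
by exists (RingAut tz tm tb).
Qed.

Definition raut1 : ring_aut R :=
  RingAut (rmorphB idfun) (conj (rmorph1 idfun) (rmorphM idfun))
    (Bijective (fun=> erefl) (fun=> erefl)).
Definition raut_mul s t : ring_aut R :=
  RingAut (rmorphB (t \o s)) (conj (rmorph1 (t \o s)) (rmorphM (t \o s)))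
    (bij_comp (raut_bij t) (raut_bij s)).
Definition raut_inv s : ring_aut R := sval (raut_inv_subproof s).

Lemma raut_mulE s t a : raut_mul s t a = t (s a). Proof. by []. Qed.

Lemma rautK s : cancel s (raut_inv s).
Proof. by rewrite /raut_inv; case: raut_inv_subproof => t []. Qed.

Lemma rautVK s : cancel (raut_inv s) s.
Proof. by rewrite /raut_inv; case: raut_inv_subproof => t []. Qed.

Lemma raut_mulA : associative raut_mul.
Proof. by move=> s t u; apply: raut_eq. Qed.
Lemma raut_mul1g : left_id raut1 raut_mul.
Proof. by move=> s; apply: raut_eq. Qed.
Lemma raut_mulg1 : right_id raut1 raut_mul.
Proof. by move=> s; apply: raut_eq. Qed.
Lemma raut_mulVg : left_inverse raut1 raut_inv raut_mul.
Proof. by move=> s; apply: raut_eq => a; rewrite raut_mulE rautVK. Qed.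
Lemma raut_mulgV : right_inverse raut1 raut_inv raut_mul.
Proof. by move=> s; apply: raut_eq => a; rewrite raut_mulE rautK. Qed.

HB.instance Definition _ :=
  isGroup.Build (ring_aut R) raut_mulA raut_mul1g raut_mulg1
    raut_mulVg raut_mulgV.

End RingAutomorphisms.

(* The group of K-automorphisms of L, for an embedding j : K -> L.            *)

Section RelativeAutomorphisms.
Variables (K L : fieldType) (j : {rmorphism K -> L}).

Definition fixes_base : {pred ring_aut L} :=
  fun s => `[< forall c, s (j c) = j c >].

Lemma fixes_base_closed : group_closed fixes_base.
Proof.
split=> [|s t /asboolP sj /asboolP tj]; first exact/asboolP.
by apply/asboolP => c; rewrite /= sj -{1}(tj c) [LHS]rautK.
Qed.

Definition kaut := {s : ring_aut L | s \in fixes_base}.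
HB.instance Definition _ := Choice.on kaut.
HB.instance Definition _ := SubType.on kaut.
HB.instance Definition _ :=
  SubChoice_isSubGroup.Build (ring_aut L) fixes_base kaut fixes_base_closed.

End RelativeAutomorphisms.

(* The library's 'GL_n[F] has matrices of size n.-1.+1; here the size is n.   *)

Section MonomialGroup.
Variables (F : finFieldType) (n : nat).

Definition GL := {M : 'M[F]_n | M \in unitmx}.
HB.instance Definition _ := Choice.on GL.
HB.instance Definition _ := SubType.on GL.

Lemma GL1_subproof : (1%:M : 'M[F]_n) \in unitmx.
Proof. exact: unitmx1. Qed.
Lemma GLM_subproof (M M' : GL) : val M *m val M' \in unitmx.
Proof. by rewrite unitmx_mul (valP M) (valP M'). Qed.
Lemma GLV_subproof (M : GL) : invmx (val M) \in unitmx.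
Proof. by rewrite unitmx_inv (valP M). Qed.

Definition GLone : GL := Sub 1%:M GL1_subproof.
Definition GLmul (M M' : GL) : GL := Sub (val M *m val M') (GLM_subproof M M').
Definition GLinv (M : GL) : GL := Sub (invmx (val M)) (GLV_subproof M).

Lemma GLmulA : associative GLmul.
Proof. by move=> A B C; apply: val_inj; rewrite /= mulmxA. Qed.
Lemma GLmul1g : left_id GLone GLmul.
Proof. by move=> A; apply: val_inj; rewrite /= mul1mx. Qed.
Lemma GLmulg1 : right_id GLone GLmul.
Proof. by move=> A; apply: val_inj; rewrite /= mulmx1. Qed.
Lemma GLmulVg : left_inverse GLone GLinv GLmul.
Proof. by move=> A; apply: val_inj; rewrite /= mulVmx ?(valP A). Qed.
Lemma GLmulgV : right_inverse GLone GLinv GLmul.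
Proof. by move=> A; apply: val_inj; rewrite /= mulmxV ?(valP A). Qed.

HB.instance Definition _ :=
  isGroup.Build GL GLmulA GLmul1g GLmulg1 GLmulVg GLmulgV.

Definition monomial_mx (M : 'M[F]_n) : bool :=
  [forall i, #|[pred k | M i k != 0]| == 1%N]
    && [forall k, #|[pred i | M i k != 0]| == 1%N].

Lemma monomial_mxP (M : 'M[F]_n) :
  reflect (exists s : 'S_n, forall i k, (M i k != 0) = (k == s i))
          (monomial_mx M).
Proof.
apply: (iffP andP) => [[/forallP rowM /forallP colM]|[s sP]]; last first.
  split; apply/forallP => i; apply/eqP.
    by rewrite -(card1 (s i)); apply: eq_card => k; rewrite !inE sP.
  rewrite -(card1 ((s^-1)%g i)); apply: eq_card => k; rewrite !inE sP.
  by rewrite eq_sym (can2_eq (permK s) (permKV s)).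
have rowP i : {k | [pred k | M i k != 0] =i pred1 k}.
  exact/mem_card1/eqP/rowM.
have s_inj : injective (fun i => sval (rowP i)).
  move=> i i'; case: (rowP i) (rowP i') => [k Mi] [k' Mi'] /= kk.
  case/(fun h => mem_card1 (eqP h)): (colM k) => i0 Mk.
  have := Mk i; have := Mk i'; rewrite !inE.
  have := Mi k; have := Mi' k; rewrite !inE -kk eqxx => -> ->.
  by move=> /esym/eqP -> /esym/eqP ->.
exists (perm s_inj) => i k; rewrite permE; case: (rowP i) => k0 /= Mi.
by have := Mi k; rewrite !inE.
Qed.

Definition monomial : {pred GL} := fun M => monomial_mx (val M).

Lemma monomial_closed : group_closed monomial.
Proof.
split.
  apply/monomial_mxP; exists 1%g => i k; rewrite mxE perm1 [RHS]eq_sym.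
  by case: (i == k); rewrite ?oner_eq0 ?eqxx.
have mulE (s : 'S_n) (A B : 'M[F]_n) :
  (forall i k, (A i k != 0) = (k == s i)) ->
  forall i k, (A *m B) i k = A i (s i) * B (s i) k.
  move=> sP i k; rewrite mxE (bigD1 (s i)) //= big1 ?addr0 // => l ls.
  by have := sP i l; rewrite (negPf ls) => /negbFE/eqP ->; rewrite mul0r.
move=> A B /monomial_mxP[s sP] /monomial_mxP[t tP].
apply/monomial_mxP; exists (s * t^-1)%g => i k.
have -> : val (A * B^-1)%g = val A *m invmx (val B) by [].
rewrite (mulE s) // mulf_eq0 negb_or sP eqxx /= permM.
have := mulmxV (valP B) => /matrixP/(_ (t^-1 (s i))%g k).
rewrite (mulE t) // permKV mxE => BV.
have tn0 : val B (t^-1 (s i))%g (s i) != 0 by rewrite tP permKV.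
rewrite [RHS]eq_sym; case: eqVneq BV => _ /eqP; last first.
  by rewrite mulf_eq0 (negPf tn0) /= => /eqP ->; rewrite eqxx.
by apply: contraTneq => ->; rewrite mulr0 eq_sym mulr1n oner_eq0.
Qed.

Definition monomial_group := {M : GL | M \in monomial}.
HB.instance Definition _ := Choice.on monomial_group.
HB.instance Definition _ := SubType.on monomial_group.
HB.instance Definition _ :=
  SubChoice_isSubGroup.Build GL monomial monomial_group monomial_closed.

End MonomialGroup.

(* The group of semilinear monomial transformations: the pair (M, g) stands   *)
(* for M g, acting on row vectors by v |-> (v *m M) ^ g.                      *)

Section SemilinearGroup.
Variables (F : finFieldType) (n : nat).
Implicit Types (M : monomial_group F n) (g : ring_aut F).

Lemma conj_GL_subproof (M : GL F n) g : map_mx g (val M) \in unitmx.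
Proof. by rewrite map_unitmx (valP M). Qed.

Definition conj_GL (M : GL F n) g : GL F n :=
  Sub (map_mx g (val M)) (conj_GL_subproof M g).

Lemma conj_monomial_subproof M g : conj_GL (val M) g \in @monomial F n.
Proof.
have /monomial_mxP[s sP] := valP M.
by apply/monomial_mxP; exists s => i k; rewrite /= mxE fmorph_eq0 sP.
Qed.

Definition conj_monomial M g : monomial_group F n :=
  Sub (conj_GL (val M) g) (conj_monomial_subproof M g).

Lemma conj_monomialM g :
  {morph conj_monomial^~ g : M M' / (M * M')%g}.
Proof. by move=> M M'; do 2 apply: val_inj; rewrite /= map_mxM. Qed.

Lemma conj_monomial1 M : conj_monomial M 1%g = M.
Proof. by do 2 apply: val_inj; apply/matrixP => i k; rewrite mxE. Qed.

Lemma conj_monomialA M g h :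
  conj_monomial M (g * h)%g = conj_monomial (conj_monomial M g) h.
Proof. by do 2 apply: val_inj; apply/matrixP => i k; rewrite !mxE. Qed.

Definition entrywise_action : right_action (monomial_group F n) (ring_aut F) :=
  RightAction conj_monomialM conj_monomial1 conj_monomialA.

Definition semilinear_group := semidirect entrywise_action.

Definition slact (w : semilinear_group) (v : 'rV[F]_n) : 'rV[F]_n :=
  map_mx (sdr w) (v *m val (val (sdl w))).

Lemma slact1 v : slact 1%g v = v.
Proof.
have -> : slact 1%g v = map_mx idfun (v *m 1%:M) by [].
by rewrite mulmx1; apply/rowP => i; rewrite mxE.
Qed.

Lemma slactM w w' v : slact (w * w')%g v = slact w' (slact w v).
Proof.
rewrite /slact; have -> : val (val (sdl (w * w')%g)) =
  val (val (sdl w)) *m map_mx (sdr w)^-1%g (val (val (sdl w'))) by [].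
rewrite mulmxA; set X := val (val (sdl w')); set Y := v *m _.
transitivity (map_mx (sdr w') (map_mx (sdr w) (Y *m map_mx (sdr w)^-1%g X))).
  by apply/rowP => i; rewrite [LHS]mxE [RHS]mxE [in RHS]mxE.
rewrite map_mxM; congr (map_mx _ (_ *m _)).
by apply/matrixP => i k; rewrite !mxE /= rautVK.
Qed.

Definition code_stabiliser (C : set 'rV[F]_n) : {pred semilinear_group} :=
  fun w => `[< forall v, C v -> C (slact w v) >].

Lemma code_stabiliser_closed (C : set 'rV[F]_n) :
  group_closed (code_stabiliser C).
Proof.
split=> [|w u /asboolP wC /asboolP uC].
  by apply/asboolP => v; rewrite slact1.
apply/asboolP => v0 Cv0; rewrite slactM.
move: {w wC v0 Cv0}(slact w v0) (wC v0 Cv0) => v Cv.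
pose Cs := [set v | `[< C v >]]%SET.
have sub : slact u @: Cs \subset Cs.
  apply/fintype.subsetP => z /imsetP[b]; rewrite inE => /asboolP Cb ->.
  by rewrite inE; apply/asboolP/uC.
have uK : cancel (slact u) (slact u^-1%g).
  by move=> b; rewrite -slactM mulgV slact1.
have /eqP eqC : slact u @: Cs == Cs.
  by rewrite eqEcard sub card_imset ?leqnn; last exact: can_inj uK.
have : v \in Cs by rewrite inE; apply/asboolP.
by rewrite -eqC => /imsetP[b]; rewrite inE => /asboolP Cb ->; rewrite uK.
Qed.

Definition code_aut (C : set 'rV[F]_n) :=
  {w : semilinear_group | w \in code_stabiliser C}.

Section Instances.
Variable C : set 'rV[F]_n.
HB.instance Definition _ := Choice.on (code_aut C).
HB.instance Definition _ := SubType.on (code_aut C).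
HB.instance Definition _ :=
  SubChoice_isSubGroup.Build semilinear_group (code_stabiliser C) (code_aut C)
    (code_stabiliser_closed C).
End Instances.

End SemilinearGroup.

(* N ><| Aut(F) acts on the scalars of F through its factor Aut(F).           *)

Section ScalarAction.
Variables (F : finFieldType) (N : groupType) (A : right_action N (ring_aut F)).
Implicit Types (a b : {unit F}) (u v : semidirect A).

Definition conj_scalar a u : {unit F} :=
  FinRing.unit F (rmorph_unit (sdr u) (valP a)).

Lemma conj_scalarM u : {morph conj_scalar^~ u : a b / (a * b)%g}.
Proof. by move=> a b; apply: val_inj; rewrite /= rmorphM. Qed.

Lemma conj_scalar1 a : conj_scalar a 1%g = a.
Proof. exact: val_inj. Qed.

Lemma conj_scalarA a u v :
  conj_scalar a (u * v)%g = conj_scalar (conj_scalar a u) v.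
Proof. exact: val_inj. Qed.

Definition scalar_action : right_action {unit F} (semidirect A) :=
  RightAction conj_scalarM conj_scalar1 conj_scalarA.

End ScalarAction.

(* Bivariate polynomials are in {poly {poly K}}, with 'Y := 'X%:P; p.[x, y]   *)
(* substitutes x for 'X and y for 'Y.                                         *)

Definition eval2 (K L : fieldType) (j : K -> L) (x y : L)
  (p : {poly {poly K}}) : L := (map_poly (map_poly j) p).[x, y].

Definition norm_trace_poly (K : fieldType) (q r : nat) : {poly {poly K}} :=
  'X ^+ ((q ^ r - 1) %/ (q - 1))%N - \sum_(i < r) 'Y ^+ (q ^ i)%N.

(* L, with j : K -> L and x, y in L, is the fraction field of K[X, Y] / (f).  *)
Definition is_function_field (K L : fieldType) (j : {rmorphism K -> L})
    (f : {poly {poly K}}) (x y : L) : Prop :=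
  (forall p, eval2 j x y p = 0 <-> exists g, p = g * f) /\
  (forall z, exists p g, eval2 j x y g != 0 /\
                         z = eval2 j x y p / eval2 j x y g).

(* A place of the function field L / K, given by its normalised discrete      *)
(* valuation; the value at 0, which should be infinite, is set to 0 to make   *)
(* the valuation unique, and only nonzero functions are meant to be valuated. *)
Record place (K L : fieldType) (j : {rmorphism K -> L}) := Place {
  pval :> L -> int;
  pval0 : pval 0 = 0;
  pvalM : forall f g, f != 0 -> g != 0 -> pval (f * g) = pval f + pval g;
  pvalD : forall f g, f != 0 -> g != 0 -> f + g != 0 ->
    Num.min (pval f) (pval g) <= pval (f + g);
  pvalC : forall c, pval (j c) = 0;
  pval_unif : exists t, pval t = 1 }.

Section Codes.
Variables (F : finFieldType) (K L : fieldType).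
Variables (iota : {rmorphism F -> K}) (j : {rmorphism K -> L}) (x y : L).

Definition rational_function (f : L) : Prop :=
  exists p g : {poly {poly F}}, eval2 (j \o iota) x y g != 0 /\
    f = eval2 (j \o iota) x y p / eval2 (j \o iota) x y g.

(* The action of g in Aut(F) on the coefficients of f in F(x, y) gives f'.    *)
Definition coef_image (g : ring_aut F) (f f' : L) : Prop :=
  exists p h : {poly {poly F}},
    [/\ eval2 (j \o iota) x y h != 0,
        f = eval2 (j \o iota) x y p / eval2 (j \o iota) x y h &
        f' = eval2 (j \o iota) x y (map_poly (map_poly g) p) /
             eval2 (j \o iota) x y (map_poly (map_poly g) h)].

(* K-automorphisms s of L = K(x, y) are determined by (s x, s y).  This       *)
(* characterises A uniquely, and entails that they are all defined over F.    *)
Definition is_coef_action (A : right_action (kaut j) (ring_aut F)) : Prop :=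
  forall (s : kaut j) (g : ring_aut F),
    coef_image g (val s x) (val (A s g) x) /\
    coef_image g (val s y) (val (A s g) y).

Definition has_value (P : place j) (f : L) (c : K) : Prop :=
  f = j c \/ 0 < P (f - j c).

(* P has degree 1 over F: the residues of the functions of F(x, y) regular    *)
(* at P all lie in F.                                                         *)
Definition rational_place (P : place j) : Prop :=
  forall f, rational_function f -> 0 <= P f ->
    exists c, has_value P f (iota c).

Definition Omega : set (place j) :=
  [set P | rational_place P /\ 0 < P x].

Definition Theta : set (place j) :=
  [set P | rational_place P /\ ~ Omega P].

Definition divisor := place j -> int.

Definition Riemann_Roch_space (E : divisor) : set L :=
  [set f | rational_function f /\ (f = 0 \/ forall P : place j, 0 <= P f + E P)].

(* C_L(D, G), for D the sum of the P_i.                                       *)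
Definition AG_code (n : nat) (P : 'I_n -> place j) (G : divisor) :
    set 'rV[F]_n :=
  [set v | exists f, Riemann_Roch_space G f /\
                     forall i, has_value (P i) f (iota (v 0 i))].

Definition Omega_divisor (l : nat) : divisor :=
  fun P => if `[< Omega P >] then l%:Z else 0.

End Codes.

(* Main.v *)
Require Import Defs.
From HB Require Import structures.
From mathcomp Require Import all_boot all_order all_algebra all_fingroup.
From mathcomp Require Import cyclic separable finfield zify ring.
From mathcomp Require Import boolp classical_sets.
Set Implicit Arguments.
Unset Strict Implicit.
Unset Printing Implicit Defensive.
Import Order.TTheory GRing.Theory Num.Theory.
Local Open Scope ring_scope.

(* Put M = q^(r-1), N = (q^r - 1)/(q - 1) and c = NM - N - M.  The main point *)
(* is that, as r >= 3, the K-automorphisms s of L = K(x, y) fix the place V   *)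
(* at infinity.  The derivation D = d/dx preserves regularity at the affine   *)
(* points and sends the functions of valuation 1 at V to functions of         *)
(* valuation 1 - c; moreover D (s z) = s (D z) D (s x).  If s moved V, then   *)
(* t = s x would have a finite value a at V, and x (t - a)^(M-1) D t would be *)
(* regular at all affine points (at the poles of t because M (M - 1) < c,     *)
(* which fails for r = 2), hence lie in K[x, y]; but its pole order at V      *)
(* would be c, which is not of the form M i + N k.                            *)
(* Thus s x has pole order M and s y has pole order N at V, so both are       *)
(* affine functions of x and y; comparing coefficients in the equation of the *)
(* curve leaves s x = a x and s y = a^N y + f, with a and f in F and f of     *)
(* trace 0.  These automorphisms, and the lifts to L of the automorphisms of  *)
(* F (which are powers of the Frobenius map), preserve F(x, y), Omega, Theta  *)
(* and L(G), and so act on the code by semilinear monomial maps.  The action  *)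
(* is faithful because Theta has a point of the form (1, b).                  *)

(** * Valuations and places *)

(** An automorphism of L permutes the places of L; it acts on codewords as soon as it preserves F(x,
    y), the set Omega and therefore Theta and the divisor. Everything thus rests on the explicit
    shape of the K-automorphisms, found in [aut_form]: x is only rescaled, and y goes to a^N y + f.
    Such a map preserves the zeros of x, and so does the lift of an automorphism of F, which fixes
    x.

    To reach that shape, the unique pole V of x must be shown to be fixed ([regular_false],
    [V_aut]). The constant c, written [c0] below, is 2g - 1 for the genus g = (M - 1)(N - 1)/2, and
    also the largest gap of the semigroup generated by M and N. That the differential dx has divisor
    (2g - 2) V is what [V_D] and [vge_D_affine] replace by direct computations. Places being
    abstract valuations, they are first matched with points: the places where x is regular are the
    solutions of trace b = a^N ([at_point_of_vge], [at_point_ex], [at_point_uniq]), exactly one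
    place remains ([place_inf_ex], [pole_uniq]), and a function regular at all affine points is a
    polynomial in x and y ([regular_polynomial]). Then [aut_affine] compares pole orders at V and
    [aut_form] compares coefficients.

    K-automorphisms and lifts of automorphisms of F are handled together as [semilinear] maps, a
    class closed under products and inverses. A triple of a scalar a, an automorphism s and an
    element g of Aut(F) sends the codeword of a function f to that of g(a) h(f), where h is s
    followed by a lift of g ([code_map_stabiliser]). This is a morphism ([code_aut_mapM]) because
    lifts compose correctly on F(x, y), and it is injective ([code_aut_map_inj]) because g, a and s
    can be read off the semilinear map. *)

Section Places.
Variables (K L : fieldType) (j : {rmorphism K -> L}).
Implicit Types (P Q : place j) (f g : L) (k l : int).

(* [pval] is 0 at 0, so the infinite valuation of 0 is restored by hand. *)
Definition vge P k f := (f == 0) || (k <= P f).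

Lemma place_eq P Q : (forall f, P f = Q f) -> P = Q.
Proof.
case: P Q => [v v0 vM vD vC vu] [w w0 wM wD wC wu] /= /funext vw.
by case: w / vw w0 wM wD wC wu => *; congr Place; exact: Prop_irrelevance.
Qed.

Lemma pval1 P : P 1 = 0.
Proof. by rewrite -(rmorph1 j) pvalC. Qed.

Lemma pvalV P f : P f^-1 = - P f.
Proof.
have [->|f0] := eqVneq f 0; first by rewrite invr0 pval0.
have fV0 : f^-1 != 0 by rewrite invr_eq0.
have := pvalM P f0 fV0; rewrite divff // pval1; lia.
Qed.

Lemma pvalX P f n : P (f ^+ n) = P f *+ n.
Proof.
have [->|f0] := eqVneq f 0.
  by case: n => [|n]; rewrite ?expr0 ?pval1 // expr0n pval0 mul0rn.
elim: n => [|n IHn]; first by rewrite expr0 pval1.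
by rewrite exprS pvalM ?expf_neq0 // IHn mulrS.
Qed.

Lemma pvalN P f : P (- f) = P f.
Proof.
have [->|f0] := eqVneq f 0; first by rewrite oppr0.
have j1 : j (-1) = -1 by rewrite rmorphN rmorph1.
by rewrite -mulN1r -j1 pvalM ?pvalC ?add0r // j1 oppr_eq0 oner_eq0.
Qed.

Lemma vge0 P k : vge P k 0. Proof. by rewrite /vge eqxx. Qed.

Lemma vgeE P k f : f != 0 -> vge P k f = (k <= P f).
Proof. by rewrite /vge => /negPf ->. Qed.

Lemma vge_weaken P k l f : l <= k -> vge P k f -> vge P l f.
Proof. by rewrite /vge => lk /orP[->//|kf]; rewrite (le_trans lk kf) orbT. Qed.

Lemma vgeC P c : vge P 0 (j c).
Proof. by rewrite /vge pvalC lexx orbT. Qed.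

Lemma vgeN P k f : vge P k (- f) = vge P k f.
Proof. by rewrite /vge pvalN oppr_eq0. Qed.

Lemma vgeD P k f g : vge P k f -> vge P k g -> vge P k (f + g).
Proof.
rewrite /vge; have [->|f0] := eqVneq f 0; first by rewrite add0r.
have [->|g0] := eqVneq g 0; first by rewrite addr0 => *; apply/orP; right.
have [->//|fg0] /= := eqVneq (f + g) 0 => kf kg.
by apply: le_trans (pvalD P f0 g0 fg0); rewrite le_min kf.
Qed.

Lemma vge_sum P k (I : Type) (s : seq I) (p : pred I) (E : I -> L) :
  (forall i, p i -> vge P k (E i)) -> vge P k (\sum_(i <- s | p i) E i).
Proof.
by move=> kE; elim/big_ind: _ => //; [exact: vge0|move=> f g; exact: vgeD].
Qed.

Lemma vgeM P k l f g : vge P k f -> vge P l g -> vge P (k + l) (f * g).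
Proof.
rewrite /vge mulf_eq0; have [//|f0 /=] := eqVneq f 0.
by have [//|g0 /= kf lg] := eqVneq g 0; rewrite pvalM //; lia.
Qed.

Lemma vgeX P k f n : vge P k f -> vge P (k *+ n) (f ^+ n).
Proof.
move=> kf; elim: n => [|n IHn]; last by rewrite exprS mulrS vgeM.
by rewrite expr0 -(rmorph1 j) vgeC.
Qed.

Lemma vge_horner P (p : {poly K}) f : vge P 0 f -> vge P 0 (map_poly j p).[f].
Proof.
move=> f0; rewrite horner_coef; apply: vge_sum => i _; rewrite coef_map /=.
rewrite -[X in vge P X]addr0; apply: vgeM; first exact: vgeC.
by rewrite -(mul0rn _ i); exact: vgeX.
Qed.

Lemma pval_add P f g : f != 0 -> g != 0 -> f + g != 0 ->
  P f <= P (f + g) \/ P g <= P (f + g).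
Proof.
by move=> f0 g0 fg0; apply/orP; rewrite -ge_min; exact: pvalD.
Qed.

(** Strict triangle inequality: were the valuation of [f + g] larger than that of [f], writing [f]
    as [(f + g) - g] would give [f] too large a valuation. *)
Lemma pval_dom P f g : f != 0 -> vge P (P f + 1) g ->
  f + g != 0 /\ P (f + g) = P f.
Proof.
move=> f0; have [->|g0] := eqVneq g 0; first by rewrite addr0.
rewrite vgeE // => fg.
have fg0 : f + g != 0.
  apply: contraTneq fg => /eqP; rewrite addr_eq0 => /eqP ->.
  by rewrite pvalN; lia.
have gN0 : - g != 0 by rewrite oppr_eq0.
have := pval_add P fg0 gN0; rewrite addrK pvalN => /(_ f0) fgf.
by split=> //; have := pval_add P f0 g0 fg0; lia.
Qed.

Lemma has_valueP P f c : has_value P f c <-> vge P 1 (f - j c).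
Proof.
rewrite /has_value /vge subr_eq0 -gtz0_ge1.
by split=> [[->|->]|/orP[/eqP->|->]]; rewrite ?eqxx ?orbT; auto.
Qed.

Lemma has_value_uniq P f c d : has_value P f c -> has_value P f d -> c = d.
Proof.
rewrite !has_valueP => fc fd; apply/eqP; rewrite -subr_eq0.
apply/negPn/negP => cd; have := vgeD fd (etrans (vgeN P 1 _) fc).
have -> : f - j d - (f - j c) = j (c - d) by rewrite rmorphB; ring.
by rewrite vgeE ?fmorph_eq0 // pvalC.
Qed.

Lemma has_value_vge P f c : has_value P f c -> vge P 0 f.
Proof.
move=> /has_valueP fc; rewrite -(subrK (j c) f); apply: vgeD (vgeC P c).
exact: vge_weaken fc.
Qed.

Lemma has_valueD P f g c d : has_value P f c -> has_value P g d ->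
  has_value P (f + g) (c + d).
Proof.
by rewrite !has_valueP rmorphD opprD addrACA; exact: vgeD.
Qed.

Lemma has_valueC P c : has_value P (j c) c. Proof. by left. Qed.

Lemma has_valueM P f g c d : has_value P f c -> has_value P g d ->
  has_value P (f * g) (c * d).
Proof.
move=> fc gd; rewrite has_valueP rmorphM.
have -> : f * g - j c * j d = (f - j c) * g + j c * (g - j d) by ring.
apply: vgeD.
  by rewrite -[1]addr0; apply: vgeM; [exact/has_valueP|exact: has_value_vge gd].
by rewrite -[1]add0r; apply: vgeM; [exact: vgeC|exact/has_valueP].
Qed.

Lemma has_valueX P f c n : has_value P f c -> has_value P (f ^+ n) (c ^+ n).
Proof.
move=> fc; elim: n => [|n IHn]; last by rewrite !exprS; exact: has_valueM.
by rewrite !expr0 -(rmorph1 j); exact: has_valueC.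
Qed.

Lemma has_value_horner P (p : {poly K}) f c :
  has_value P f c -> has_value P (map_poly j p).[f] p.[c].
Proof.
move=> fc; elim/poly_ind: p => [|p a IHp].
  by rewrite rmorph0 !horner0 -(rmorph0 j); exact: has_valueC.
rewrite rmorphD rmorphM /= map_polyX map_polyC /= !hornerE.
exact: has_valueD (has_valueM IHp fc) (has_valueC P a).
Qed.

Lemma has_value_neq0 P f c : has_value P f c -> c != 0 -> f != 0 /\ P f = 0.
Proof.
move=> /has_valueP fc c0; have jc0 : j c != 0 by rewrite fmorph_eq0.
have := @pval_dom P (j c) (f - j c) jc0; rewrite pvalC add0r subrKC.
exact.
Qed.

Lemma has_valueV P f c : has_value P f c -> c != 0 -> has_value P f^-1 c^-1.
Proof.
move=> fc c0; have [f0 Pf] := has_value_neq0 fc c0.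
have jc0 : j c != 0 by rewrite fmorph_eq0.
rewrite has_valueP fmorphV; have -> : f^-1 - (j c)^-1 = (- (f - j c)) * (f * j c)^-1.
  by field; rewrite f0 jc0.
rewrite -[1]addr0; apply: vgeM; first by rewrite vgeN; apply/has_valueP.
by rewrite vgeE ?invr_eq0 ?mulf_neq0 // pvalV pvalM // pvalC Pf.
Qed.

Section Composition.
Variables (h : ring_aut L) (tau : K -> K).
Hypothesis htau : forall c, h (j c) = j (tau c).

Lemma pval_comp0 P : P (h 0) = 0. Proof. by rewrite rmorph0 pval0. Qed.
Lemma pval_compM P f g : f != 0 -> g != 0 -> P (h (f * g)) = P (h f) + P (h g).
Proof. by move=> f0 g0; rewrite rmorphM pvalM ?fmorph_eq0. Qed.
Lemma pval_compD P f g : f != 0 -> g != 0 -> f + g != 0 ->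
  Num.min (P (h f)) (P (h g)) <= P (h (f + g)).
Proof.
by move=> f0 g0 fg0; rewrite rmorphD pvalD -?rmorphD ?fmorph_eq0.
Qed.
Lemma pval_compC P c : P (h (j c)) = 0. Proof. by rewrite htau pvalC. Qed.
Lemma pval_comp_unif P : exists t, P (h t) = 1.
Proof. by have [t Pt] := pval_unif P; exists (raut_inv h t); rewrite rautVK. Qed.

(** The pullback of [P] along [h], still normalised because [h] is onto. The map [tau] leaves room
    for automorphisms that move the constants. *)
Definition place_comp P : place j :=
  Place (pval_comp0 P) (@pval_compM P) (@pval_compD P) (pval_compC P)
    (pval_comp_unif P).

Lemma vge_comp P k f : vge (place_comp P) k f = vge P k (h f).
Proof. by rewrite /vge fmorph_eq0. Qed.

End Composition.

Section PlaceOfOrder.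
Variable ord : L -> int -> Prop.
Hypothesis ord_ex : forall f, f != 0 -> exists k, ord f k.
Hypothesis ord_uniq : forall f k l, ord f k -> ord f l -> k = l.
Hypothesis ordM : forall f g k l, ord f k -> ord g l -> ord (f * g) (k + l).
Hypothesis ordD : forall f g k l m, f != 0 -> g != 0 ->
  ord f k -> ord g l -> ord (f + g) m -> Num.min k l <= m.
Hypothesis ordC : forall c, c != 0 -> ord (j c) 0.
Hypothesis ord_unif : exists2 t, t != 0 & ord t 1.

(** Orders arise as relations, through a choice of representation of the function; this turns such a
    relation into a place, both at affine points and at infinity. *)
Lemma place_of_ord : exists P : place j, forall f, f != 0 -> ord f (P f).
Proof.
have [v vP] : {v : L -> int & v 0 = 0 /\ forall f, f != 0 -> ord f (v f)}.
  apply/cid; pose v f := if pselect (f != 0) is left f0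
    then sval (cid (ord_ex f0)) else 0.
  exists v; split=> [|f f0]; first by rewrite /v; case: pselect => // f0; case/eqP: (f0).
  by rewrite /v; case: pselect => // f0'; case: cid.
have [v0 {}vP] := vP.
have vM f g : f != 0 -> g != 0 -> v (f * g) = v f + v g.
  move=> f0 g0; apply: ord_uniq (vP _ _) (ordM (vP _ f0) (vP _ g0)).
  by rewrite mulf_neq0.
have vD f g : f != 0 -> g != 0 -> f + g != 0 -> Num.min (v f) (v g) <= v (f + g).
  by move=> f0 g0 fg0; apply: (ordD f0 g0 (vP _ f0) (vP _ g0) (vP _ fg0)).
have vC c : v (j c) = 0.
  have [->|c0] := eqVneq c 0; first by rewrite rmorph0.
  by apply: ord_uniq (vP _ _) (ordC c0); rewrite fmorph_eq0.
have vu : exists t, v t = 1.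
  by have [t t0 t1] := ord_unif; exists t; apply: ord_uniq (vP _ t0) t1.
by exists (Place v0 vM vD vC vu).
Qed.

End PlaceOfOrder.
End Places.

Lemma subn1_div_subn1 q r : (1 < q)%N ->
  ((q ^ r - 1) %/ (q - 1))%N = (\sum_(i < r) q ^ i)%N.
Proof. by move=> q1; rewrite !subn1 predn_exp mulKn //; lia. Qed.

(** * Bivariate polynomials and their values at functions *)

Section SwapXY.
Variable R : comNzRingType.
Implicit Types (u v : {poly {poly R}}).

Lemma swapXYB u v : swapXY (u - v) = swapXY u - swapXY v.
Proof. exact: rmorphB. Qed.

Lemma swapXYN u : swapXY (- u) = - swapXY u.
Proof. exact: rmorphN. Qed.

Lemma swapXYM u v : swapXY (u * v) = swapXY u * swapXY v.
Proof. exact: rmorphM. Qed.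

Lemma swapXYXn u n : swapXY (u ^+ n) = swapXY u ^+ n.
Proof. exact: rmorphXn. Qed.

End SwapXY.

Section Eval2.
Variables (K L : fieldType) (j : {rmorphism K -> L}) (x y : L).
Implicit Types (u v : {poly {poly K}}).

Lemma eval2_zmod_morphism : zmod_morphism (eval2 j x y).
Proof. by move=> u v; rewrite /eval2 rmorphB !hornerE. Qed.

Lemma eval2_monoid_morphism : GRing.monoid_morphism (eval2 j x y).
Proof.
by split=> [|u v]; rewrite /eval2 ?rmorph1 ?rmorphM /= !hornerE.
Qed.

HB.instance Definition _ :=
  GRing.isZmodMorphism.Build _ _ (eval2 j x y) eval2_zmod_morphism.
HB.instance Definition _ :=
  GRing.isMonoidMorphism.Build _ _ (eval2 j x y) eval2_monoid_morphism.

Lemma eval2B u v : eval2 j x y (u - v) = eval2 j x y u - eval2 j x y v.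
Proof. exact: rmorphB. Qed.

Lemma eval2D u v : eval2 j x y (u + v) = eval2 j x y u + eval2 j x y v.
Proof. exact: rmorphD. Qed.

Lemma eval2M u v : eval2 j x y (u * v) = eval2 j x y u * eval2 j x y v.
Proof. exact: rmorphM. Qed.

Lemma eval2_0 : eval2 j x y 0 = 0.
Proof. exact: rmorph0. Qed.

Lemma eval2_polyC c : eval2 j x y c%:P = (map_poly j c).[y].
Proof. by rewrite /eval2 map_polyC hornerC. Qed.

Lemma eval2C c : eval2 j x y c%:P%:P = j c.
Proof. by rewrite eval2_polyC map_polyC hornerC. Qed.

Lemma eval2X : eval2 j x y 'X = x.
Proof. by rewrite /eval2 map_polyX !hornerE. Qed.

Lemma eval2Y : eval2 j x y 'Y = y.
Proof. by rewrite eval2_polyC map_polyX hornerX. Qed.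

Lemma eval2_XsubC c : eval2 j x y ('X - c%:P)%:P = y - j c.
Proof. by rewrite eval2_polyC rmorphB /= map_polyX map_polyC !hornerE. Qed.

Lemma eval2_XsubC2 c : eval2 j x y ('X - c%:P%:P) = x - j c.
Proof. by rewrite rmorphB /= eval2X eval2C. Qed.

Lemma eval2E u : eval2 j x y u =
  \sum_(i < size u) (map_poly j u`_i).[y] * x ^+ i.
Proof.
rewrite -{1}[u]coefK poly_def rmorph_sum; apply: eq_bigr => i _.
by rewrite -mul_polyC rmorphM rmorphXn /= eval2_polyC eval2X.
Qed.

Lemma has_value_eval2 (P : place j) u a b :
  has_value P x a -> has_value P y b -> has_value P (eval2 j x y u) u.[a, b].
Proof.
move=> xa yb; elim/poly_ind: u => [|u c IHu].
  by rewrite rmorph0 !horner0 -(rmorph0 j); exact: has_valueC.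
rewrite rmorphD rmorphM /= eval2X eval2_polyC !hornerE.
apply: has_valueD; first exact: has_valueM.
exact: has_value_horner.
Qed.

End Eval2.

Lemma eval2_swapXY (K L : fieldType) (j : {rmorphism K -> L}) x y u :
  eval2 j x y (swapXY u) = eval2 j y x u.
Proof. by rewrite /eval2 -[in LHS]swapXY_map horner2_swapXY. Qed.

Lemma eval2_comp (F K L : fieldType) (i : {rmorphism F -> K})
    (j : {rmorphism K -> L}) x y u :
  eval2 (j \o i) x y u = eval2 j x y (map_poly (map_poly i) u).
Proof.
rewrite /eval2 -map_poly_comp_id0; last by rewrite rmorph0.
by congr (_.[_, _]); apply: eq_map_poly => c /=; rewrite map_poly_comp.
Qed.

Lemma semilinear_eval2 (K L L' : fieldType) (j : {rmorphism K -> L})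
    (j' : {rmorphism K -> L'}) (t : {rmorphism K -> K}) (h : {rmorphism L -> L'}) :
  (forall c, h (j c) = j' (t c)) -> forall x y u,
  h (eval2 j x y u) = eval2 j' (h x) (h y) (map_poly (map_poly t) u).
Proof.
move=> hj x y u; elim/poly_ind: u => [|u c IHu]; first by rewrite !rmorph0.
rewrite !(rmorphD, rmorphM) /= IHu !map_polyC map_polyX !eval2X !eval2_polyC /=.
congr (_ + _); rewrite -horner_map -!map_poly_comp.
by congr (_.[_]); apply: eq_map_poly => a /=.
Qed.

Lemma horner2_map (F K : comNzRingType) (i : {rmorphism F -> K}) u a b :
  (map_poly (map_poly i) u).[i b, i a] = i u.[b, a].
Proof. by rewrite -(map_polyC i b) !horner_map. Qed.

(** * General rules for derivations *)

Section Derivations.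
Variables (L : fieldType) (G : L -> L).
Hypothesis GB : forall z t, G (z - t) = G z - G t.
Hypothesis GM : forall z t, G (z * t) = G z * t + z * G t.

Lemma der0 : G 0 = 0.
Proof. by have := GB 0 0; rewrite !subrr. Qed.

Lemma derN z : G (- z) = - G z.
Proof. by have := GB 0 z; rewrite !sub0r der0 sub0r. Qed.

Lemma derD z t : G (z + t) = G z + G t.
Proof. by have := GB z (- t); rewrite opprK derN opprK. Qed.

Lemma der_sum (I : Type) (s : seq I) (E : I -> L) :
  G (\sum_(i <- s) E i) = \sum_(i <- s) G (E i).
Proof. exact: (big_morph G derD der0). Qed.

Lemma der1 : G 1 = 0.
Proof.
have := GM 1 1; rewrite !mulr1 mul1r => /eqP.
by rewrite -[X in X == _]addr0 (inj_eq (addrI _)) eq_sym => /eqP.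
Qed.

Lemma derX z n : G (z ^+ n) = (z ^+ n.-1 * G z) *+ n.
Proof.
elim: n => [|n IHn]; first by rewrite expr0 der1 mulr0n.
rewrite exprS GM IHn mulrnAr mulrA /=.
case: n {IHn} => [|n]; first by rewrite mulr0n addr0 mulrC.
by rewrite -exprS [in RHS]mulrS [G z * _]mulrC.
Qed.

Lemma derV z : z != 0 -> G z^-1 = - G z / z ^+ 2.
Proof.
move=> z0; have := GM z z^-1; rewrite divff // der1.
move=> /esym/eqP; rewrite addrC addr_eq0 => /eqP E.
by apply: (mulfI z0); rewrite E; field.
Qed.

End Derivations.

(** * Automorphisms of finite fields *)

Section FiniteField.
Variables (F : finFieldType) (p d : nat).
Hypotheses (p_prime : prime p) (d_gt0 : (0 < d)%N) (cardF : #|F| = (p ^ d)%N).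

Lemma finField_pchar : p \in [pchar F].
Proof. exact: card_finPcharP cardF p_prime. Qed.

(** X^p - X has at most p roots, and the first p multiples of 1 are already p distinct ones. *)
Lemma prime_subfieldP (c : F) : c ^+ p = c -> exists n, c = n%:R.
Proof.
move=> cp; have pF := finField_pchar; have p1 := prime_gt1 p_prime.
pose s : seq F := [seq n%:R | n <- iota 0 p].
have us : uniq s.
  have nat_le (m n : nat) : (m <= n < p)%N -> m%:R = n%:R :> F -> m = n.
    move=> /andP[mn np] /eqP; rewrite eq_sym -subr_eq0 -natrB // -(dvdn_pcharf pF).
    by move=> /dvdn_leq; lia.
  rewrite map_inj_in_uniq ?iota_uniq // => m n; rewrite !mem_iota /= !add0n => mp np E.
  by case: (leqP m n) => [|/ltnW] h; [|symmetry]; apply: nat_le; rewrite // h.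
suff /mapP[n _ ->] : c \in s by exists n.
apply: contraT => cs; have : (size (c :: s) < size ('X^p - 'X : {poly F})%R)%N.
  apply: max_poly_roots.
  - by rewrite -size_poly_gt0 size_polyDl ?size_polyXn // size_polyN size_polyX.
  - have rootX (a : F) : a ^+ p = a -> root ('X^p - 'X) a.
      by move=> ap; rewrite rootE !hornerE ap subrr.
    apply/allP => a; rewrite inE => /orP[/eqP->|/mapP[n _ ->]]; apply: rootX => //.
    by rewrite -[LHS](pFrobenius_autE pF) rmorph_nat.
  - by rewrite /= cs.
by rewrite size_polyDl ?size_polyN ?size_polyX ?size_polyXn // /= size_map size_iota ltnn.
Qed.

(* A generator w of the unit group and its image are both roots of the        *)
(* product of the X - w^(p^k), whose coefficients lie in the prime field.     *)
Lemma finField_aut_Frobenius (g : ring_aut F) :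
  exists k, forall c, g c = c ^+ (p ^ k).
Proof.
have pF := finField_pchar; pose phi := pFrobenius_aut pF.
have /cyclicP[w wE] := field_unit_group_cyclic [set: {unit F}]%G.
pose f k : {poly F} := 'X - (val w ^+ (p ^ k))%:P.
pose h := \prod_(k < d) f k.
have fd : f d = f 0 by rewrite /f -cardF expf_card expn0 expr1.
have hE : \prod_(k < d) f k.+1 = h.
  have f0 : f 0 != 0 by rewrite polyXsubC_eq0.
  have : \prod_(k < d.+1) f k = f 0 * \prod_(k < d) f k.+1 by rewrite big_ord_recl.
  by rewrite big_ord_recr /= fd mulrC => /(mulfI f0).
have hphi : map_poly phi h = h.
  rewrite rmorph_prod -hE; apply: eq_bigr => k _.
  by rewrite [LHS]map_polyXsubC /= pFrobenius_autE -exprM -expnSr.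
have hg : map_poly g h = h.
  apply/polyP => i; rewrite coef_map /=.
  have /prime_subfieldP[n ->] : h`_i ^+ p = h`_i; last exact: rmorph_nat.
  by rewrite -[in RHS]hphi coef_map [RHS]pFrobenius_autE.
have : root h (g (val w)).
  rewrite -hg rootE horner_map fmorph_eq0 horner_prod.
  apply/prodf_eq0; exists (Ordinal d_gt0) => //.
  by rewrite /= /f !hornerE expn0 expr1 subrr.
rewrite /root horner_prod => /prodf_eq0[k _ /=].
rewrite /f !hornerE subr_eq0 => /eqP gw; exists k => c.
have [->|c0] := eqVneq c 0; first by rewrite rmorph0 expr0n expn_eq0 eqn0Ngt prime_gt0.
have cU : c \is a GRing.unit by rewrite unitfE.
have : FinRing.unit F cU \in <[w]>%g by rewrite -wE inE.
move=> /cycleP[n /(congr1 val)]; rewrite /= FinRing.val_unitX => ->.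
by rewrite rmorphXn /= gw -!exprM mulnC.
Qed.

End FiniteField.

(** * The coordinate ring of the curve *)

Section NormTrace.
Variables (p e q r : nat).
Hypotheses (p_prime : prime p) (e_gt0 : (0 < e)%N).
Hypotheses (q_def : q = (p ^ e)%N) (r_ge3 : (3 <= r)%N).

Local Notation M := (q ^ r.-1)%N.
Local Notation N := (\sum_(i < r) q ^ i)%N.

Lemma q_gt1 : (1 < q)%N.
Proof. by rewrite q_def -(exp1n e) ltn_exp2r // prime_gt1. Qed.

(** Here S = 1 + q + ... + q^(r-2). The bound [3 <= S] is the form in which r >= 3 enters most
    estimates below. *)
Lemma sum_q_bounds : exists S, [/\ N = (M + S)%N, (3 <= S)%N & (S < M)%N].
Proof.
have q1 := q_gt1; exists (\sum_(i < r.-1) q ^ i)%N.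
case: r r_ge3 => [|[|[|s]]] //= _; split; first by rewrite big_ord_recr addnC.
  by rewrite big_ord_recl big_ord_recl /= expn0 expn1; lia.
have := predn_exp q s.+2; have : (0 < q ^ s.+2)%N by rewrite expn_gt0; lia.
by move: (\sum_(i < s.+2) q ^ i)%N (q ^ s.+2)%N => a b; nia.
Qed.

Lemma N_mod_q : exists k, N = (q * k).+1.
Proof.
case: r r_ge3 => [//|s] _; rewrite big_ord_recl expn0 add1n.
exists (\sum_(i < s) q ^ i)%N; rewrite big_distrr /=; congr S.
by apply: eq_bigr => i _; rewrite -expnS.
Qed.

Lemma coprime_MN : coprime M N.
Proof.
have [k ->] := N_mod_q; apply: coprimeXl.
exact: coprime_dvdl (dvdn_mulr k (dvdnn q)) (coprimenS _).
Qed.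

Variables (K : closedFieldType) (charK : p \in [pchar K]).

Lemma pchar_q_nat (R : nzRingType) : p \in [pchar R] -> [pchar R].-nat q.
Proof.
move=> pR; rewrite (eq_pnat _ (pcharf_eq pR)) q_def pnatX pnat_id //.
Qed.

Lemma pchar_Xq_nat (R : nzRingType) i : p \in [pchar R] -> [pchar R].-nat (q ^ i)%N.
Proof. by move=> pR; rewrite pnatX pchar_q_nat. Qed.

Lemma natN1 : N%:R = 1 :> K.
Proof.
have [k ->] := N_mod_q; rewrite -addn1 natrD natrM q_def.
have : (p ^ e)%:R = 0 :> K.
  by apply/eqP; rewrite -(dvdn_pcharf charK); exact: dvdn_exp.
by move=> ->; rewrite mul0r add0r.
Qed.

Lemma natM0 : M%:R = 0 :> K.
Proof.
apply/eqP; rewrite -(dvdn_pcharf charK) q_def -expnM dvdn_exp //.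
by case: r r_ge3 => [|[|s]] //; lia.
Qed.

Definition trace (R : pzSemiRingType) (z : R) : R := \sum_(i < r) z ^+ (q ^ i).

Lemma rmorph_trace (R S : pzSemiRingType) (f : {rmorphism R -> S}) z :
  f (trace z) = trace (f z).
Proof. by rewrite rmorph_sum; apply: eq_bigr => i _; rewrite rmorphXn. Qed.

Lemma traceD (R : comNzRingType) (z t : R) : p \in [pchar R] ->
  trace (z + t) = trace z + trace t.
Proof.
move=> pR; rewrite -big_split; apply: eq_bigr => i _.
by rewrite exprDn_pchar ?pchar_Xq_nat.
Qed.

Variables (L : fieldType) (j : {rmorphism K -> L}) (x y : L).
Hypothesis ffL : is_function_field j (norm_trace_poly K q r) x y.

(* The inner variable stands for x and the outer one for y, in which the      *)
(* equation of the curve is monic.                                            *)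
Local Notation ev := (eval2 j y x).
Definition curve : {poly {poly K}} := trace 'X - ('X ^+ N)%:P.

Lemma swapXY_curve : swapXY (norm_trace_poly K q r) = - curve.
Proof.
rewrite /norm_trace_poly (subn1_div_subn1 r q_gt1) /curve opprB.
rewrite swapXYB swapXYXn swapXY_X -(rmorphXn polyC).
rewrite (rmorph_sum swapXY) /=; congr (_ - _).
by apply: eq_bigr => i _; rewrite swapXYXn swapXY_Y.
Qed.

Lemma ev_eq0 u : ev u = 0 <-> exists g : {poly {poly K}}, u = g * curve.
Proof.
rewrite -eval2_swapXY; split.
  move=> /(proj1 ffL)[g ug]; exists (- swapXY g).
  by rewrite mulNr -mulrN -swapXY_curve -swapXYM -ug swapXYK.
case=> g ->; apply/(proj1 ffL); exists (- swapXY g).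
rewrite swapXYM mulNr -mulrN; congr (_ * _).
by rewrite -[curve]opprK -swapXY_curve swapXYN swapXYK.
Qed.

Lemma curve0 : ev curve = 0.
Proof. by apply/ev_eq0; exists 1; rewrite mul1r. Qed.

Lemma curveE : trace y = x ^+ N.
Proof.
have /eqP := curve0; rewrite eval2B (rmorph_trace ev) /= eval2X eval2_polyC.
by rewrite subr_eq0 => /eqP ->; rewrite map_polyXn hornerXn.
Qed.

Lemma size_trace (R : nzRingType) : size (trace ('X : {poly R})) = M.+1 /\
  trace ('X : {poly R}) \is monic.
Proof.
have q1 := q_gt1; rewrite /trace; case: r r_ge3 => [//|s] _; rewrite big_ord_recr.
set t := \sum_(i < s) _ => /=; have tM : (size t < size ('X^(q ^ s) : {poly R}))%N.
  rewrite size_polyXn ltnS; apply: (leq_trans (size_sum _ _ _)).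
  by apply/bigmax_leqP => i _; rewrite size_polyXn ltn_exp2l /=.
by rewrite addrC size_polyDl // monicE lead_coefDl // lead_coefXn size_polyXn.
Qed.

Lemma M_gt0 : (0 < M)%N.
Proof. by rewrite expn_gt0 ltnW // q_gt1. Qed.

Lemma size_curve : size curve = M.+1 /\ curve \is monic.
Proof.
have [s1 /monicP s2] := size_trace {poly K}; rewrite /curve.
have h : (size (- ('X ^+ N)%:P : {poly {poly K}}) <
          size (trace ('X : {poly {poly K}})))%N.
  by rewrite size_polyN s1 ltnS (leq_trans (size_polyC_leq1 _)) ?M_gt0.
by rewrite size_polyDl // monicE lead_coefDl // s1 s2.
Qed.

Lemma curve_neq0 : curve != 0.
Proof. by apply: monic_neq0; case: size_curve. Qed.

(** The equation is monic of degree M in y, so every element of K[x, y] has exactly one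
    representative of y-degree below M; uniqueness is [ev_inj2]. *)
Definition normal_form u := Pdiv.Ring.rmodp u curve.

Lemma ev_normal_form u : ev (normal_form u) = ev u.
Proof.
have [_ cm] := size_curve.
by rewrite [in RHS](Pdiv.RingMonic.rdivp_eq cm u) eval2D eval2M curve0 mulr0 add0r.
Qed.

Lemma size_normal_form u : (size (normal_form u) <= M)%N.
Proof.
have [sc cm] := size_curve.
by have := Pdiv.Ring.ltn_rmodpN0 u curve_neq0; rewrite sc ltnS.
Qed.

Lemma ev_inj (u : {poly {poly K}}) : (size u <= M)%N -> ev u = 0 -> u = 0.
Proof.
move=> uM /ev_eq0[g uE]; apply/eqP; apply: contraTT uM; rewrite uE => gc.
have [sc cm] := size_curve; have g0 : g != 0.
  by apply: contraNneq gc => ->; rewrite mul0r.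
by rewrite size_Mmonic // sc -ltnNge addnS /= -[ltnLHS]add0n ltn_add2r size_poly_gt0.
Qed.

Lemma ev_inj2 u v : ev u = ev v -> (size u <= M)%N -> (size v <= M)%N -> u = v.
Proof.
move=> uv uM vM; have uv0 : ev (u - v) = 0 by rewrite eval2B uv subrr.
apply/subr0_eq; apply: ev_inj uv0.
by rewrite (leq_trans (size_polyD _ _)) // geq_max uM size_polyN.
Qed.

Lemma ev_polyC_eq0 c : (ev c%:P == 0) = (c == 0).
Proof.
apply/eqP/eqP => [/ev_inj|->]; last by rewrite !rmorph0.
rewrite (leq_trans (size_polyC_leq1 _)) ?M_gt0 // => /(_ isT)/eqP.
by rewrite polyC_eq0 => /eqP.
Qed.

Lemma ev_repr z : exists u h, ev h != 0 /\ z = ev u / ev h.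
Proof.
have [u [h [h0 ->]]] := proj2 ffL z.
by exists (swapXY u), (swapXY h); rewrite !eval2_swapXY.
Qed.

(** K[x, y] is integral over K[x]: the resultant of u and the curve with respect to y is a multiple
    of u lying in K[x]. *)
Lemma ev_dvd_polyC u : ev u != 0 ->
  exists w d, d != 0 /\ ev u * ev w = ev d%:P.
Proof.
move=> u0; have [|su] := leqP (size u) 1%N.
  move=> /size1_polyC uE; exists 1, u`_0; rewrite rmorph1 mulr1 -uE; split=> //.
  by apply: contraNneq u0 => u00; rewrite uE u00 !rmorph0.
have [sc cm] := size_curve; have [R0|R0] := eqVneq (resultant curve u) 0; last first.
  have sc1 : (1 < size curve)%N by rewrite sc ltnS M_gt0.
  have [[a b] _ /= RE] := resultant_in_ideal sc1 su.
  exists b, (resultant curve u); split=> //.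
  by rewrite RE rmorphD !rmorphM /= curve0 mulr0 add0r mulrC.
(* A zero resultant gives a common factor g of positive y-degree. Up to a constant of K[x], the
   curve is k g; as L is a field, either [ev k = 0], so that the curve divides k against the
   degrees, or [ev g = 0], and then [ev u = 0]. *)
have /eqP := R0; rewrite resultant_eq0; set g := gcdp _ _ => sg.
have scale_ev (c : {poly K}) v : ev (c *: v) = ev c%:P * ev v.
  by rewrite -mul_polyC rmorphM.
have gc : g %| curve by exact: dvdp_gcdl.
have gu : g %| u by exact: dvdp_gcdr.
have lg n : lead_coef g ^+ n != 0.
  by rewrite expf_neq0 // lead_coef_eq0 -size_poly_gt0 ltnW.
move: gc gu; rewrite !Pdiv.Idomain.dvdp_eq; set c := _ ^+ _; set c' := _ ^+ _.
move=> /eqP cE /eqP uE; have : ev (c *: curve) = 0 by rewrite scale_ev curve0 mulr0.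
rewrite cE rmorphM /= => /eqP; rewrite mulf_eq0 => /orP[/eqP|] k0; last first.
  case/negP: u0; have /eqP := congr1 ev uE; rewrite scale_ev rmorphM /= (eqP k0).
  by rewrite mulr0 mulf_eq0 ev_polyC_eq0 (negPf (lg _)).
have kg0 : curve %/ g * g != 0 by rewrite -cE -size_poly_eq0 size_scale ?lg // sc.
have := congr1 (size : {poly {poly K}} -> nat) cE; rewrite size_scale ?lg // sc.
have [h kE] := proj1 (ev_eq0 _) k0; move: kg0; rewrite kE !mulf_eq0 !negb_or.
move=> /andP[/andP[h0 c0] g0]; rewrite size_mul ?mulf_neq0 // size_Mmonic // sc.
have aux (s t m : nat) : (0 < s)%N -> (1 < t)%N -> m.+1 <> ((s + m.+1).-1 + t).-1.
  by lia.
by move=> /aux; rewrite size_poly_gt0 h0 sg => /(_ isT isT).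
Qed.

Lemma curve_at a b : curve.[b, a] = trace b - a ^+ N.
Proof.
rewrite -[LHS]/((horner_eval a \o horner_eval b%:P) curve) rmorphB rmorph_trace /=.
by rewrite /horner_eval !hornerE.
Qed.

Section Point.
Variables (a b : K).
Hypothesis Pab : trace b = a ^+ N.

Lemma ev_value0 u : ev u = 0 -> u.[b, a] = 0.
Proof.
by move=> /ev_eq0[g ->]; rewrite !hornerM curve_at Pab subrr mulr0.
Qed.

Lemma ev_value u v : ev u = ev v -> u.[b, a] = v.[b, a].
Proof.
move=> uv; have : ev (u - v) = 0 by rewrite eval2B uv subrr.
by move=> /ev_value0/eqP; rewrite !(hornerD, hornerN) subr_eq0 => /eqP.
Qed.

Lemma ev_value_neq0 u : u.[b, a] != 0 -> ev u != 0.
Proof. by apply: contraNneq => /ev_value0 ->. Qed.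

(** Membership in the local ring of the curve at the point (a, b). *)
Definition regular z := exists u h, h.[b, a] != 0 /\ z * ev h = ev u.

End Point.

Lemma deriv_trace (R : comNzRingType) : p \in [pchar R] ->
  (trace ('X : {poly R}))^`() = 1.
Proof.
move=> pR; rewrite raddf_sum /=.
case: r r_ge3 => [//|t] _; rewrite big_ord_recl /= expn0 expr1 derivX big1 ?addr0 //.
move=> i _; rewrite derivXn -mulr_natr.
have -> : (q ^ (bump 0 i))%:R = 0 :> {poly R}.
  apply/eqP; rewrite -polyC_natr polyC_eq0 -(dvdn_pcharf pR) q_def -expnM.
  by rewrite dvdn_exp // muln_gt0 e_gt0.
by rewrite mulr0.
Qed.

(** The trace polynomial has derivative 1, so it is separable after subtraction of any constant: x
    takes each finite value at exactly M points. *)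
Lemma trace_roots (c : K) : exists s : seq K,
  [/\ trace 'X - c%:P = \prod_(b <- s) ('X - b%:P), uniq s,
      size s = M & forall b, b \in s -> trace b = c].
Proof.
have [st tm] := size_trace K.
have szc : (size (- c%:P) < size (trace ('X : {poly K})))%N.
  by rewrite size_polyN st ltnS (leq_trans (size_polyC_leq1 _)) ?M_gt0.
have pm : trace 'X - c%:P \is monic by rewrite monicE lead_coefDl // (monicP tm).
have [s sE] := closed_field_poly_normal (trace 'X - c%:P).
rewrite (monicP pm) scale1r in sE; exists s; split=> //.
- rewrite -separable_prod_XsubC -sE.
  have -> : separable_poly (trace 'X - c%:P) = coprimep (trace 'X - c%:P) 1.
    by rewrite unlock; congr coprimep; rewrite derivB derivC subr0 deriv_trace.
  exact: coprimep1.
- have := congr1 (size : {poly K} -> nat) sE; rewrite size_prod_XsubC size_polyDl // st.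
  by case.
move=> b bs; have : root (trace 'X - c%:P) b by rewrite sE root_prod_XsubC.
rewrite rootE !hornerE subr_eq0 horner_sum => /eqP <-.
by apply: eq_bigr => i _; rewrite !hornerE.
Qed.

(** By [ev_dvd_polyC] the denominator of z can be taken in K[x]; by induction on its degree, its
    roots are cancelled one at a time. *)
Lemma regular_polynomial z :
  (forall a b, trace b = a ^+ N -> regular a b z) -> exists u, z = ev u.
Proof.
move=> zreg; have [u [d [d0]]] : exists u d, d != 0 /\ z * ev d%:P = ev u.
  have [u [h [h0 ->]]] := ev_repr z; have [w [d [d0 hw]]] := ev_dvd_polyC h0.
  by exists (u * w), d; split=> //; rewrite -hw mulrA divfK // rmorphM.
elim/ltn_ind: {d}(size d) {-2}d (erefl (size d)) d0 u => n IHn d sd d0 u zd.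
have [s1|s1] := eqVneq (size d) 1%N.
  have /size_poly1P[c c0 dE] := introT eqP s1.
  exists (u * (c^-1)%:P%:P); rewrite rmorphM /= -zd -mulrA dE -rmorphM /=.
  by rewrite -!polyCM divff // rmorph1 mulr1.
have [a /factor_theorem[d' dE]] := closed_rootP d s1.
have d'0 : d' != 0 by apply: contraNneq d0 => d'0; rewrite dE d'0 mul0r.
(* With x set to a, the normal form of the numerator becomes a polynomial in y of degree below M
   that vanishes at the M points over a. It is therefore zero, and X - a divides every
   coefficient. *)
have [v' vE] : exists v', normal_form u = ('X - a%:P)%:P * v'.
  pose w := map_poly (horner_eval a) (normal_form u).
  suff w0 : w = 0.
    exists (map_poly (fun c : {poly K} => c %/ ('X - a%:P)) (normal_form u)).
    apply/polyP => i; rewrite coefCM coef_map_id0 ?div0p // mulrC divpK //.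
    rewrite dvdp_XsubCl rootE; have := congr1 (fun w : {poly K} => w`_i) w0.
    by rewrite coef_map coef0 /= => /eqP.
  have [s [_ us ss sE]] := trace_roots (a ^+ N).
  apply/eqP; apply: contraT => w0.
  have : (size s < size w)%N.
    apply: max_poly_roots => //; apply/allP => b /sE Pab.
    have -> : b = horner_eval a b%:P by rewrite /horner_eval hornerC.
    rewrite rootE horner_map /= /horner_eval; have [g [h [h0 zh]]] := zreg a b Pab.
    have : ev (u * h) = ev (g * d%:P).
      by rewrite !rmorphM /= -zd -zh mulrAC.
    move=> /(ev_value Pab); rewrite !hornerM hornerC dE hornerM hornerXsubC subrr.
    rewrite !mulr0 -(ev_value Pab (ev_normal_form u)) => /eqP.
    by rewrite mulf_eq0 (negPf h0) orbF.
  rewrite ss ltnNge => /negP[]; apply: leq_trans (size_normal_form u).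
  exact: size_poly.
apply: (IHn (size d') _ d' (erefl _) d'0 v').
  by rewrite -sd dE size_Mmonic ?monicXsubC // size_XsubC addn2 /=.
have e0 : ev ('X - a%:P)%:P != 0 by rewrite ev_polyC_eq0 polyXsubC_eq0.
apply: (mulIf e0); rewrite -mulrA -rmorphM /= -polyCM -dE zd -ev_normal_form vE.
by rewrite rmorphM mulrC.
Qed.

(** * Affine places *)

Lemma Xsub_neq0 a : x - j a != 0.
Proof. by rewrite -(eval2_XsubC j y x) ev_polyC_eq0 polyXsubC_eq0. Qed.

Lemma ev_extend (k : fieldType) (i : {rmorphism k -> K}) (jk : {rmorphism k -> L}) :
  (forall c, jk c = j (i c)) ->
  forall u, eval2 jk y x u = ev (map_poly (map_poly i) u).
Proof.
move=> jkE u; rewrite -eval2_comp /eval2; congr (_.[_, _]).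
by do 2 apply: eq_map_poly => ?.
Qed.

Section LocalRing.
Variables (k : fieldType) (i : {rmorphism k -> K}) (jk : {rmorphism k -> L}).
Hypothesis jkE : forall c, jk c = j (i c).
Variables (a b : k).
Hypothesis kab : trace b = a ^+ N.

Local Notation evk := (eval2 jk y x).

Let evkE := ev_extend jkE.


Lemma rmorph_point : trace (i b) = i a ^+ N.
Proof. by rewrite -rmorph_trace kab rmorphXn. Qed.

(* The trace is additive, so y - b divides trace y - trace b = x^N - a^N,     *)
(* with a cofactor that does not vanish at the point (a, b).                  *)
Lemma local_step u : u.[b, a] = 0 -> exists B u',
  B.[b, a] != 0 /\ evk B * evk u = (x - jk a) * evk u'.
Proof.
move=> u0; have charL : p \in [pchar L] by rewrite (fmorph_pchar j).
have [c cE] : exists c : {poly k}, 'X ^+ N - (a ^+ N)%:P = c * ('X - a%:P).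
  by apply/factor_theorem; rewrite rootE !hornerE subrr.
have {cE} Nx : x ^+ N - jk a ^+ N = evk c%:P * (x - jk a).
  have := congr1 (fun c => (map_poly jk c).[x]) cE.
  rewrite eval2_polyC [in RHS]rmorphM [in LHS]rmorphB /= map_polyXn map_polyC /=.
  by rewrite rmorphXn map_polyXsubC !hornerE.
have /factor_theorem[d dE] : root u.[b%:P] a by rewrite rootE u0.
have [v vE] : exists v, u - u.[b%:P]%:P = v * ('X - b%:P%:P).
  by apply/factor_theorem; rewrite rootE !hornerE subrr.
have {vE} uE : evk u = evk v * (y - jk b) + evk d%:P * (x - jk a).
  rewrite -[u](subrK u.[b%:P]%:P) vE dE rmorphD rmorphM /= eval2_XsubC2 polyCM.
  by rewrite rmorphM /= eval2_XsubC.
pose B : {poly {poly k}} := \sum_(s < r) ('X - b%:P%:P) ^+ (q ^ s - 1).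
have BE : (y - jk b) * evk B = x ^+ N - jk a ^+ N.
  have -> : x ^+ N - jk a ^+ N = trace (y - jk b).
    have := traceD (y - jk b) (jk b) charL; rewrite subrK curveE => ->.
    by rewrite -rmorphXn -kab rmorph_trace addrK.
  rewrite rmorph_sum big_distrr /=; apply: eq_bigr => s _.
  rewrite rmorphXn /= eval2_XsubC2 -exprS.
  by rewrite subn1 prednK // expn_gt0 ltnW // q_gt1.
exists B, (c%:P * v + B * d%:P); split.
  have -> : B.[b%:P] = 1.
    rewrite horner_sum; case: r r_ge3 => [//|t] _; rewrite big_ord_recl big1.
      by rewrite addr0 expr0 hornerE.
    move=> s _; rewrite horner_exp hornerXsubC subrr expr0n subn_eq0 leqNgt.
    by rewrite -{1}(expn0 q) ltn_exp2l ?q_gt1.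
  by rewrite hornerE oner_eq0.
rewrite uE rmorphD !rmorphM /=; move: Nx BE => -> BE.
transitivity (evk v * ((y - jk b) * evk B) + evk B * evk d%:P * (x - jk a)).
  by ring.
by rewrite BE; ring.
Qed.

(** Otherwise [local_step] could be iterated forever, and u would be divisible by every power of x -
    a in the local ring, although it divides some nonzero d in K[x]. The coefficients stay in [k],
    which will be K for the study of places and F for that of rational places. *)
Lemma local_repr_poly u : evk u != 0 -> exists n w h,
  [/\ w.[b, a] != 0, h.[b, a] != 0 & evk h * evk u = (x - jk a) ^+ n * evk w].
Proof.
move=> u0; apply: contrapT => no_repr.
have [w0 [d [d0]]] : exists w d, d != 0 /\ evk u * ev w = ev d%:P.
  by rewrite evkE in u0 *; exact: ev_dvd_polyC.
have [m [d' /implyP/(_ d0) d'a ->]] := multiplicity_XsubC d (i a) => {d d0} ud.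
have step n : exists v h, h.[b, a] != 0 /\ evk h * evk u = (x - jk a) ^+ n * evk v.
  elim: n => [|n [v [h [h0 hu]]]].
    by exists u, 1; rewrite hornerC hornerC oner_eq0 rmorph1 expr0 !mul1r.
  have [v0|v0] := eqVneq v.[b, a] 0; last first.
    by case: no_repr; exists n, v, h.
  have [B [v' [B0 Bv]]] := local_step v0; exists v', (B * h).
  rewrite !hornerM mulf_neq0 //; split=> //.
  by rewrite rmorphM -mulrA hu mulrCA Bv exprSr mulrA.
(* One step more than the multiplicity m of d at a: after cancelling (x - a)^m, a nonzero value at
   the point equals a multiple of the value of x - a, which is 0. *)
have [v [h [h0 hu]]] := step m.+1.
have := rmorph_point; set a' := i a; set b' := i b => Pab.
have xa : x - jk a = ev ('X - a'%:P)%:P.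
  by rewrite eval2_XsubC jkE.
have xa0 : x - jk a != 0 by rewrite xa ev_polyC_eq0 polyXsubC_eq0.
have : ev (map_poly (map_poly i) h * d'%:P) =
       ev (('X - a'%:P)%:P * (map_poly (map_poly i) v * w0)).
  have {}ud : evk u * ev w0 = ev d'%:P * (x - jk a) ^+ m.
    by rewrite ud polyCM rmorphM /= polyC_exp rmorphXn /= -xa.
  apply: (mulIf (expf_neq0 m xa0)); rewrite !rmorphM /= -!evkE -xa.
  transitivity (evk h * evk u * ev w0); first by rewrite -!mulrA ud.
  by rewrite hu exprS; ring.
move=> /(ev_value Pab)/eqP; rewrite !hornerM hornerC horner2_map hornerC hornerXsubC.
by rewrite subrr mul0r mulf_eq0 fmorph_eq0 (negPf h0) -rootE (negPf d'a).
Qed.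

Lemma evk_neq0 u : u.[b, a] != 0 -> evk u != 0.
Proof.
move=> u0; rewrite evkE; apply: (ev_value_neq0 rmorph_point).
by rewrite horner2_map fmorph_eq0.
Qed.

Lemma evk_Xsub_neq0 : x - jk a != 0.
Proof. by rewrite jkE Xsub_neq0. Qed.

Lemma local_repr u v : evk u != 0 -> evk v != 0 -> exists (n : int) w h,
  [/\ w.[b, a] != 0, h.[b, a] != 0 &
      evk u / evk v = (x - jk a) ^ n * (evk w / evk h)].
Proof.
move=> u0 v0; have [n [w [h [w0 h0 hu]]]] := local_repr_poly u0.
have [n' [w' [h' [w'0 h'0 hv]]]] := local_repr_poly v0.
exists (n%:Z - n'%:Z), (w * h'), (h * w'); rewrite !hornerM !mulf_neq0 //.
split=> //; rewrite expfzDr ?evk_Xsub_neq0 // -exprnN.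
rewrite -[(x - jk a) ^ n]/((x - jk a) ^+ n).
have := evk_Xsub_neq0; set t := x - jk a in hu hv * => t0.
have [[[h1 w1] h1'] w1'] := (evk_neq0 h0, evk_neq0 w0, evk_neq0 h'0, evk_neq0 w'0).
have -> : evk u = t ^+ n * evk w / evk h by rewrite -hu mulrAC mulfV ?mul1r.
have -> : evk v = t ^+ n' * evk w' / evk h' by rewrite -hv mulrAC mulfV ?mul1r.
by rewrite !rmorphM /=; field; rewrite h1 w1' h1' expf_neq0.
Qed.

End LocalRing.

Definition at_point (P : place j) a b := has_value P x a /\ has_value P y b.

Lemma at_point_curve P a b : at_point P a b -> trace b = a ^+ N.
Proof.
move=> [xa yb]; apply: (@has_value_uniq _ _ _ P (trace y)).
  have -> : trace b = (trace 'X : {poly K}).[b].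
    by rewrite -/(horner_eval b _) rmorph_trace /= /horner_eval hornerX.
  have -> : trace y = (map_poly j (trace 'X)).[y].
    rewrite rmorph_trace /= map_polyX -/(horner_eval y _) rmorph_trace /=.
    by rewrite /horner_eval hornerX.
  exact: has_value_horner.
by rewrite curveE; exact: has_valueX.
Qed.

Section AffinePlace.
Variables (a b : K).

(** A power of x - a times a unit of the local ring; x - a is a uniformiser at every affine point
    since the curve is unramified over the affine x-line. *)
Definition ord_at z (n : int) := exists w h, [/\ w.[b, a] != 0, h.[b, a] != 0 &
  z = (x - j a) ^ n * (ev w / ev h)].

Hypothesis Pab : trace b = a ^+ N.

Lemma ord_at_uniq z m n : ord_at z m -> ord_at z n -> m = n.
Proof.
have lt_false (k l : int) : k < l -> ord_at z k -> ord_at z l -> False.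
  move=> kl [w [h [w0 h0 ->]]] [w' [h' [w0' h0']]].
  have {m n} [n lE] : exists n : nat, l = k + n.+1%:Z.
    by exists (absz (l - k - 1)%R); lia.
  rewrite lE expfzDr ?Xsub_neq0 // -mulrA => /mulfI.
  rewrite expfz_neq0 ?Xsub_neq0 // => /(_ isT) eq1.
  have : ev (w * h') = ev ((('X - a%:P)%:P ^+ n.+1) * (w' * h)).
    rewrite !rmorphM rmorphXn /= eval2_XsubC.
    have [h1 h1'] := (ev_value_neq0 Pab h0, ev_value_neq0 Pab h0').
    rewrite -[ev w](divfK h1) eq1 -exprnP; field.
    by rewrite ?h1 ?h1' ?expf_neq0 ?Xsub_neq0.
  move=> /(ev_value Pab)/eqP; rewrite !hornerM exprS !hornerM hornerC hornerXsubC subrr.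
  by rewrite !mul0r mulf_eq0 (negPf w0) (negPf h0').
move=> zm zn; have [mn|nm|//] := ltgtP m n.
  by case: (lt_false _ _ mn).
by case: (lt_false _ _ nm).
Qed.

Lemma ord_at_neq0 z n : ord_at z n -> z != 0.
Proof.
move=> [w [h [w0 h0 ->]]].
by rewrite !mulf_neq0 ?expfz_neq0 ?Xsub_neq0 ?invr_eq0 ?(ev_value_neq0 Pab).
Qed.

Lemma ord_atM f g k l : ord_at f k -> ord_at g l -> ord_at (f * g) (k + l).
Proof.
move=> [w [h [w0 h0 ->]]] [w' [h' [w0' h0' ->]]]; exists (w * w'), (h * h').
rewrite !hornerM !mulf_neq0 // !rmorphM expfzDr ?Xsub_neq0 //; split=> //=.
have [h1 h1'] := (ev_value_neq0 Pab h0, ev_value_neq0 Pab h0').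
by field; rewrite ?h1 ?h1' ?expf_neq0 ?Xsub_neq0.
Qed.

Lemma ord_at_ex z : z != 0 -> exists n, ord_at z n.
Proof.
have [u [h [h0 ->]]] := ev_repr z => z0.
have u0 : ev u != 0 by apply: contraNneq z0 => ->; rewrite mul0r.
have [n [w [h' [w0 h'0 E]]]] := local_repr (i := idfun) (fun=> erefl) Pab u0 h0.
by exists n, w, h'.
Qed.

Lemma ord_at_poly u n : ord_at (ev u) n -> 0 <= n.
Proof.
move=> un; have u0 := ord_at_neq0 un.
have [m [w [h [w0 h0 E]]]] := local_repr_poly (i := idfun) (fun=> erefl) Pab u0.
suff -> : n = m by [].
apply: ord_at_uniq un _; exists w, h; split=> //; rewrite mulrA.
by apply: (mulIf (ev_value_neq0 Pab h0)); rewrite divfK ?(ev_value_neq0 Pab) // mulrC E.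
Qed.

Lemma ord_atD f g k l m : ord_at f k -> ord_at g l -> ord_at (f + g) m ->
  Num.min k l <= m.
Proof.
wlog kl : f g k l / k <= l.
  move=> th; have [kl|lk] := orP (le_total k l); first exact: th.
  by rewrite addrC minC => fk gl; exact: (th _ _ _ _ lk gl fk).
move=> [w [h [w0 h0 fE]]] [w' [h' [w0' h0' gE]]] fgm.
rewrite min_l //; have [n lE] : exists n : nat, l = k + n%:Z.
  by exists (absz (l - k)%R); lia.
have [h1 h1'] := (ev_value_neq0 Pab h0, ev_value_neq0 Pab h0').
pose s := w * h' + ('X - a%:P)%:P ^+ n * w' * h.
have fgE : f + g = (x - j a) ^ k * (ev s / ev (h * h')).
  rewrite fE gE lE expfzDr ?Xsub_neq0 // -exprnP rmorphD !rmorphM rmorphXn /=.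
  by rewrite eval2_XsubC; field; rewrite ?h1 ?h1' ?expf_neq0 ?Xsub_neq0.
have s0 : ev s != 0.
  by apply: contraNneq (ord_at_neq0 fgm) => s0; rewrite fgE s0 mul0r mulr0.
have [c sc] := ord_at_ex s0; have c0 := ord_at_poly sc.
suff -> : m = k + c by rewrite lerDl.
apply: ord_at_uniq fgm _; rewrite fgE; apply: ord_atM.
  by exists 1, 1; rewrite !hornerC oner_neq0 rmorph1 divr1 mulr1.
have : ord_at (ev (h * h'))^-1 0.
  exists 1, (h * h'); rewrite !hornerM !hornerC oner_neq0 mulf_neq0 //.
  by rewrite rmorph1 expr0z !mul1r.
by move=> /(ord_atM sc); rewrite addr0.
Qed.

Lemma ord_atC c : c != 0 -> ord_at (j c) 0.
Proof.
move=> c0; exists c%:P%:P, 1; rewrite !hornerC oner_neq0 c0.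
by rewrite rmorph1 divr1 eval2C expr0z mul1r.
Qed.

Lemma ord_at_unif : exists2 t, t != 0 & ord_at t 1.
Proof.
exists (x - j a); first exact: Xsub_neq0.
by exists 1, 1; rewrite !hornerC oner_neq0 rmorph1 divr1 mulr1.
Qed.

(** Units of the local ring have valuation 0 at P, so P is [P (x - j a)] times the order; being
    normalised, it forces this factor to be 1. *)
Lemma at_point_pval P : at_point P a b ->
  P (x - j a) = 1 /\ forall z n, ord_at z n -> P z = n.
Proof.
move=> [xa yb].
have Pord z n : ord_at z n -> P z = P (x - j a) * n.
  move=> [w [h [w0 h0 ->]]].
  have [w1 Pw] := has_value_neq0 (has_value_eval2 w yb xa) w0.
  have [h1 Ph] := has_value_neq0 (has_value_eval2 h yb xa) h0.
  have xz := expfz_neq0 n (Xsub_neq0 a); have hV : (ev h)^-1 != 0 by rewrite invr_eq0.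
  rewrite !pvalM ?mulf_neq0 // pvalV Pw Ph addr0.
  case: n {xz} => n; first by rewrite pvalX; lia.
  by rewrite NegzE -exprnN pvalV pvalX; lia.
have xa1 : P (x - j a) = 1.
  have [t Pt] := pval_unif P; have t0 : t != 0.
    by apply: contra_eq_neq Pt => ->; rewrite pval0.
  have [n /Pord] := ord_at_ex t0; rewrite Pt => nE.
  have : 0 < P (x - j a).
    move: xa; rewrite has_valueP vgeE ?Xsub_neq0 //; lia.
  have aux (c d : int) : 1 = c * d -> 0 < c -> c = 1.
    by have [d0|d0] := lerP d 0; nia.
  exact: aux nE.
by split=> // z n /Pord ->; rewrite xa1 mul1r.
Qed.

Lemma at_point_uniq P Q : at_point P a b -> at_point Q a b -> P = Q.
Proof.
move=> /at_point_pval[_ Pord] /at_point_pval[_ Qord]; apply: place_eq => z.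
have [->|z0] := eqVneq z 0; first by rewrite !pval0.
by have [n zn] := ord_at_ex z0; rewrite (Pord _ _ zn) (Qord _ _ zn).
Qed.

Lemma at_point_ex : exists P, at_point P a b.
Proof.
have [P PP] := place_of_ord ord_at_ex ord_at_uniq ord_atM
  (fun f g k l m _ _ => @ord_atD f g k l m) ord_atC ord_at_unif.
have xa0 := Xsub_neq0 a; exists P; split; apply/has_valueP.
  have [t t0 t1] := ord_at_unif.
  rewrite vgeE //; suff -> : P (x - j a) = 1 by [].
  apply: ord_at_uniq (PP _ xa0) _.
  by exists 1, 1; rewrite !hornerC oner_neq0 rmorph1 divr1 mulr1.
have [y0|y0] := eqVneq (y - j b) 0; first by rewrite /vge y0 eqxx.
rewrite vgeE //; have := PP _ y0; set n := P _ => yn.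
have : 0 <= n by apply: (@ord_at_poly ('X - b%:P%:P)); rewrite eval2_XsubC2.
suff : n != 0 by lia.
apply/eqP => n0; move: yn; rewrite n0 => -[w [h [w0 h0]]].
rewrite expr0z mul1r => yE; have : ev (('X - b%:P%:P) * h) = ev w.
  by rewrite rmorphM /= eval2_XsubC2 yE divfK // (ev_value_neq0 Pab h0).
move=> /(ev_value Pab)/esym/eqP; rewrite !hornerM hornerXsubC subrr horner0 mul0r.
by rewrite (negPf w0).
Qed.

Lemma at_point_regular P z : at_point P a b -> vge P 0 z -> regular a b z.
Proof.
move=> /at_point_pval[_ Pord]; have [->|z0] := eqVneq z 0.
  by exists 0, 1; rewrite !hornerC oner_neq0 rmorph0 mul0r.
rewrite vgeE //; have [n zn] := ord_at_ex z0; rewrite (Pord _ _ zn).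
case: n zn => // n [w [h [w0 h0 ->]]] _.
exists (('X - a%:P)%:P ^+ n * w), h; split=> //.
by rewrite mulrA divfK ?(ev_value_neq0 Pab) // rmorphM rmorphXn /= eval2_XsubC.
Qed.

End AffinePlace.

(** At a pole of y the term y^M would dominate the trace of y, which is x^N. *)
Lemma vge_y (P : place j) : vge P 0 x -> vge P 0 y.
Proof.
move=> x0; rewrite /vge; have [//|y0 /=] := eqVneq y 0; rewrite leNgt.
apply/negP => yneg; have M0 := M_gt0.
have : vge P 0 (trace y) by rewrite curveE -(mul0rn _ N); exact: vgeX.
have trE : trace y = y ^+ M + \sum_(s < r.-1) y ^+ (q ^ s).
  by rewrite /trace; case: r r_ge3 => [//|t] _; rewrite big_ord_recr addrC.
have [] := @pval_dom _ _ _ P (y ^+ M) (\sum_(s < r.-1) y ^+ (q ^ s)).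
- exact: expf_neq0.
- apply: vge_sum => s _; rewrite vgeE ?expf_neq0 // !pvalX.
  have : (q ^ s < M)%N by rewrite ltn_exp2l ?q_gt1.
  by nia.
rewrite -trE => t0 Pt; rewrite vgeE // Pt pvalX; nia.
Qed.

Lemma at_point_of_vge (P : place j) : vge P 0 x -> exists a b, at_point P a b.
Proof.
move=> x0; have y0 := vge_y x0.
have vge_ev u : vge P 0 (ev u).
  rewrite eval2E; apply: vge_sum => s _; rewrite -[0]addr0.
  apply: vgeM; first exact: vge_horner.
  by rewrite -(mul0rn _ s); exact: vgeX.
have [a xa] : exists a, has_value P x a.
  (* If x had no value, all the x - a would have valuation 0, hence also every nonzero element of
     K[x] (by splitting it) and of K[x, y] (by [ev_dvd_polyC]): P would be trivial. *)
  apply: contrapT => no_value.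
  have Pxa a : P (x - j a) = 0.
    apply/eqP; rewrite eq_le -[X in _ && X]vgeE ?Xsub_neq0 //.
    rewrite vgeD ?vgeN ?vgeC // andbT leNgt; apply/negP => xa.
    by case: no_value; exists a; right.
  have Pd d : d != 0 -> P (ev d%:P) = 0.
    move=> d0; have [s dE] := closed_field_poly_normal d.
    have -> : ev d%:P = j (lead_coef d) * \prod_(a <- s) (x - j a).
      rewrite eval2_polyC {1}dE linearZ /= hornerZ; congr (_ * _).
      rewrite rmorph_prod horner_prod /=; apply: eq_bigr => a _.
      by rewrite map_polyXsubC hornerXsubC.
    rewrite pvalM ?fmorph_eq0 ?lead_coef_eq0 //; last first.
      by rewrite prodf_seq_neq0; apply/allP => a _; exact: Xsub_neq0.
    rewrite pvalC add0r; elim: s {dE} => [|a s IHs]; first by rewrite big_nil pval1.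
    rewrite big_cons pvalM ?Pxa ?IHs ?Xsub_neq0 //.
    by rewrite prodf_seq_neq0; apply/allP => ? _; exact: Xsub_neq0.
  have Pev u : ev u != 0 -> P (ev u) = 0.
    move=> u0; have [w [d [d0 uw]]] := ev_dvd_polyC u0.
    have w0 : ev w != 0.
      by apply: contraNneq d0 => w0; rewrite -ev_polyC_eq0 -uw w0 mulr0.
    have := Pd d d0; rewrite -uw pvalM //.
    by have := vge_ev u; have := vge_ev w; rewrite !vgeE //; lia.
  have [t] := pval_unif P; have [u [h [h0 ->]]] := ev_repr t.
  have [u0|u0] := eqVneq (ev u) 0; first by rewrite u0 mul0r pval0.
  by rewrite pvalM ?invr_eq0 // pvalV !Pev.
exists a; have [s [sE _ _ _]] := trace_roots (a ^+ N).
(* The y - b, for b in the fibre over a, multiply to x^N - a^N, which vanishes at P; so one of the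
   factors does. *)
have : vge P 1 (\prod_(b <- s) (y - j b)).
  have -> : \prod_(b <- s) (y - j b) = x ^+ N - j (a ^+ N).
    rewrite -curveE; transitivity (map_poly j (\prod_(b <- s) ('X - b%:P))).[y].
      rewrite rmorph_prod horner_prod; apply: eq_bigr => b _ /=.
      by rewrite map_polyXsubC hornerXsubC.
    rewrite -sE rmorphB rmorph_trace /= map_polyX map_polyC !hornerE; congr (_ - _).
    by rewrite -[LHS]/(horner_eval y _) rmorph_trace /= /horner_eval hornerX.
  by apply/has_valueP; exact: has_valueX.
elim: s {sE} => [|b s IHs]; first by rewrite big_nil /vge oner_eq0 pval1.
rewrite big_cons; have [yb _|yb] := boolP (vge P 1 (y - j b)).
  by exists b; split=> //; exact/has_valueP.
move: yb; rewrite {1}/vge negb_or => /andP[y1 Py].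
have Py0 : P (y - j b) = 0.
  have : vge P 0 (y - j b) by rewrite vgeD ?vgeN ?vgeC.
  by rewrite vgeE //; lia.
rewrite /vge mulf_eq0 (negPf y1) /= => h; apply: IHs; rewrite /vge.
by move: h; case: eqVneq => //= s0; rewrite pvalM // Py0 add0r.
Qed.

(** * The place at infinity *)

(* Monomials y^i x^j get the weight M j + N i, their pole order at infinity.  *)
Definition weight_le (u : {poly {poly K}}) d :=
  forall i l, u`_i`_l != 0 -> (M * l + N * i <= d)%N.

(** The substitution x = T^M, y = T^N, which parametrises the top-weight part y^M = x^N of the
    equation. *)
Definition weight_form (u : {poly {poly K}}) : {poly K} :=
  (map_poly (comp_poly 'X^M) u).['X^N].

(* The terms of top weight d do not cancel modulo x^N = y^M. *)
Definition exact_weight u d := weight_le u d /\ size (weight_form u) = d.+1.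

Lemma weight_form_zmod_morphism : zmod_morphism weight_form.
Proof. by move=> u v; rewrite /weight_form rmorphB !hornerE. Qed.

Lemma weight_form_monoid_morphism : GRing.monoid_morphism weight_form.
Proof. by split=> [|u v]; rewrite /weight_form ?rmorph1 ?rmorphM /= !hornerE. Qed.

HB.instance Definition _ :=
  GRing.isZmodMorphism.Build _ _ weight_form weight_form_zmod_morphism.
HB.instance Definition _ :=
  GRing.isMonoidMorphism.Build _ _ weight_form weight_form_monoid_morphism.

Lemma weight_formXn n : weight_form 'X^n = 'X^(N * n).
Proof. by rewrite rmorphXn /= /weight_form map_polyX hornerX exprM. Qed.

Lemma weight_form_polyC c : weight_form c%:P = c \Po 'X^M.
Proof. by rewrite /weight_form map_polyC hornerC. Qed.

Lemma weight_formE u : weight_form u =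
  \sum_(i < size u) \sum_(l < size u`_i) u`_i`_l *: 'X^(M * l + N * i).
Proof.
rewrite /weight_form (@horner_coef_wide _ (size u)) ?size_poly //.
apply: eq_bigr => i _; rewrite coef_map /= comp_polyE mulr_suml.
by apply: eq_bigr => l _; rewrite -scalerAl -!exprM -exprD.
Qed.

Lemma weight_le_weaken u d d' : (d <= d')%N -> weight_le u d -> weight_le u d'.
Proof. by move=> dd ud i l /ud/leq_trans; apply. Qed.

Lemma weight_le0 d : weight_le 0 d.
Proof. by move=> i l; rewrite !coef0 eqxx. Qed.

Lemma weight_leD u v d : weight_le u d -> weight_le v d -> weight_le (u + v) d.
Proof.
move=> ud vd i l; rewrite !coefD; have [u0|u0 _] := eqVneq u`_i`_l 0; last exact: ud.
by rewrite u0 add0r; exact: vd.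
Qed.

Lemma weight_leN u d : weight_le u d -> weight_le (- u) d.
Proof. by move=> ud i l; rewrite !coefN oppr_eq0; exact: ud. Qed.

Lemma weight_leM u v d d' : weight_le u d -> weight_le v d' ->
  weight_le (u * v) (d + d').
Proof.
move=> ud vd i l; rewrite coefM coef_sum => uv.
have [s us] : exists s : 'I_i.+1, (u`_s * v`_(i - s))`_l != 0.
  by apply/existsP; apply: contraNT uv; rewrite negb_exists => /forallP h;
     rewrite big1 // => s _; apply/eqP/negPn/h.
move: us; rewrite coefM => us.
have [t] : exists t : 'I_l.+1, u`_s`_t * v`_(i - s)`_(l - t) != 0.
  by apply/existsP; apply: contraNT us; rewrite negb_exists => /forallP h;
     rewrite big1 // => t _; apply/eqP/negPn/h.
rewrite mulf_eq0 negb_or => /andP[/ud h1 /vd h2]; have := ltn_ord s; have := ltn_ord t.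
rewrite !ltnS => tl si; have := leq_add h1 h2; congr (_ <= _)%N.
rewrite addnACA -!mulnDr; congr (M * _ + N * _)%N; exact: subnKC.
Qed.

Lemma weight_le_monomial (c : K) i l :
  weight_le (c *: 'X^l *: 'X^i) (M * l + N * i).
Proof.
move=> i' l'; rewrite coefZ coefXn; case: (eqVneq i' i) => [->|_]; last first.
  by rewrite mulr0 coef0 eqxx.
by rewrite mulr1 coefZ coefXn; case: (eqVneq l' l) => [->//|_]; rewrite mulr0 eqxx.
Qed.

Lemma weight_leMXn u n d : u != 0 -> weight_le (u * 'X^n) d ->
  exists2 d', d = (d' + N * n)%N & weight_le u d'.
Proof.
move=> u0 ud; have h i l : u`_i`_l != 0 -> (M * l + N * i + N * n <= d)%N.
  by have := ud (i + n)%N l; rewrite coefMXn ltnNge leq_addl addnK /= mulnDr addnA.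
have := h (size u).-1 (size u`_(size u).-1).-1.
rewrite -!lead_coefE !lead_coef_eq0 => /(_ u0) le_d.
exists (d - N * n)%N.
  by rewrite subnK //; apply: leq_trans le_d; rewrite leq_addl.
by move=> i l /h; lia.
Qed.

Lemma size_weight_form u d : weight_le u d -> (size (weight_form u) <= d.+1)%N.
Proof.
move=> ud; rewrite weight_formE; apply: (leq_trans (size_sum _ _ _)).
apply/bigmax_leqP => i _; apply: (leq_trans (size_sum _ _ _)).
apply/bigmax_leqP => l _; have [->|/ud h] := eqVneq u`_i`_l 0.
  by rewrite scale0r size_poly0.
by rewrite (leq_trans (size_scale_leq _ _)) // size_polyXn ltnS.
Qed.

Lemma exact_weightM u v d d' : exact_weight u d -> exact_weight v d' ->
  exact_weight (u * v) (d + d').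
Proof.
move=> [ud us] [vd vs]; split; first exact: weight_leM.
by rewrite rmorphM size_mul -?size_poly_eq0 ?us ?vs //= addnS.
Qed.

(** The terms y^M and x^N, of weight NM, cancel under the substitution. This drop in degree is why
    adding multiples of the curve cannot change an exact weight. *)
Lemma weight_form_curve :
  weight_le curve (N * M) /\ (size (weight_form curve) <= N * M)%N.
Proof.
have [S [NE S3 SM]] := sum_q_bounds.
split.
  apply: weight_leD.
    rewrite /trace; elim/big_ind: _ => [|u v|i _]; [exact: weight_le0|exact: weight_leD|].
    have := @weight_le_monomial 1 (q ^ i) 0; rewrite !expr0 !scale1r muln0 add0n.
    apply: weight_le_weaken; rewrite leq_mul2l leq_exp2l ?q_gt1 //.
    by rewrite -ltnS prednK ?ltn_ord ?orbT //; lia.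
  apply: weight_leN; have := @weight_le_monomial 1 0 N.
  by rewrite expr0 scale1r -mul_polyC mulr1 muln0 addn0 mulnC.
have -> : weight_form curve = \sum_(i < r.-1) 'X^(N * q ^ i).
  rewrite rmorphB /= rmorph_sum /= [X in _ - X](_ : _ = 'X^(N * M)); last first.
    by rewrite weight_form_polyC comp_Xn_poly -exprM mulnC.
  under eq_bigr => i _ do rewrite weight_formXn.
  by move: (N) => N'; case: r r_ge3 => [//|t] _; rewrite big_ord_recr /= addrK.
apply: (leq_trans (size_sum _ _ _)); apply/bigmax_leqP => i _.
rewrite size_polyXn ltn_mul2l ltn_exp2l ?q_gt1 // ltn_ord andbT NE; lia.
Qed.

(** Each division step removes a leading term s y^M by subtracting s times the curve, and y^M is
    among the heaviest terms of the curve, so the weight never grows. The bound on the quotient g is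
    recorded through g y^M. *)
Lemma weight_division (u : {poly {poly K}}) d : weight_le u d ->
  exists g v : {poly {poly K}},
  [/\ u = g * curve + v, (size v <= M)%N, weight_le v d & weight_le (g * 'X^M) d].
Proof.
elim/ltn_ind: {u}(size u) {-2}u (erefl (size u)) => n IHn u su ud.
have [uM|Mu] := leqP (size u) M.
  exists 0, u; rewrite !mul0r add0r; split=> //; exact: weight_le0.
have u0 : u != 0 by rewrite -size_poly_gt0; apply: leq_ltn_trans Mu.
pose s := lead_coef u *: 'X^((size u).-1 - M) : {poly {poly K}}.
have sXM : s * 'X^M = lead_coef u *: 'X^((size u).-1).
  by rewrite -scalerAl -exprD subnK //; move: Mu; case: (size u).
have sd : weight_le (s * 'X^M) d.
  move=> i l; rewrite sXM coefZ coefXn; case: (eqVneq i _) => [->|_].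
    by rewrite mulr1; exact: ud.
  by rewrite mulr0 coef0 eqxx.
have [sc cm] := size_curve.
have s0 : s != 0 by rewrite -size_poly_gt0 size_scale ?lead_coef_eq0 // size_polyXn.
have szs : size (s * curve) = size u.
  rewrite size_Mmonic // sc size_scale ?lead_coef_eq0 // size_polyXn.
  by move: Mu; case: (size u) => // m Mm /=; lia.
have lcs : lead_coef (s * curve) = lead_coef u.
  by rewrite lead_coef_Mmonic // lead_coefZ lead_coefXn mulr1.
have scd : weight_le (s * curve) d.
  have [d' -> sd'] := weight_leMXn s0 sd; apply: weight_leM => //.
  by case: weight_form_curve.
pose u' := u - s * curve.
have su' : (size u' < n)%N.
  rewrite -su; apply: (leq_trans (n := (size u).-1.+1)); last first.
    by rewrite prednK ?size_poly_gt0.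
  rewrite ltnS; apply/leq_sizeP => i; rewrite leq_eqVlt => /orP[/eqP <-|ui].
    by rewrite coefB -{2}szs -!lead_coefE lcs subrr.
  have {}ui : (size u <= i)%N by rewrite -(prednK (_ : 0 < size u)%N) ?size_poly_gt0.
  by rewrite coefB !nth_default ?subrr ?szs.
have [g [v [uE sv vd gd]]] := IHn _ su' u' erefl (weight_leD ud (weight_leN scd)).
exists (s + g), v; split=> //; last by rewrite mulrDl; exact: weight_leD.
by rewrite mulrDl -addrA -uE /u' addrC subrK.
Qed.

Lemma ev_curve_add (g v : {poly {poly K}}) : ev (g * curve + v) = ev v.
Proof. by rewrite rmorphD rmorphM /= curve0 mulr0 add0r. Qed.

(** Both polynomials have the same remainder modulo the curve, of weight at most d'. If d' < d, the
    top part of u would come from a multiple of the curve alone, whose weight form has degree below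
    d. *)
Lemma exact_weight_min u v d d' :
  exact_weight u d -> weight_le v d' -> ev u = ev v -> (d <= d')%N.
Proof.
move=> [ud us] vd' uv; rewrite leqNgt; apply/negP => dd.
have [g [t [uE st _ gd]]] := weight_division ud.
have [g' [t' [vE st' td' _]]] := weight_division vd'.
have tt : t = t'.
  by apply: ev_inj2 => //; have := uv; rewrite uE vE !ev_curve_add.
have wt : (size (weight_form t) <= d)%N.
  by rewrite tt (leq_trans (size_weight_form td')).
have wg : (size (weight_form (g * curve)) <= d)%N.
  have [->|g0] := eqVneq g 0; first by rewrite mul0r rmorph0 size_poly0.
  have [d0 dE gd0] := weight_leMXn g0 gd; have [_ sc] := weight_form_curve.
  rewrite rmorphM (leq_trans (size_polyMleq _ _)) //.
  have := leq_add (size_weight_form gd0) sc; rewrite dE addSn.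
  by case: (_ + _)%N.
have : (d < size (weight_form u))%N by rewrite us.
rewrite uE rmorphD => /leq_trans/(_ (size_polyD _ _)).
by rewrite leq_max !ltnNge wg wt.
Qed.

Definition top_term (u : {poly {poly K}}) d := exists i l,
  [/\ (i < M)%N, u`_i`_l != 0, d = (M * l + N * i)%N &
  forall i' l', u`_i'`_l' != 0 -> (i', l') <> (i, l) -> (M * l' + N * i' < d)%N].

(** M is prime to N and divides N (i' - i), so i = i'. Hence a nonzero normal form has a single
    monomial of top weight. *)
Lemma weight_inj i l i' l' : (i < M)%N -> (i' < M)%N ->
  (M * l + N * i = M * l' + N * i')%N -> (i, l) = (i', l').
Proof.
wlog ii' : i l i' l' / (i <= i')%N.
  move=> th iM i'M E; have [/th|/ltnW/th th'] := leqP i i'; first exact.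
  by apply/esym/th'.
move=> iM i'M E; have ii : i = i'.
  have : (M %| N * (i' - i))%N.
    have -> : (N * (i' - i) = M * l - M * l')%N by rewrite mulnBr; lia.
    by rewrite -mulnBr dvdn_mulr.
  rewrite Gauss_dvdr ?coprime_MN // => /dvdn_leq; lia.
move: E; rewrite ii => /addIn/eqP; rewrite eqn_pmul2l ?M_gt0 // => /eqP -> //.
Qed.

Lemma coef2_bounds (u : {poly {poly K}}) i l : u`_i`_l != 0 ->
  (i < size u)%N /\ (l < size (u`_i)%R)%N.
Proof.
move=> uil; split; rewrite ltnNge; apply: contra uil => h.
  by rewrite [u`_i]nth_default ?coef0.
by rewrite nth_default.
Qed.

Lemma top_term_ex (u : {poly {poly K}}) :
  u != 0 -> (size u <= M)%N -> exists d, top_term u d.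
Proof.
move=> u0 uM; pose D d := [exists i : 'I_(size u), exists l : 'I_(size u`_i),
  (u`_i`_l != 0) && (d == M * l + N * i)%N].
have Dex i l : u`_i`_l != 0 -> D (M * l + N * i)%N.
  move=> uil; have [iu lu] := coef2_bounds uil.
  apply/existsP; exists (Ordinal iu); apply/existsP; exists (Ordinal lu).
  by rewrite /= uil eqxx.
have exD : exists d, D d.
  exists (M * (size (lead_coef u)).-1 + N * (size u).-1)%N; apply: Dex.
  by rewrite -lead_coefE -lead_coefE !lead_coef_eq0.
have boundD d : D d -> (d <= M * sizeY u + N * size u)%N.
  move=> /existsP[i /existsP[l /andP[_ /eqP ->]]].
  rewrite leq_add ?leq_mul2l ?(ltnW (ltn_ord i)) ?orbT //.
  by rewrite (leq_trans (ltnW (ltn_ord l))) ?max_size_coefXY ?orbT.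
have [d Dd maxd] := ex_maxnP exD boundD.
have /existsP[i /existsP[l /andP[uil /eqP dE]]] := Dd.
exists d, i, l; split=> // [|i' l' ui'l' ne]; first exact: leq_trans (ltn_ord i) uM.
rewrite ltn_neqAle maxd ?Dex // andbT.
apply: contra_not_neq ne; rewrite dE; apply: weight_inj.
  by case: (coef2_bounds ui'l') => h _; apply: leq_trans h uM.
exact: leq_trans (ltn_ord i) uM.
Qed.

Lemma exact_weight_top u d : top_term u d -> exact_weight u d.
Proof.
move=> [i [l [_ uil dE u_lt]]]; have ud : weight_le u d.
  move=> i' l' ui'l'; have [/eqP[-> ->]|/eqP ne] := boolP ((i', l') == (i, l)).
    by rewrite dE.
  exact: ltnW (u_lt _ _ ui'l' ne).
split=> //; apply/eqP; rewrite eqn_leq size_weight_form //= ltnNge.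
suff : (weight_form u)`_d != 0 by apply: contra => /leq_sizeP ->.
have [iu lu] := coef2_bounds uil.
have coef0s i' l' : (i', l') <> (i, l) ->
    (u`_i'`_l' *: 'X^(M * l' + N * i'))`_d = 0.
  move=> ne; have [->|/u_lt/(_ ne) h] := eqVneq u`_i'`_l' 0.
    by rewrite scale0r coef0.
  by rewrite coefZ coefXn gtn_eqF // mulr0.
rewrite weight_formE (bigD1 (Ordinal iu)) //= coefD coef_sum.
rewrite [X in _ + X]coef_sum [X in _ + X]big1 ?addr0; last first.
  move=> i' ne; rewrite coef_sum big1 // => l' _; apply: coef0s => -[ii _].
  by case/eqP: ne; apply: val_inj.
rewrite (bigD1 (Ordinal lu)) //= [X in _ + X]big1 ?addr0; last first.
  move=> l' ne; apply: coef0s => -[ll].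
  by case/eqP: ne; apply: val_inj.
by rewrite coefZ coefXn dE eqxx mulr1.
Qed.

Lemma top_term_repr z : z != 0 -> exists u h d d',
  [/\ top_term u d, top_term h d' & z = ev u / ev h].
Proof.
have [u [h [h0 ->]]] := ev_repr z => z0.
have u0 : ev u != 0 by apply: contraNneq z0 => ->; rewrite mul0r.
have nf_top w : ev w != 0 -> exists d, top_term (normal_form w) d.
  move=> w0; apply: top_term_ex (size_normal_form w).
  by apply: contraNneq w0 => w0; rewrite -ev_normal_form w0 eval2_0.
have [[d ud] [d' hd]] := (nf_top _ u0, nf_top _ h0).
by exists (normal_form u), (normal_form h), d, d'; rewrite !ev_normal_form.
Qed.

Lemma exact_monomial l i : exact_weight (('X^l)%:P * 'X^i) (M * l + N * i).
Proof.
split.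
  have -> : ('X^l)%:P * 'X^i = 1 *: 'X^l *: 'X^i :> {poly {poly K}}.
    by rewrite scale1r mul_polyC.
  exact: weight_le_monomial.
rewrite rmorphM /= weight_formXn weight_form_polyC.
by rewrite comp_Xn_poly -exprM -exprD size_polyXn.
Qed.

Lemma exact_weight_neq0 u d : exact_weight u d -> ev u != 0.
Proof.
(* Multiplying by y makes the exact weight positive even when d = 0, against the weight bound 0 of
   the zero polynomial. *)
move=> ud; apply/eqP => u0; have := exact_weightM ud (exact_monomial 0 1).
move=> /exact_weight_min/(_ (weight_le0 0)); rewrite eval2M u0 mul0r eval2_0.
have [S [NE _ _]] := sum_q_bounds; have := M_gt0; move=> ? /(_ erefl); lia.
Qed.

Lemma ev_monomial l i : ev (('X^l)%:P * 'X^i) = x ^+ l * y ^+ i.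
Proof. by rewrite eval2M eval2_polyC map_polyXn hornerXn rmorphXn /= eval2X. Qed.

Definition ord_inf z (n : int) := exists u h d d',
  [/\ exact_weight u d, exact_weight h d', z = ev u / ev h & n = d'%:Z - d%:Z].

Lemma ord_inf_ex z : z != 0 -> exists n, ord_inf z n.
Proof.
move=> /top_term_repr[u [h [d [d' [ud hd zE]]]]].
by exists (d'%:Z - d%:Z), u, h, d, d'; split=> //; exact: exact_weight_top.
Qed.

Lemma ord_inf_uniq z m n : ord_inf z m -> ord_inf z n -> m = n.
Proof.
move=> [u [h [d [d' [ud hd zE ->]]]]] [v [k [c [c' [vc kc zE' ->]]]]].
have h0 := exact_weight_neq0 hd; have k0 := exact_weight_neq0 kc.
have E : ev (u * k) = ev (v * h).
  rewrite !eval2M; have := zE; rewrite zE' => /eqP.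
  by rewrite eqr_div // => /eqP ->.
have uk := exact_weightM ud kc; have vh := exact_weightM vc hd.
have := exact_weight_min uk (proj1 vh) E.
have := exact_weight_min vh (proj1 uk) (esym E); lia.
Qed.

Lemma ord_infM f g m n : ord_inf f m -> ord_inf g n -> ord_inf (f * g) (m + n).
Proof.
move=> [u [h [d [d' [ud hd -> ->]]]]] [v [k [c [c' [vc kc -> ->]]]]].
exists (u * v), (h * k), (d + c)%N, (d' + c')%N; split; try exact: exact_weightM.
  by rewrite !eval2M invfM mulrACA.
by rewrite !PoszD; ring.
Qed.

Lemma ord_infD f g m n s : ord_inf f m -> ord_inf g n -> ord_inf (f + g) s ->
  Num.min m n <= s.
Proof.
move=> [u [h [d [d' [ud hd fE mE]]]]] [v [k [c [c' [vc kc gE nE]]]]].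
move=> [w [t [b [b' [wb tb fgE sE]]]]].
have [[h0 k0] t0] := (exact_weight_neq0 hd, exact_weight_neq0 kc, exact_weight_neq0 tb).
have E : ev (w * (h * k)) = ev ((u * k + v * h) * t).
  have : f + g = (ev u * ev k + ev v * ev h) / (ev h * ev k).
    by rewrite fE gE addf_div.
  rewrite fgE => /eqP; rewrite eqr_div ?mulf_neq0 // => /eqP.
  by rewrite !eval2M eval2D !eval2M.
have le_d : weight_le ((u * k + v * h) * t) (maxn (d + c') (c + d') + b').
  apply: weight_leM (proj1 tb); apply: weight_leD.
    exact: weight_le_weaken (leq_maxl _ _) (proj1 (exact_weightM ud kc)).
  exact: weight_le_weaken (leq_maxr _ _) (proj1 (exact_weightM vc hd)).
have := exact_weight_min (exact_weightM wb (exact_weightM hd kc)) le_d E.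
move=> le1; rewrite ge_min; apply/orP.
have [le2|le2] := leqP (d + c') (c + d'); [right|left]; lia.
Qed.

Lemma exact_weightC c : c != 0 -> exact_weight c%:P%:P 0.
Proof.
move=> c0; split; last first.
  by rewrite /weight_form map_polyC hornerC /= comp_polyC size_polyC c0.
have := @weight_le_monomial c 0 0; rewrite !expr0 !muln0.
by rewrite -!mul_polyC !mulr1.
Qed.

Lemma exact_weight1 : exact_weight 1 0.
Proof. exact: exact_weightC (oner_neq0 _). Qed.

Lemma ord_infC c : c != 0 -> ord_inf (j c) 0.
Proof.
move=> c0; exists c%:P%:P, 1, 0%N, 0%N; split=> //.
- exact: exact_weightC.
- exact: exact_weight1.
- by rewrite rmorph1 divr1 eval2C.
Qed.

(** With these exponents x^l / y^i is a uniformiser at infinity. *)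
Lemma weight_bezout : exists l i, (N * i = (M * l).+1)%N.
Proof.
have := egcdnP M (_ : 0 < N)%N; have [S [NE _ _]] := sum_q_bounds; have M0 := M_gt0.
case=> [|km kn E _]; first by lia.
by exists kn, km; rewrite mulnC E gcdnC (eqP coprime_MN) addn1 mulnC.
Qed.

Lemma ord_inf_unif : exists2 t, t != 0 & ord_inf t 1.
Proof.
have [l [i E]] := weight_bezout.
have xl := exact_monomial l 0; have yi := exact_monomial 0 i.
exists (ev (('X^l)%:P * 'X^0) / ev (('X^0)%:P * 'X^i)).
  by rewrite mulf_neq0 ?invr_eq0 ?(exact_weight_neq0 xl) ?(exact_weight_neq0 yi).
by do 4 eexists; split; [exact: xl|exact: yi|by []|]; lia.
Qed.

Lemma place_inf_ex : exists V : place j,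
  forall u d, exact_weight u d -> V (ev u) = - d%:Z.
Proof.
have [V VP] := place_of_ord ord_inf_ex ord_inf_uniq ord_infM
  (fun f g k l m _ _ => @ord_infD f g k l m) ord_infC ord_inf_unif.
exists V => u d ud; apply: ord_inf_uniq (VP _ (exact_weight_neq0 ud)) _.
exists u, 1, d, 0%N; rewrite rmorph1 divr1 sub0r; split=> //; exact: exact_weight1.
Qed.

Lemma x_neq0 : x != 0.
Proof. by have := Xsub_neq0 0; rewrite rmorph0 subr0. Qed.

Lemma y_neq0 : y != 0.
Proof. by have := exact_weight_neq0 (exact_monomial 0 1); rewrite ev_monomial mul1r. Qed.

Lemma ev_sum u :
  ev u = \sum_(i < size u) \sum_(l < size u`_i) j u`_i`_l * (x ^+ l * y ^+ i).
Proof.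
rewrite eval2E; apply: eq_bigr => i _.
rewrite (@horner_coef_wide _ (size (u`_i)%R)) ?size_poly // mulr_suml.
by apply: eq_bigr => l _; rewrite coef_map /= mulrA.
Qed.

Lemma vge_ev (P : place j) (u : {poly {poly K}}) k :
  (forall i l, u`_i`_l != 0 -> vge P k (x ^+ l * y ^+ i)) -> vge P k (ev u).
Proof.
move=> h; rewrite ev_sum; apply: vge_sum => i _; apply: vge_sum => l _.
have [->|/h kxy] := eqVneq u`_i`_l 0; first by rewrite rmorph0 mul0r vge0.
by rewrite -[k]add0r; apply: vgeM => //; exact: vgeC.
Qed.

Section PoleOfX.
Variable P : place j.

(** At a pole of x, y^M dominates the trace, so M P(y) = N P(x), and coprimality supplies the common
    factor m. *)
Lemma pole_xy : ~~ vge P 0 x ->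
  exists2 m : nat, (0 < m)%N & P x = - (M * m)%N%:Z /\ P y = - (N * m)%N%:Z.
Proof.
have x0 := x_neq0; have y0 := y_neq0; rewrite vgeE // -ltNge => xneg.
have M0 := M_gt0; have [S [NE S3 SM]] := sum_q_bounds.
have trE : trace y = y ^+ M + \sum_(s < r.-1) y ^+ (q ^ s).
  by rewrite /trace; case: r r_ge3 => [//|t] _; rewrite big_ord_recr addrC.
have yneg : P y < 0.
  rewrite ltNge; apply/negP => ypos; have : vge P 0 (trace y).
    by apply: vge_sum => s _; rewrite -(mul0rn _ (q ^ s)); apply: vgeX; rewrite vgeE.
  rewrite curveE vgeE ?expf_neq0 // pvalX; nia.
have [] := @pval_dom _ _ _ P (y ^+ M) (\sum_(s < r.-1) y ^+ (q ^ s)).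
- exact: expf_neq0.
- apply: vge_sum => s _; rewrite vgeE ?expf_neq0 // !pvalX.
  have : (q ^ s < M)%N by rewrite ltn_exp2l ?q_gt1.
  by nia.
rewrite -trE curveE !pvalX => _ E.
have [a aE] : exists a : nat, P x = - a%:Z by exists (absz (P x)); lia.
have [b bE] : exists b : nat, P y = - b%:Z by exists (absz (P y)); lia.
rewrite aE bE in E xneg *; have {}E : (N * a = M * b)%N by nia.
have /dvdnP[m mE] : (M %| a)%N.
  by rewrite -(Gauss_dvdr a coprime_MN) E dvdn_mulr.
exists m; first by case: m mE => // mE; lia.
by rewrite mE mulnC; split=> //; congr (- Posz _); move: E; rewrite mE; nia.
Qed.

Lemma pole_top_term_approx m u d : P x = - (M * m)%N%:Z -> P y = - (N * m)%N%:Z ->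
  (0 < m)%N -> top_term u d -> exists i l c,
  [/\ (i < M)%N, c != 0, d = (M * l + N * i)%N &
      vge P (- (d * m)%N%:Z + 1) (ev u - j c * (x ^+ l * y ^+ i))].
Proof.
move=> xm ym m0 [i [l [iM uil dE u_lt]]]; have x0 := x_neq0; have y0 := y_neq0.
exists i, l, u`_i`_l; split=> //; pose t : {poly {poly K}} := u`_i`_l *: 'X^l *: 'X^i.
have -> : j u`_i`_l * (x ^+ l * y ^+ i) = ev t.
  by rewrite /t -!mul_polyC polyCM -mulrA eval2M eval2C ev_monomial.
rewrite -eval2B; apply: vge_ev => i' l'; rewrite !coefB !coefZ !coefXn.
have [/eqP[-> ->]|ne] := boolP ((i', l') == (i, l)).
  by rewrite !eqxx !mulr1 coefZ coefXn eqxx mulr1 subrr eqxx.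
have -> : (u`_i`_l *: 'X^l * (i' == i)%:R)`_l' = 0.
  move: ne; case: (eqVneq i' i) => [->|_ _]; last by rewrite mulr0 coef0.
  rewrite mulr1 coefZ coefXn; case: (eqVneq l' l) => [->|_ _]; first by rewrite eqxx.
  by rewrite mulr0.
rewrite subr0 => /u_lt/(_ (elimN eqP ne)) lt_d.
rewrite vgeE ?mulf_neq0 ?expf_neq0 // pvalM ?expf_neq0 // !pvalX xm ym.
by move: lt_d; nia.
Qed.

Lemma pole_top_term m u d : P x = - (M * m)%N%:Z -> P y = - (N * m)%N%:Z ->
  (0 < m)%N -> top_term u d -> P (ev u) = - (d * m)%N%:Z.
Proof.
move=> xm ym m0 /(pole_top_term_approx xm ym m0)[i [l [c [_ c0 dE]]]].
have x0 := x_neq0; have y0 := y_neq0; set t := j c * _ => ut.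
have t0 : t != 0 by rewrite !mulf_neq0 ?expf_neq0 ?fmorph_eq0.
have tE : P t = - (d * m)%N%:Z.
  rewrite !pvalM ?mulf_neq0 ?expf_neq0 ?fmorph_eq0 // pvalC !pvalX xm ym dE; nia.
by rewrite -tE in ut *; have [_] := pval_dom t0 ut; rewrite subrKC.
Qed.

(** On quotients of normal forms, P is m times V, with m from [pole_xy]; since P takes the value 1,
    m = 1. *)
Lemma pole_uniq (V : place j) : ~~ vge P 0 x ->
  (forall u d, exact_weight u d -> V (ev u) = - d%:Z) -> P = V.
Proof.
move=> /pole_xy[m m0 [xm ym]] VE.
have PV z : P z = V z * m%:Z.
  have [->|z0] := eqVneq z 0; first by rewrite !pval0.
  have [u [h [d [d' [ud hd ->]]]]] := top_term_repr z0.
  have [ud' hd'] := (exact_weight_top ud, exact_weight_top hd).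
  have [u0 h0] := (exact_weight_neq0 ud', exact_weight_neq0 hd').
  rewrite !pvalM ?invr_eq0 // !pvalV (VE _ _ ud') (VE _ _ hd').
  by rewrite (pole_top_term xm ym m0 ud) (pole_top_term xm ym m0 hd); lia.
have aux (c : int) (n : nat) : 1 = c * n%:Z -> n = 1%N.
  by case: n => [|[|n]] //; have [c0|c0] := lerP c 0; nia.
have [t Pt] := pval_unif P; have m1 : m = 1%N by apply: (aux (V t)); rewrite -PV.
by apply: place_eq => z; rewrite PV m1 mulr1.
Qed.

End PoleOfX.

(** * The derivation d/dx *)

(* The derivation d/dx of L: x' = 1, and y' = x^(N-1) by differentiating the  *)
(* equation of the curve.                                                     *)
Definition dpoly u : {poly {poly K}} :=
  swapXY (swapXY u)^`() + ('X^(N.-1))%:P * u^`().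

Lemma dpolyB u v : dpoly (u - v) = dpoly u - dpoly v.
Proof. by rewrite /dpoly swapXYB !derivB swapXYB; ring. Qed.

Lemma dpolyM u v : dpoly (u * v) = dpoly u * v + u * dpoly v.
Proof.
rewrite /dpoly swapXYM !derivM raddfD /= !swapXYM !swapXYK; ring.
Qed.

Lemma dpoly_curve : dpoly curve = 0.
Proof.
have swap_curve : swapXY curve = (trace 'X)%:P - 'X^N.
  rewrite /curve swapXYB (rmorph_trace swapXY) /= swapXY_X -(rmorph_trace polyC) /=.
  by rewrite swapXY_polyC map_polyXn.
have Nx : ('X^N : {poly {poly K}})^`() = 'X^(N.-1).
  rewrite derivXn -mulr_natr; suff -> : N%:R = 1 :> {poly {poly K}} by rewrite mulr1.
  by rewrite -!polyC_natr natN1.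
rewrite /dpoly swap_curve derivB derivC sub0r Nx swapXYN swapXYXn swapXY_X.
rewrite /curve derivB derivC subr0 deriv_trace ?pchar_poly // mulr1 -(rmorphXn polyC).
by rewrite addNr.
Qed.

Lemma ev_dpolyM u v : ev (dpoly (u * v)) = ev (dpoly u) * ev v + ev u * ev (dpoly v).
Proof. by rewrite dpolyM eval2D !eval2M. Qed.

Lemma ev_dpolyB u v : ev (dpoly (u - v)) = ev (dpoly u) - ev (dpoly v).
Proof. by rewrite dpolyB eval2B. Qed.

(** As [dpoly] kills the curve, it maps the ideal of the curve into itself and so descends to
    K[x, y]. *)
Lemma dpoly_ev u v : ev u = ev v -> ev (dpoly u) = ev (dpoly v).
Proof.
move=> uv; have /ev_eq0[g uE] : ev (u - v) = 0 by rewrite eval2B uv subrr.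
apply/eqP; rewrite -subr_eq0 -ev_dpolyB uE ev_dpolyM dpoly_curve curve0 eval2_0.
by rewrite !mulr0 addr0.
Qed.

Definition derivation z : L :=
  let u := sval (cid (ev_repr z)) in let h := sval (cid (svalP (cid (ev_repr z)))) in
  (ev (dpoly u) * ev h - ev u * ev (dpoly h)) / ev h ^+ 2.
Local Notation D := derivation.

Lemma derivation_frac u h : ev h != 0 ->
  D (ev u / ev h) = (ev (dpoly u) * ev h - ev u * ev (dpoly h)) / ev h ^+ 2.
Proof.
move=> h0; rewrite /D; case: cid => u' eu /=; case: cid => h' [h'0] /= /eqP.
rewrite eqr_div // => /eqP E.
have /dpoly_ev : ev (u * h') = ev (u' * h) by rewrite !eval2M.
rewrite !ev_dpolyM => E2.
have uE : ev u = ev u' * ev h / ev h' by rewrite -E mulfK.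
have duE : ev (dpoly u) =
    (ev (dpoly u') * ev h + ev u' * ev (dpoly h) - ev u * ev (dpoly h')) / ev h'.
  by rewrite -E2 addrK mulfK.
by rewrite duE uE; field; rewrite h0 h'0.
Qed.

Lemma derivation_ev u : D (ev u) = ev (dpoly u).
Proof.
have e1 : ev 1 = 1 by exact: rmorph1.
have d1 : dpoly 1 = 0.
  have := dpolyM 1 1; rewrite !mulr1 mul1r => /eqP.
  by rewrite -[X in X == _]addr0 (inj_eq (addrI _)) eq_sym => /eqP.
have := @derivation_frac u 1; rewrite e1 d1 eval2_0 oner_neq0 => /(_ isT).
by rewrite expr1n !divr1 mulr1 mulr0 subr0.
Qed.

Lemma derivationM z t : D (z * t) = D z * t + z * D t.
Proof.
have [u [h [h0 ->]]] := ev_repr z; have [v [k [k0 ->]]] := ev_repr t.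
have -> : ev u / ev h * (ev v / ev k) = ev (u * v) / ev (h * k).
  by rewrite !eval2M mulf_div.
rewrite !derivation_frac ?eval2M ?mulf_neq0 // !ev_dpolyM.
by field; rewrite h0 k0.
Qed.

Lemma derivationB z t : D (z - t) = D z - D t.
Proof.
have [u [h [h0 ->]]] := ev_repr z; have [v [k [k0 ->]]] := ev_repr t.
have -> : ev u / ev h - ev v / ev k = ev (u * k - v * h) / ev (h * k).
  by rewrite eval2B !eval2M -mulNr addf_div // mulNr.
rewrite !derivation_frac ?eval2M ?mulf_neq0 // ev_dpolyB !ev_dpolyM !(eval2B, eval2M).
by field; rewrite h0 k0.
Qed.

Lemma derivation_j c : D (j c) = 0.
Proof.
rewrite -(eval2C j y x) derivation_ev /dpoly swapXY_polyC map_polyC derivC.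
by rewrite ?derivC mulr0 addr0 (rmorph0 swapXY) eval2_0.
Qed.

Lemma derivation_x : D x = 1.
Proof.
rewrite -{1}(eval2Y j y x) derivation_ev /dpoly swapXY_Y derivX derivC mulr0 addr0.
by rewrite (rmorph1 swapXY); exact: rmorph1.
Qed.

Lemma derivation_y : D y = x ^+ N.-1.
Proof.
rewrite -{1}(eval2X j y x) derivation_ev /dpoly swapXY_X derivC derivX mulr1.
by rewrite (rmorph0 swapXY) add0r eval2_polyC map_polyXn hornerXn.
Qed.

(** Only the linear term of the trace survives derivation, so G y = G (trace y) = G (x^N) = 0. Thus
    a derivation that kills K is determined by its value at x. *)
Lemma derivation_eq0 (G : L -> L) :
  (forall z t, G (z - t) = G z - G t) ->
  (forall z t, G (z * t) = G z * t + z * G t) ->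
  (forall c, G (j c) = 0) -> G x = 0 -> forall z, G z = 0.
Proof.
move=> GB GM Gj Gx; have charL : p \in [pchar L] by rewrite (fmorph_pchar j).
have Gy : G y = 0.
  have : G (trace y) = G y.
    have -> : trace y = y + \sum_(i < r.-1) y ^+ (q ^ i.+1).
      by rewrite /trace; case: r r_ge3 => [//|t] _; rewrite big_ord_recl.
    rewrite (derD GB) (der_sum GB) big1 ?addr0 // => i _; rewrite (derX GM) -mulr_natr.
    suff -> : (q ^ i.+1)%:R = 0 :> L by rewrite mulr0.
    by apply/eqP; rewrite -(dvdn_pcharf charL) q_def -expnM dvdn_exp // muln_gt0 e_gt0.
  by move=> <-; rewrite curveE (derX GM) Gx mulr0 mul0rn.
have Gev u : G (ev u) = 0.
  rewrite ev_sum (der_sum GB) big1 // => i _; rewrite (der_sum GB) big1 // => l _.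
  by rewrite !(GM, derX GM) Gj Gx Gy !mulr0 !mul0rn !(mul0r, mulr0, addr0).
move=> z; have [u [h [h0 ->]]] := ev_repr z.
by rewrite GM (derV GM) // !Gev oppr0 !mul0r mulr0 addr0.
Qed.

(** The difference of the derivations s^-1 D s and s^-1(D (s x)) D kills K and x. *)
Lemma derivation_chain (s : ring_aut L) : (forall c, s (j c) = j c) ->
  forall z, D (s z) = s (D z) * D (s x).
Proof.
move=> sj z; pose G t := (s^-1)%g (D (s t)) - (s^-1)%g (D (s x)) * D t.
have sK : cancel s (s^-1)%g := rautK s; have sVK : cancel (s^-1)%g s := rautVK s.
have s'B a b : (s^-1)%g (a - b) = (s^-1)%g a - (s^-1)%g b by exact: rmorphB.
have s'D a b : (s^-1)%g (a + b) = (s^-1)%g a + (s^-1)%g b by exact: rmorphD.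
have s'M a b : (s^-1)%g (a * b) = (s^-1)%g a * (s^-1)%g b by exact: rmorphM.
have : G z = 0.
  apply: derivation_eq0 => [t t'|t t'|c|].
  - by rewrite /G [s _]rmorphB !derivationB s'B; ring.
  - by rewrite /G [s _]rmorphM !derivationM s'D !s'M !sK; ring.
  - by rewrite /G sj derivation_j rmorph0 mulr0 subrr.
  - by rewrite /G derivation_x mulr1 subrr.
rewrite /G => /eqP; rewrite subr_eq0 => /eqP/(congr1 s).
have sM a b : s (a * b) = s a * s b by exact: rmorphM.
by rewrite sM !sVK mulrC.
Qed.

Local Notation c0 := (N%:Z * M%:Z - N%:Z - M%:Z).

(** * Derivatives at infinity, and why the infinite place is fixed *)

Section Infinity.
Variable V : place j.
Hypothesis VE : forall u d, exact_weight u d -> V (ev u) = - d%:Z.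

Lemma V_x : V x = - M%:Z.
Proof.
by have := VE (exact_monomial 1 0); rewrite ev_monomial expr1 mulr1 => ->; lia.
Qed.

Lemma V_y : V y = - N%:Z.
Proof.
by have := VE (exact_monomial 0 1); rewrite ev_monomial expr1 mul1r => ->; lia.
Qed.

Lemma dlog_monomial l i :
  D (x ^+ l * y ^+ i) = x ^+ l * y ^+ i * (l%:R / x + i%:R * (x ^+ N.-1 / y)).
Proof.
have x0 := x_neq0; have y0 := y_neq0.
have pw (t : L) n : t != 0 -> t ^+ n.-1 *+ n = t ^+ n * (n%:R / t).
  move=> t0; case: n => [|n]; first by rewrite mulr0n mul0r mulr0.
  by rewrite /= exprS -mulr_natr; field.
rewrite derivationM !(derX derivationM) derivation_x derivation_y mulr1.
rewrite -mulrnAl !pw //; by field; apply/andP.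
Qed.

(** This is the logarithmic derivative of a monomial: 1/x has valuation M, and x^(N-1)/y has
    valuation N - M(N - 1), which is exactly -[c0]. *)
Lemma vge_dlog l i : vge V (- c0) (l%:R / x + i%:R * (x ^+ N.-1 / y)).
Proof.
have [S [NE S3 SM]] := sum_q_bounds; have x0 := x_neq0; have y0 := y_neq0.
apply: vgeD; rewrite -(rmorph_nat j).
  rewrite -[- _]add0r; apply: vgeM; first exact: vgeC.
  by rewrite vgeE ?invr_eq0 // pvalV V_x NE; nia.
rewrite -[- _]add0r; apply: vgeM; first exact: vgeC.
rewrite vgeE ?mulf_neq0 ?expf_neq0 ?invr_eq0 // pvalM ?expf_neq0 ?invr_eq0 //.
by rewrite pvalX pvalV V_x V_y NE; nia.
Qed.

Lemma vge_D_ev u d : weight_le u d -> vge V (- d%:Z - c0) (D (ev u)).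
Proof.
move=> ud; have x0 := x_neq0; have y0 := y_neq0.
rewrite ev_sum (der_sum derivationB); apply: vge_sum => i _.
rewrite (der_sum derivationB); apply: vge_sum => l _.
rewrite derivationM derivation_j mul0r add0r.
have [->|/ud le_d] := eqVneq u`_i`_l 0; first by rewrite rmorph0 mul0r vge0.
rewrite -[X in vge V X _]add0r; apply: vgeM; first exact: vgeC.
rewrite dlog_monomial; apply: vgeM (vge_dlog _ _).
by rewrite vgeE ?mulf_neq0 ?expf_neq0 // pvalM ?expf_neq0 // !pvalX V_x V_y; nia.
Qed.

Lemma vge_D k z : vge V k z -> vge V (k - c0) (D z).
Proof.
have [->|z0] := eqVneq z 0; first by rewrite (der0 derivationB) !vge0.
rewrite vgeE // => kz; apply: (@vge_weaken _ _ _ _ (V z - c0)); first by rewrite lerD2r.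
have [u [h [d [d' [/exact_weight_top ud /exact_weight_top hd' ->]]]]] := top_term_repr z0.
have [u0 h0] := (exact_weight_neq0 ud, exact_weight_neq0 hd').
rewrite derivationM (derV derivationM) //.
rewrite pvalM ?invr_eq0 // pvalV (VE ud) (VE hd') opprK.
have DU := vge_D_ev (proj1 ud); have DH := vge_D_ev (proj1 hd').
apply: vgeD.
  have -> : - d%:Z + d'%:Z - c0 = (- d%:Z - c0) + d'%:Z by ring.
  by apply: vgeM => //; rewrite vgeE ?invr_eq0 // pvalV (VE hd') opprK.
have -> : - d%:Z + d'%:Z - c0 = - d%:Z + ((- d'%:Z - c0) + d'%:Z *+ 2) by ring.
apply: vgeM; first by rewrite vgeE // (VE ud).
apply: vgeM; first by rewrite vgeN.
by rewrite vgeE ?invr_eq0 ?expf_neq0 // pvalV pvalX (VE hd'); lia.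
Qed.

(** Two normal forms of equal weight share their top monomial by [weight_inj]; the residue is the
    quotient of its two coefficients. *)
Lemma residue_inf z : z != 0 -> V z = 0 -> exists2 c, c != 0 & has_value V z c.
Proof.
move=> z0; have [u [h [d [d' [ud hd zE]]]]] := top_term_repr z0.
have [ud' hd'] := (exact_weight_top ud, exact_weight_top hd).
have [u0 h0] := (exact_weight_neq0 ud', exact_weight_neq0 hd').
rewrite zE pvalM ?invr_eq0 // pvalV (VE ud') (VE hd') => /eqP dd.
have {}dd : d' = d by lia.
rewrite dd in hd hd' {ud'}.
have xm : V x = - (M * 1)%N%:Z by rewrite muln1 V_x.
have ym : V y = - (N * 1)%N%:Z by rewrite muln1 V_y.
have [i [l [a [iM a0 dE ua]]]] := pole_top_term_approx xm ym isT ud.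
have [i' [l' [b [iM' b0 dE' hb]]]] := pole_top_term_approx xm ym isT hd.
have [ii ll] : (i', l') = (i, l) by apply: weight_inj => //; rewrite -dE.
rewrite ii ll in hb; exists (a / b); first by rewrite mulf_neq0 ?invr_eq0.
rewrite has_valueP; have ja := fmorph_eq0 j a; have jb := fmorph_eq0 j b.
move: ua hb; set f := x ^+ l * _ => ua hb.
have -> : ev u / ev h - j (a / b) =
    ((ev u - j a * f) - j (a / b) * (ev h - j b * f)) / ev h.
  by rewrite fmorph_div /=; field; rewrite h0 jb b0.
apply: (@vge_weaken _ _ _ V (- (d * 1)%N%:Z + 1 + d%:Z)).
  by rewrite muln1 addrAC addNr add0r.
apply: vgeM; last by rewrite vgeE ?invr_eq0 // pvalV (VE hd') opprK.
apply: vgeD => //; rewrite vgeN -[X in vge V X _]add0r.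
by apply: vgeM => //; exact: vgeC.
Qed.

(** For the uniformiser f = x^l / y^i of [weight_bezout], i is 1 in K, so the dominant term
    x^(N-1)/y does occur in the logarithmic derivative. Any z of valuation 1 is a nonzero constant
    times f plus a function of valuation at least 2, whose derivative is negligible by [vge_D]. *)
Lemma V_D z : V z = 1 -> V (D z) = 1 - c0.
Proof.
move=> z1; have z0 : z != 0 by apply: contra_eq_neq z1 => ->; rewrite pval0.
have [l [i E]] := weight_bezout; have x0 := x_neq0; have y0 := y_neq0.
have [S [NE S3 SM]] := sum_q_bounds.
pose f := x ^+ l / y ^+ i.
have f0 : f != 0 by rewrite mulf_neq0 ?invr_eq0 ?expf_neq0.
have f1 : V f = 1.
  rewrite pvalM ?invr_eq0 ?expf_neq0 // pvalV !pvalX V_x V_y.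
  by move: E; nia.
have i1 : i%:R = 1 :> L.
  have := congr1 (fun n => n%:R : K) E; rewrite natrM natN1 mul1r -addn1 natrD natrM.
  by rewrite natM0 mul0r add0r => /(congr1 j); rewrite rmorph_nat rmorph1.
have Df : D f = f * (l%:R / x - x ^+ N.-1 / y).
  rewrite derivationM (derV derivationM) ?expf_neq0 //.
  rewrite !(derX derivationM) derivation_x derivation_y mulr1.
  rewrite /f; have pw (t : L) n : t != 0 -> t ^+ n.-1 *+ n = t ^+ n * (n%:R / t).
    move=> t0; case: n => [|n]; first by rewrite mulr0n mul0r mulr0.
    by rewrite /= exprS -mulr_natr; field.
  rewrite -mulrnAl !pw // i1; field; rewrite x0 y0 expf_neq0 //.
have lx : V (- (x ^+ N.-1 / y)) = - c0.
  rewrite pvalN pvalM ?expf_neq0 ?invr_eq0 // pvalX pvalV V_x V_y NE; nia.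
have [||dl0 dlE] := @pval_dom _ _ _ V (- (x ^+ N.-1 / y)) (l%:R / x).
  by rewrite oppr_eq0 mulf_neq0 ?invr_eq0 ?expf_neq0.
  rewrite lx -(rmorph_nat j) -[X in vge V X _]add0r; apply: vgeM; first exact: vgeC.
  by rewrite vgeE ?invr_eq0 // pvalV V_x NE; nia.
rewrite addrC in dl0 dlE.
have VDf : V (D f) = 1 - c0 by rewrite Df pvalM // f1 dlE lx.
have Df0 : D f != 0 by rewrite Df mulf_neq0.
have [||c cn0 /has_valueP wc] := @residue_inf (z / f) _ _.
- by rewrite mulf_neq0 ?invr_eq0.
- by rewrite pvalM ?invr_eq0 // pvalV z1 f1.
have zE : z = j c * f + f * (z / f - j c) by field.
have DzE : D z = j c * D f + D (f * (z / f - j c)).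
  by rewrite {1}zE (derD derivationB) derivationM derivation_j mul0r add0r.
have cDf : j c * D f != 0 by rewrite mulf_neq0 ?fmorph_eq0.
have VcDf : V (j c * D f) = 1 - c0 by rewrite pvalM ?fmorph_eq0 // pvalC add0r VDf.
have [] := @pval_dom _ _ _ V (j c * D f) (D (f * (z / f - j c))) cDf; last first.
  by rewrite -DzE VcDf.
rewrite VcDf; have -> : 1 - c0 + 1 = 1 + 1 - c0 by ring.
by apply/vge_D/vgeM => //; rewrite vgeE // f1.
Qed.


Lemma vge_D_affine P a b z : at_point P a b -> vge P 0 z -> vge P 0 (D z).
Proof.
move=> Pab; have [xa yb] := Pab.
move=> /(at_point_regular (at_point_curve Pab) Pab)[u [h [h0 zh]]].
have vge_ev0 w : vge P 0 (ev w) by exact: has_value_vge (has_value_eval2 w yb xa).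
have [h1 Ph] := has_value_neq0 (has_value_eval2 h yb xa) h0.
have -> : z = ev u / ev h by rewrite -zh mulfK.
rewrite derivation_frac // -!eval2M -eval2B -[X in vge P X _]addr0.
apply: vgeM => //.
by rewrite vgeE ?invr_eq0 ?expf_neq0 // pvalV pvalX Ph.
Qed.

(** * Automorphisms of the function field *)

Section Automorphism.
Variable s : ring_aut L.
Hypothesis sj : forall c, s (j c) = j c.

Let s' : ring_aut L := (s^-1)%g.

Lemma inv_aut_j c : s' (j c) = j c.
Proof. by rewrite -{1}(sj c) [LHS]rautK. Qed.

Let pull P := @place_comp K L j s id sj P.
Let pull' P := @place_comp K L j s' id inv_aut_j P.

Lemma pole_fixed : ~~ vge V 0 (s x) -> forall z, V (s z) = V z.
Proof.
move=> sx z; have E : pull V = V by apply: pole_uniq VE; rewrite vge_comp.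
exact: (congr1 (fun P : place j => P z) E).
Qed.

Lemma regular_false : ~ vge V 0 (s x).
Proof.
move=> sx; have [a [b Vab]] : exists a b, at_point (pull V) a b.
  by apply: at_point_of_vge; rewrite vge_comp.
have Pab := at_point_curve Vab; have [Va _] := at_point_pval Pab Vab.
have sK z : s' (s z) = z by exact: rautK.
have sVK z : s (s' z) = z by exact: rautVK.
have Vx := V_x; have [S [NE S3 SM]] := sum_q_bounds.
(* The inverse of s moves V as well, so that [V_D] also applies to s^-1 x. *)
have s'x : vge (pull' V) 0 x.
  apply/negPn/negP => nx; have E := pole_uniq nx VE.
  have : V (s' (s x)) = V (s x) by rewrite -[LHS]/(pull' V _) E.
  by rewrite sK Vx => Vsx; move: sx; rewrite vgeE ?fmorph_eq0 ?x_neq0 // -Vsx; lia.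
have [a' [b' Vab']] := at_point_of_vge s'x.
have Pab' := at_point_curve Vab'; have [Va' _] := at_point_pval Pab' Vab'.
have sB z t : s (z - t) = s z - s t by exact: rmorphB.
have s'B z t : s' (z - t) = s' z - s' t by exact: rmorphB.
pose t := s x.
have Vt : V (t - j a) = 1 by rewrite /t -(sj a) -sB // Va.
have Vt' : V (s' x - j a') = 1 by rewrite -(inv_aut_j a') -s'B -[LHS]/(pull' V _) Va'.
have DB c z : D (z - j c) = D z by rewrite derivationB derivation_j subr0.
have VDt : V (D t) = 1 - c0 by rewrite -(DB a) V_D.
have VDt' : V (D (s' x)) = 1 - c0 by rewrite -(DB a') V_D.
(* The exponent is chosen so that V z = -M + (M - 1) + (1 - c0) = -c0. *)
pose z := x * ((t - j a) ^+ (M.-1) * D t).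
(* The difference of the two sides is (S - 1)(M - 1) - 2. *)
have cbig : c0 - 1 >= (M * M.-1)%N%:Z by rewrite NE; have := M_gt0; nia.
have cpos : c0 - 1 > 0 by apply: lt_le_trans cbig; rewrite ltz_nat; nia.
have x0 := x_neq0.
have t0 : t - j a != 0 by apply: contra_eq_neq Vt => ->; rewrite pval0.
have Dt0 : D t != 0.
  by apply: contra_eq_neq VDt => ->; rewrite pval0; apply/eqP; move: cpos; lia.
have w0 : (t - j a) ^+ M.-1 * D t != 0 by rewrite mulf_neq0 // expf_neq0.
have Vz : V z = - c0.
  rewrite /z pvalM // pvalM ?expf_neq0 // pvalX Vt VDt Vx.
  by have := M_gt0; move: (M) => m; lia.
have [u zE] : exists u, z = ev u.
  apply: regular_polynomial => a1 b1 Pab1; have [P P1] := at_point_ex Pab1.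
  have [xa1 yb1] := P1; have Px := has_value_vge xa1.
  apply: (at_point_regular Pab1 P1).
  have [tP|tP] := boolP (vge P 0 t).
    rewrite -[X in vge P X _]addr0; apply: vgeM => //.
    rewrite -[X in vge P X _]addr0; apply: vgeM; last exact: vge_D_affine P1 tP.
    rewrite -(mul0rn _ M.-1); apply: vgeX; apply: vgeD => //.
    by rewrite vgeN vgeC.
  (* At a pole P of t = s x, the pullback of P along s is a pole of x, hence V. *)
  have PV w : P (s w) = V w.
    have E : pull P = V by apply: pole_uniq VE; rewrite vge_comp.
    exact: (congr1 (fun P : place j => P w) E).
  (* The chain rule applied to x = s(s^-1 x) makes D t the inverse of s(D(s^-1 x)), whose valuation
     at P is that of D(s^-1 x) at V. *)
  have PDt : P (D t) = c0 - 1.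
    have := derivation_chain sj (s' x); rewrite sVK derivation_x => E.
    have sD0 : s (D (s' x)) != 0.
      by apply: contra_eq_neq E => ->; rewrite mul0r oner_eq0.
    have := congr1 P E; rewrite pval1 pvalM // PV VDt' => /esym/eqP.
    by rewrite addrC addr_eq0 opprB => /eqP.
  have Pta : P (t - j a) = - M%:Z.
    have [] := @pval_dom _ _ _ P t (- j a).
    - by rewrite fmorph_eq0.
    - rewrite vgeN PV Vx; apply: vge_weaken (vgeC P a); have := M_gt0; lia.
    by move=> _ ->; rewrite PV Vx.
  rewrite -[X in vge P X _]addr0; apply: vgeM => //.
  rewrite vgeE // pvalM ?expf_neq0 // pvalX Pta PDt.
  by move: cbig; nia.
have z0 : z != 0 by rewrite mulf_neq0.
have [d ud] : exists d, top_term (normal_form u) d.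
  apply: top_term_ex (size_normal_form u).
  by apply: contraNneq z0 => u0; rewrite zE -ev_normal_form u0 eval2_0.
have := VE (exact_weight_top ud); rewrite ev_normal_form -zE Vz => dE.
have [i [l [iM _ dE' _]]] := ud.
(* The pole order c0 = M l + N i has been increased by M + N. As M divides N (i + 1) with 0 < i + 1
   <= M, i + 1 = M, which leaves no room for M (l + 1). *)
have E : (N * M = M * l.+1 + N * i.+1)%N by move: dE; rewrite dE' !mulnS; nia.
have : (M %| N * i.+1)%N.
  have -> : (N * i.+1 = N * M - M * l.+1)%N by rewrite E addKn.
  by apply: dvdn_sub; [exact: dvdn_mull | exact: dvdn_mulr].
rewrite Gauss_dvdr ?coprime_MN // => /dvdn_leq => /(_ isT) Mi.
have iE : i.+1 = M by apply/eqP; rewrite eqn_leq iM.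
have : (0 < M * l.+1)%N by rewrite muln_gt0 M_gt0.
by move/eqP: E; rewrite iE -[X in X == _]add0n eqn_add2r eq_sym -leqn0 ltnNge => ->.
Qed.

Lemma V_aut z : V (s z) = V z.
Proof. by apply: pole_fixed; apply/negP/regular_false. Qed.

End Automorphism.

End Infinity.

(** * Explicit form of the K-automorphisms *)

Section AutomorphismForm.
Variable s : ring_aut L.
Hypothesis sj : forall c, s (j c) = j c.

(** Since s preserves V, affine places pull back to affine places, where polynomials in x and y are
    regular; [regular_polynomial] concludes. *)
Lemma aut_regular (V : place j) u :
  (forall u d, exact_weight u d -> V (ev u) = - d%:Z) ->
  exists v, s (ev u) = ev v.
Proof.
move=> VE; apply: regular_polynomial => a b Pab; have [P P1] := at_point_ex Pab.
apply: (at_point_regular Pab P1); have [xa _] := P1; have Px := has_value_vge xa.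
pose Q := @place_comp K L j s id sj P.
have [|Qx] := boolP (vge Q 0 x).
  move=> /at_point_of_vge[a' [b' [xa' yb']]].
  rewrite -(vge_comp sj); apply: has_value_vge; exact: has_value_eval2 yb' xa'.
have QV : Q = V by exact: pole_uniq.
have := V_aut VE sj ((s^-1)%g x); have -> : s ((s^-1)%g x) = x by exact: rautVK.
have <- : Q ((s^-1)%g x) = V ((s^-1)%g x) by rewrite QV.
have -> : Q ((s^-1)%g x) = P x by rewrite /= [s _]rautVK.
by move=> E; move: Px; rewrite vgeE ?x_neq0 // -E (V_x VE); have := M_gt0; lia.
Qed.

Lemma regular_weight_le (V : place j) u d :
  (forall u d, exact_weight u d -> V (ev u) = - d%:Z) ->
  V (ev u) = - d%:Z -> exists2 v, ev u = ev v & weight_le v d.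
Proof.
move=> VE Vd; exists (normal_form u); first by rewrite ev_normal_form.
have [->|nf0] := eqVneq (normal_form u) 0; first exact: weight_le0.
have [d' /exact_weight_top ud'] := top_term_ex nf0 (size_normal_form u).
have : d' = d by have := VE _ _ ud'; rewrite ev_normal_form Vd; lia.
by move=> <-; case: ud'.
Qed.

(** Since N = M + S < 2M, the only monomials of weight at most N are 1, x and y. *)
Lemma ev_weight_le_N u : weight_le u N ->
  ev u = j u`_0`_0 + j u`_0`_1 * x + j u`_1`_0 * y.
Proof.
move=> uN; have [S [NE S3 SM]] := sum_q_bounds; have M0 := M_gt0.
have u0 i l : (N < M * l + N * i)%N -> u`_i`_l = 0.
  by move=> lt_N; apply/eqP; apply: contraTT lt_N => /uN; rewrite leqNgt.
rewrite {1}/eval2 (@horner_coef_wide _ 2 (map_poly (map_poly j) u)); last first.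
  apply/leq_sizeP => i i2; rewrite coef_map /= (_ : u`_i = 0) ?rmorph0 //.
  by apply/polyP => l; rewrite coef0 u0 //; nia.
rewrite !big_ord_recl big_ord0 !coef_map /= expr0 expr1 mulr1 addr0 !hornerE.
rewrite (@horner_coef_wide _ 2 (map_poly j u`_0)); last first.
  by apply/leq_sizeP => l l2; rewrite coef_map /= u0 ?rmorph0 //; nia.
rewrite (@horner_coef_wide _ 1 (map_poly j u`_1)); last first.
  by apply/leq_sizeP => l l1; rewrite coef_map /= u0 ?rmorph0 //; nia.
by rewrite !big_ord_recl !big_ord0 !coef_map /= !expr0 expr1 !mulr1 !addr0.
Qed.

Lemma aut_affine : exists a b c d f, [/\ a != 0, s x = j a * x + j b &
  s y = j c * y + (j d * x + j f)].
Proof.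
have [V VE] := place_inf_ex; have [S [NE S3 SM]] := sum_q_bounds; have M0 := M_gt0.
have xE := eval2Y j y x; have yE := eval2X j y x.
have Vs z : V (s z) = V z by exact: V_aut.
have [u su] := aut_regular 'Y VE; have [v sv] := aut_regular 'X VE.
have [u' uE u'M] : exists2 u', ev u = ev u' & weight_le u' M.
  by apply: (regular_weight_le VE); rewrite -su Vs xE V_x.
have [v' vE v'N] : exists2 v', ev v = ev v' & weight_le v' N.
  by apply: (regular_weight_le VE); rewrite -sv Vs yE V_y.
have sinj : injective s by exact: fmorph_inj.
have u'10 : u'`_1`_0 = 0.
  by apply/eqP; apply: contraT => /u'M; rewrite muln0 muln1 add0n NE; lia.
have := su; rewrite xE uE ev_weight_le_N; last first.
  by apply: weight_le_weaken u'M; rewrite NE leq_addr.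
rewrite u'10 rmorph0 mul0r addr0 addrC => sx.
have := sv; rewrite yE vE ev_weight_le_N // addrC [X in _ + X]addrC => sy.
exists u'`_0`_1, u'`_0`_0, v'`_1`_0, v'`_0`_1, v'`_0`_0; split=> //.
apply/eqP => a0; move: sx; rewrite a0 rmorph0 mul0r add0r -[in RHS]sj => /sinj/eqP.
by rewrite -subr_eq0 (negPf (Xsub_neq0 _)).
Qed.

Lemma coef_affineX (a b : K) n i :
  ((a *: 'X + b%:P) ^+ n)`_i = (a ^+ i * b ^+ (n - i)) *+ 'C(n, i).
Proof.
rewrite addrC exprDn coef_sum; have [in_|ni] := ltnP i n.+1; last first.
  rewrite bin_small // mulr0n big1 // => l _.
  rewrite coefMn -rmorphXn exprZn coefCM coefZ coefXn gtn_eqF ?mulr0 ?mul0rn //.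
  exact: leq_trans (ltn_ord l) ni.
rewrite (bigD1 (Ordinal in_)) //= big1 ?addr0 => [|l ne]; last first.
  rewrite coefMn -rmorphXn exprZn coefCM coefZ coefXn.
  suff -> : (i == l) = false by rewrite !mulr0 mul0rn.
  by apply: contraNF ne => /eqP il; apply/eqP/val_inj.
by rewrite coefMn -rmorphXn exprZn coefCM coefZ coefXn eqxx mulr1 mulrC.
Qed.

Lemma coef_trace_affine (d f : K) i :
  (trace (d *: 'X + f%:P))`_i = \sum_(k < r) d ^+ (q ^ k) * (i == q ^ k)%N%:R
    + trace f * (i == 0)%N%:R.
Proof.
rewrite traceD ?pchar_poly // coefD; congr (_ + _).
  by rewrite coef_sum; apply: eq_bigr => k _; rewrite exprZn coefZ coefXn.
by rewrite -(rmorph_trace polyC) /= coefC; case: (i == 0)%N; rewrite ?mulr1 ?mulr0.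
Qed.

Lemma aut_form : exists a f, [/\ a != 0, a ^+ (q ^ r) = a, f ^+ (q ^ r) = f,
  s x = j a * x & s y = j (a ^+ N) * y + j f].
Proof.
have [a [b [c [d [f [a0 sx sy]]]]]] := aut_affine.
have charL : p \in [pchar L] by rewrite (fmorph_pchar j).
have q1 := q_gt1; have [S [NE S3 SM]] := sum_q_bounds; have M0 := M_gt0.
pose A : {poly K} := a *: 'X + b%:P; pose B : {poly K} := d *: 'X + f%:P.
have evlin (g h : K) : ev (g *: 'X + h%:P)%:P = j g * x + j h.
  by rewrite polyCD eval2D eval2C -mul_polyC polyCM eval2M eval2C eval2Y.
have rel : trace (j c * y) + trace (ev B%:P) = ev A%:P ^+ N.
  rewrite -traceD // !evlin -sy -sx -(rmorph_trace s) curveE; exact: rmorphXn.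
(* The image of the equation under s, with y^M eliminated by the equation itself: its y-degree is
   below M, so by [ev_inj] all its coefficients vanish. *)
pose w : {poly {poly K}} := \sum_(i < r.-1) (c ^+ (q ^ i) - c ^+ M)%:P *: 'X^(q ^ i)
  + (trace B + c ^+ M *: 'X^N - A ^+ N)%:P.
have w0 : w = 0.
  apply: ev_inj.
    rewrite (leq_trans (size_polyD _ _)) // geq_max.
    rewrite (leq_trans (size_polyC_leq1 _)) // andbT.
    apply: (leq_trans (size_sum _ _ _)); apply/bigmax_leqP => i _.
    by rewrite (leq_trans (size_scale_leq _ _)) // size_polyXn ltn_exp2l.
  rewrite eval2D (rmorph_sum ev) /=.
  under eq_bigr => i _ do rewrite -mul_polyC eval2M eval2C (rmorphXn ev) /= eval2X.
  rewrite polyCB polyCD eval2B eval2D -mul_polyC polyCM eval2M eval2C.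
  have -> : ev ('X^N)%:P = trace y by rewrite curveE eval2_polyC map_polyXn hornerXn.
  have -> : ev (A ^+ N)%:P = ev A%:P ^+ N by rewrite (rmorphXn polyC) (rmorphXn ev).
  have -> : ev (trace B)%:P = trace (ev B%:P).
    by rewrite (rmorph_trace polyC) (rmorph_trace ev).
  rewrite -rel.
  have trM (z : L) : trace z = \sum_(i < r.-1) z ^+ (q ^ i) + z ^+ M.
    by rewrite /trace; case: r r_ge3 => [//|t] _; rewrite big_ord_recr.
  have -> : \sum_(i < r.-1) j (c ^+ (q ^ i) - c ^+ M) * y ^+ (q ^ i) =
     (trace (j c * y) - j (c ^+ M) * y ^+ M) - j (c ^+ M) * (trace y - y ^+ M).
    rewrite !trM !addrK [in RHS]exprMn rmorphXn addrK mulr_sumr -sumrB.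
    by apply: eq_bigr => i _; rewrite rmorphB mulrBl !rmorphXn exprMn.
  by ring.
have wE n : \sum_(i < r.-1) (c ^+ (q ^ i) - c ^+ M)%:P * (n == q ^ i)%N%:R
    + (trace B + c ^+ M *: 'X^N - A ^+ N) * (n == 0)%N%:R = 0 :> {poly K}.
  have /polyP/(_ n) := w0; rewrite coef0 coefD coefC coef_sum => wn.
  rewrite -[RHS]wn; congr (_ + _).
    by apply: eq_bigr => i _; rewrite coefZ coefXn.
  by case: eqP; rewrite ?mulr1 ?mulr0.
have cq n : (n < r.-1)%N -> c ^+ (q ^ n) = c ^+ M.
  move=> nr; have := wE (q ^ n)%N; rewrite (bigD1 (Ordinal nr)) //= eqxx mulr1 big1.
    rewrite addr0 expn_eq0 -[(q == 0)%N]negbK -lt0n (ltnW q1) mulr0 addr0 => /eqP.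
    by rewrite polyC_eq0 subr_eq0 => /eqP.
  move=> i ne; rewrite eqn_exp2l //; case: eqP => [ni|]; last by rewrite mulr0.
  by case/eqP: ne; apply: val_inj; rewrite /= ni.
(* The coefficients of y and, next, of y^q, which lies below y^M because r >= 3; together they give
   c^q = c. *)
have c1 : c = c ^+ M by have := cq 0%N; rewrite expn0 expr1; apply; lia.
have cq1 : c ^+ q = c by have := cq 1%N; rewrite expn1 -c1; apply; lia.
have polE : A ^+ N = trace B + c *: 'X^N.
  have := wE 0; rewrite mulr1 big1 => [|i _]; last first.
    by rewrite eq_sym expn_eq0 -[(q == 0)%N]negbK -lt0n (ltnW q1) mulr0.
  by rewrite add0r -c1 => /eqP; rewrite subr_eq0 eq_sym => /eqP.
have polC i := congr1 (fun g : {poly K} => g`_i) polE.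
have qiM (i : 'I_r) : (q ^ i <= M)%N.
  by rewrite leq_exp2l // -ltnS prednK ?ltn_ord //; lia.
have trB0 i : (M < i)%N -> (trace B)`_i = 0.
  move=> Mi; rewrite coef_trace_affine (gtn_eqF (ltn_trans M0 Mi)) mulr0 addr0.
  by rewrite big1 // => k _; rewrite (gtn_eqF (leq_ltn_trans (qiM k) Mi)) mulr0.
have aN : a ^+ N = c.
  have := polC N; rewrite coef_affineX subnn expr0 mulr1 binn coefD trB0; last first.
    by rewrite NE; lia.
  by rewrite add0r coefZ coefXn eqxx mulr1.
(* The coefficient of x^(N-1) in A^N is N a^(N-1) b with N = 1 in K, and [trace B] has degree at
   most M < N - 1. *)
have b0 : b = 0.
  have := polC N.-1; rewrite coef_affineX coefD coefZ coefXn trB0; last by rewrite NE; lia.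
  have -> : (N - N.-1 = 1)%N by rewrite NE; lia.
  have -> : (N.-1 == N) = false by apply/eqP; rewrite NE; lia.
  rewrite mulr0 addr0 expr1 -[X in 'C(X, _)]prednK; last by rewrite NE; lia.
  rewrite binSn prednK; last by rewrite NE; lia.
  rewrite -mulr_natr natN1 mulr1 => /eqP.
  by rewrite mulf_eq0 expf_eq0 (negPf a0) andbF => /eqP.
have trB : trace B = 0.
  apply: (addIr (c *: 'X^N)); rewrite -polE add0r /A b0 polyC0 addr0 exprZn aN.
  by [].
have d0 : d = 0.
  have /polyP/(_ 1%N) := trB; rewrite coef0 coef_trace_affine mulr0 addr0.
  case: r r_ge3 => [//|t] _; rewrite big_ord_recl big1 ?expr1 ?mulr1 ?addr0 // => i _.
  by rewrite -{1}(expn0 q) eqn_exp2l // mulr0.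
have f0 : trace f = 0.
  have /polyP/(_ 0%N) := trB; rewrite coef0 coef_trace_affine mulr1 big1 ?add0r // => i _.
  by rewrite eq_sym expn_eq0 -[(q == 0)%N]negbK -lt0n (ltnW q1) mulr0.
exists a, f; split=> //.
(* As N + q^r = qN + 1, the left side is c^q a = c a. *)
- have : a ^+ N * a ^+ (q ^ r) = a ^+ N * a.
    rewrite -exprD -[in RHS]exprSr.
    have -> : (N + q ^ r = q * N + 1)%N.
      rewrite big_distrr /= addn1; case: r r_ge3 => [//|t] _.
      rewrite [X in (X + _)%N]big_ord_recl expn0 [in RHS]big_ord_recr /= -!expnS.
      rewrite add1n addSn; congr (_.+1); congr (_ + _)%N.
      by apply: eq_bigr => i _; rewrite expnS.
    by rewrite exprD expr1 mulnC exprM aN cq1 exprSr aN.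
  by move/mulfI; apply; rewrite expf_neq0.
(* (trace f)^q - trace f telescopes to f^(q^r) - f, and trace f = 0. *)
- have charq : [pchar K].-nat q by exact: pchar_q_nat.
  have : trace f ^+ q = \sum_(i < r) f ^+ (q ^ i.+1).
    rewrite /trace; elim/big_ind2: _ => [|g1 g2 h1 h2 <- <-|i _].
    - by rewrite expr0n -[(q == 0)%N]negbK -lt0n (ltnW q1).
    - by rewrite exprDn_pchar.
    - by rewrite -exprM -expnSr.
  have tr1 : trace f = f + \sum_(i < r.-1) f ^+ (q ^ i.+1).
    by rewrite /trace; case: r r_ge3 => [//|t] _; rewrite big_ord_recl.
  rewrite f0 in tr1 *; rewrite expr0n -[(q == 0)%N]negbK -lt0n (ltnW q1) /=.
  have -> : \sum_(i < r) f ^+ (q ^ i.+1) =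
      \sum_(i < r.-1) f ^+ (q ^ i.+1) + f ^+ (q ^ r).
    by case: r r_ge3 => [//|t] _; rewrite big_ord_recr.
  move=> /esym E; apply: (addrI (\sum_(i < r.-1) f ^+ (q ^ i.+1))).
  by rewrite E [RHS]addrC -tr1.
- by rewrite sx b0 rmorph0 addr0.
by rewrite sy d0 aN rmorph0 mul0r add0r.
Qed.
End AutomorphismForm.

(** * Semilinear automorphisms *)

Section SemilinearLift.
Variable t : ring_aut K.

Definition conj_poly (u : {poly {poly K}}) := map_poly (map_poly t) u.

Lemma conj_polyB u v : conj_poly (u - v) = conj_poly u - conj_poly v.
Proof. exact: rmorphB. Qed.

Lemma conj_polyM u v : conj_poly (u * v) = conj_poly u * conj_poly v.
Proof. exact: rmorphM. Qed.

Lemma conj_polyC c : conj_poly c%:P%:P = (t c)%:P%:P.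
Proof. by rewrite /conj_poly map_polyC /= map_polyC. Qed.

Lemma conj_polyX : conj_poly 'X = 'X.
Proof. exact: map_polyX. Qed.

Lemma conj_polyY : conj_poly 'Y = 'Y.
Proof. by rewrite /conj_poly map_polyC /= map_polyX. Qed.

Lemma conj_poly_curve : conj_poly curve = curve.
Proof.
rewrite /curve conj_polyB; congr (_ - _).
  transitivity (trace (conj_poly 'X)); last by rewrite conj_polyX.
  by rewrite -[LHS]/(map_poly (map_poly t) _) rmorph_trace.
by rewrite /conj_poly map_polyC /= map_polyXn.
Qed.

Lemma conj_poly_ev0 u : ev u = 0 -> ev (conj_poly u) = 0.
Proof.
by move=> /ev_eq0[g ->]; rewrite conj_polyM conj_poly_curve eval2M curve0 mulr0.
Qed.

End SemilinearLift.

Lemma conj_poly_ev_neq0 t u : ev u != 0 -> ev (conj_poly t u) != 0.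
Proof.
apply: contra_neq => /(conj_poly_ev0 (t^-1)%g); rewrite /conj_poly.
rewrite -map_poly_comp_id0 ?rmorph0 // map_poly_id // => c _ /=.
by rewrite -map_poly_comp map_poly_id // => a _ /=; rewrite [LHS]rautK.
Qed.

(** The coefficients of the curve are 0, 1 and -1, so applying t to coefficients preserves its ideal
    and extends to fractions. The lift of t^-1 is the inverse. *)
Lemma semilinear_lift (t : ring_aut K) : exists h : ring_aut L,
  [/\ forall c, h (j c) = j (t c), h x = x & h y = y].
Proof.
pose lift t' z : L :=
  let u := sval (cid (ev_repr z)) in let h := sval (cid (svalP (cid (ev_repr z)))) in
  ev (conj_poly t' u) / ev (conj_poly t' h).
have lift_frac t' u h : ev h != 0 ->
    lift t' (ev u / ev h) = ev (conj_poly t' u) / ev (conj_poly t' h).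
  move=> h0; rewrite /lift; case: cid => u' eu /=; case: cid => h' [h'0] /= /eqP.
  rewrite eqr_div // => /eqP E; apply/eqP.
  rewrite eqr_div ?conj_poly_ev_neq0 // -!eval2M -!conj_polyM.
  rewrite -subr_eq0 -eval2B -conj_polyB; apply/eqP/conj_poly_ev0.
  by rewrite eval2B !eval2M E subrr.
have liftM t' : {morph lift t' : z w / z * w}.
  move=> z w; have [u [h [h0 ->]]] := ev_repr z; have [v [k [k0 ->]]] := ev_repr w.
  have -> : ev u / ev h * (ev v / ev k) = ev (u * v) / ev (h * k).
    by rewrite !eval2M mulf_div.
  by rewrite !lift_frac ?eval2M ?mulf_neq0 // !conj_polyM !eval2M mulf_div.
have liftB t' : {morph lift t' : z w / z - w}.
  move=> z w; have [u [h [h0 ->]]] := ev_repr z; have [v [k [k0 ->]]] := ev_repr w.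
  have -> : ev u / ev h - ev v / ev k = ev (u * k - v * h) / ev (h * k).
    by rewrite eval2B !eval2M -mulNr addf_div // mulNr.
  rewrite !lift_frac ?eval2M ?mulf_neq0 // !(conj_polyM, conj_polyB) eval2B !eval2M.
  by rewrite -[in RHS]mulNr addf_div ?conj_poly_ev_neq0 // mulNr.
have lift_ev t' u : lift t' (ev u) = ev (conj_poly t' u).
  have := lift_frac t' u 1; have -> : ev 1 = 1 by exact: rmorph1.
  rewrite oner_neq0 => /(_ isT); rewrite divr1 => ->.
  have -> : conj_poly t' 1 = 1 by exact: rmorph1.
  by have -> : ev 1 = 1 by [exact: rmorph1]; rewrite divr1.
have lift_j t' c : lift t' (j c) = j (t' c).
  by rewrite -(eval2C j y x) lift_ev conj_polyC eval2C.
have lift_x t' : lift t' x = x.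
  by rewrite -{1}(eval2Y j y x) lift_ev conj_polyY eval2Y.
have lift_y t' : lift t' y = y.
  by rewrite -{1}(eval2X j y x) lift_ev conj_polyX eval2X.
have lift1 t' : lift t' 1 = 1 by rewrite -{1}(rmorph1 j) lift_j !rmorph1.
have liftK (t1 t2 : ring_aut K) : cancel t1 t2 -> cancel (lift t1) (lift t2).
  move=> tK z; have [u [h [h0 ->]]] := ev_repr z.
  have conjK v : conj_poly t2 (conj_poly t1 v) = v.
    rewrite /conj_poly -map_poly_comp_id0 ?rmorph0 // map_poly_id // => c _ /=.
    by rewrite -map_poly_comp map_poly_id // => a _ /=; rewrite tK.
  by rewrite !lift_frac ?conj_poly_ev_neq0 // !conjK.
have lift_bij : bijective (lift t).
  by exists (lift (t^-1)%g); apply: liftK; [exact: rautK | exact: rautVK].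
exists (RingAut (liftB t) (conj (lift1 t) (liftM t)) lift_bij).
by split=> [c||]; [exact: lift_j | exact: lift_x | exact: lift_y].
Qed.

Lemma Frobenius_aut_exists k : exists t : ring_aut K, forall c, t c = c ^+ (p ^ k).
Proof.
pose f (c : K) := c ^+ (p ^ k); have pk : [pchar K].-nat (p ^ k)%N.
  by rewrite (eq_pnat _ (pcharf_eq charK)) pnatX pnat_id.
have fB : zmod_morphism f.
  by move=> a b; rewrite /f -{2}[a](subrK b) [in RHS]exprDn_pchar // addrK.
have fM : GRing.monoid_morphism f.
  by split=> [|a b]; rewrite /f ?expr1n ?exprMn.
have f_inj : injective f.
  move=> a b ab; apply/eqP; rewrite -subr_eq0.
  have : f (a - b) = 0 by rewrite fB ab subrr.
  by move=> /eqP; rewrite expf_eq0 => /andP[].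
have f_surj b : exists a, f a = b.
  have [|a] := closed_rootP ('X^(p ^ k) - b%:P : {poly K}) _.
    rewrite size_XnsubC ?eqSS ?expn_eq0; last by rewrite expn_gt0 prime_gt0.
    by rewrite -leqn0 leqNgt prime_gt0.
  by rewrite rootE !hornerE subr_eq0 => /eqP; exists a.
have f_bij : bijective f.
  have [f' f'K] := choice f_surj; exists f' => // a.
  by apply: f_inj; rewrite f'K.
by exists (RingAut fB fM f_bij).
Qed.

(** * Functions, places and automorphisms over F *)

Variables (F : finFieldType) (iota : {rmorphism F -> K}).
Hypothesis cardF : #|F| = (q ^ r)%N.

Let jF : {rmorphism F -> L} := j \o iota.

Lemma jFE c : jF c = j (iota c). Proof. by []. Qed.

Lemma jFM a b : jF (a * b) = jF a * jF b. Proof. exact: rmorphM. Qed.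
Lemma jFD a b : jF (a + b) = jF a + jF b. Proof. exact: rmorphD. Qed.
Lemma jFN a : jF (- a) = - jF a. Proof. exact: rmorphN. Qed.
Lemma jFV a : jF a^-1 = (jF a)^-1. Proof. exact: fmorphV. Qed.

Local Notation evF := (eval2 jF y x).
Local Notation Frat := (rational_function iota j x y).

Lemma ratP z : Frat z <-> exists u h, evF h != 0 /\ z = evF u / evF h.
Proof.
have swE u : eval2 (j \o iota) x y u = evF (swapXY u).
  by rewrite -[LHS]/(eval2 jF x y u) eval2_swapXY.
split=> -[u [h [h0 ->]]]; first by exists (swapXY u), (swapXY h); rewrite -!swE.
by exists (swapXY u), (swapXY h); rewrite !swE !swapXYK.
Qed.

Lemma rat_ev u : Frat (evF u).
Proof.
have e1 : evF 1 = 1 by exact: rmorph1.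
by apply/ratP; exists u, 1; rewrite e1 divr1 oner_neq0.
Qed.

Lemma rat_x : Frat x. Proof. by have := rat_ev 'Y; rewrite eval2Y. Qed.
Lemma rat_y : Frat y. Proof. by have := rat_ev 'X; rewrite eval2X. Qed.
Lemma rat_j c : Frat (jF c). Proof. by have := rat_ev c%:P%:P; rewrite eval2C. Qed.

Lemma ratM z w : Frat z -> Frat w -> Frat (z * w).
Proof.
move=> /ratP[u [h [h0 ->]]] /ratP[v [k [k0 ->]]]; apply/ratP.
by exists (u * v), (h * k); rewrite !eval2M mulf_neq0 // mulf_div.
Qed.

Lemma ratD z w : Frat z -> Frat w -> Frat (z + w).
Proof.
move=> /ratP[u [h [h0 ->]]] /ratP[v [k [k0 ->]]]; apply/ratP.
by exists (u * k + v * h), (h * k); rewrite eval2D !eval2M mulf_neq0 // addf_div.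
Qed.

Lemma ratV z : Frat z -> Frat z^-1.
Proof.
move=> /ratP[u [h [h0 ->]]]; have [->|u0] := eqVneq (evF u) 0.
  by rewrite mul0r invr0 -(rmorph0 jF); exact: rat_j.
by apply/ratP; exists h, u; rewrite invf_div.
Qed.

Lemma rat_ind (Q : L -> Prop) :
  (forall c, Q (jF c)) -> Q x -> Q y ->
  (forall z w, Q z -> Q w -> Q (z + w)) -> (forall z w, Q z -> Q w -> Q (z * w)) ->
  (forall z, Q z -> Q z^-1) -> forall z, Frat z -> Q z.
Proof.
move=> Qj Qx Qy QD QM QV z /ratP[u [h [h0 ->]]].
have Qev w : Q (evF w).
  elim/poly_ind: w => [|w c IHw]; first by rewrite eval2_0 -(rmorph0 jF).
  rewrite eval2D eval2M eval2X; apply: (QD); first exact: (QM).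
  elim/poly_ind: c => [|c a IHc]; first by rewrite polyC0 eval2_0 -(rmorph0 jF).
  rewrite polyCD polyCM eval2D eval2M eval2C eval2Y; apply: (QD) => //; exact: (QM).
by apply: QM => //; exact: QV.
Qed.

(** A shape shared by K-automorphisms and by lifts of automorphisms of F. Leaving b independent of a
    makes closure under products and inverses a direct computation. *)
Definition semilinear (h : ring_aut L) (g : ring_aut F) :=
  (exists t : ring_aut K, (forall c, h (j c) = j (t c)) /\
                          (forall c, t (iota c) = iota (g c))) /\
  exists a b f : F, [/\ a != 0, b != 0, h x = jF a * x & h y = jF b * y + jF f].

Lemma semilinear_jF h g c : semilinear h g -> h (jF c) = jF (g c).
Proof. by move=> [[t [ht tg]] _]; rewrite !jFE ht tg. Qed.

Lemma semilinearM h h' g g' : semilinear h g -> semilinear h' g' ->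
  semilinear (h * h')%g (g * g')%g.
Proof.
move=> S S'; have hj c := semilinear_jF c S'.
have [[t [ht tg]] [a [b [f [a0 b0 hx hy]]]]] := S.
have [[t' [ht' tg']] [a' [b' [f' [a'0 b'0 hx' hy']]]]] := S'; split.
  by exists (t * t')%g; split=> c; rewrite /= ?ht ?ht' ?tg ?tg'.
have h'D z w : h' (z + w) = h' z + h' w by exact: rmorphD.
have h'M z w : h' (z * w) = h' z * h' w by exact: rmorphM.
exists (g' a * a'), (g' b * b'), (g' b * f' + g' f).
rewrite !mulf_neq0 ?fmorph_eq0 //; split=> //.
  by rewrite -[LHS]/(h' (h x)) hx h'M hj hx' jFM mulrA.
by rewrite -[LHS]/(h' (h y)) hy h'D h'M !hj hy' jFD !jFM; ring.
Qed.

Lemma semilinearV h g : semilinear h g -> semilinear (h^-1)%g (g^-1)%g.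
Proof.
move=> S; have hj c := semilinear_jF c S.
have hK z : (h^-1)%g (h z) = z by exact: rautK.
have gVK z : g ((g^-1)%g z) = z by exact: rautVK.
have [[t [ht tg]] [a [b [f [a0 b0 hx hy]]]]] := S.
have tVK z : t ((t^-1)%g z) = z by exact: rautVK.
have tK z : (t^-1)%g (t z) = z by exact: rautK.
split.
  exists (t^-1)%g; split=> c; first by rewrite -{1}(tVK c) -ht hK.
  by rewrite -{1}(gVK c) -tg tK.
have hD z w : h (z + w) = h z + h w by exact: rmorphD.
have hM z w : h (z * w) = h z * h w by exact: rmorphM.
exists ((g^-1)%g a^-1), ((g^-1)%g b^-1), (- (g^-1)%g (f / b)).
rewrite !fmorph_eq0 !invr_eq0; split=> //; apply: (can_inj hK); apply/esym.
  have -> : h ((h^-1)%g x) = x by exact: rautVK.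
  by rewrite hM hj gVK hx jFV mulKf // fmorph_eq0.
have -> : h ((h^-1)%g y) = y by exact: rautVK.
have gN z : g (- z) = - g z by exact: rmorphN.
rewrite hD hM !hj gN !gVK hy !(jFN, jFM, jFV).
by field; rewrite fmorph_eq0.
Qed.

Lemma semilinear_rat h g z : semilinear h g -> Frat z -> Frat (h z).
Proof.
move=> S; have [_ [a [b [f [_ _ hx hy]]]]] := S.
apply: (rat_ind (Q := fun z => Frat (h z))).
- by move=> c; rewrite (semilinear_jF c S); exact: rat_j.
- by rewrite hx; apply: ratM rat_x; exact: rat_j.
- by rewrite hy; apply: ratD (rat_j _); apply: ratM rat_y; exact: rat_j.
- by move=> u v hu hv; rewrite rmorphD; exact: ratD.
- by move=> u v hu hv; rewrite rmorphM; exact: ratM.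
by move=> u hu; rewrite fmorphV; exact: ratV.
Qed.

Lemma semilinear_eq h h' g z : semilinear h g -> semilinear h' g ->
  h x = h' x -> h y = h' y -> Frat z -> h z = h' z.
Proof.
move=> S S' hx hy.
apply: (rat_ind (Q := fun z => h z = h' z)) => // [c|u v|u v|u].
- by rewrite (semilinear_jF c S) (semilinear_jF c S').
- by move=> hu hv; rewrite [LHS]rmorphD [RHS]rmorphD /= hu hv.
- by move=> hu hv; rewrite [LHS]rmorphM [RHS]rmorphM /= hu hv.
by move=> hu; rewrite [LHS]fmorphV [RHS]fmorphV /= hu.
Qed.

(** A rational place other than the pole of x is centred at a point with coordinates in F, which its
    values on F(x, y) determine. This matters because lifts compose correctly on F(x, y) only. *)
Lemma rational_place_eq (P Q : place j) :
  rational_place iota x y P -> rational_place iota x y Q ->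
  (forall z, Frat z -> P z = Q z) -> P = Q.
Proof.
move=> Prat Qrat PQ; have [V VE] := place_inf_ex.
have [Px|Px] := boolP (vge P 0 x); last first.
  rewrite (pole_uniq Px VE); apply/esym/(pole_uniq _ VE).
  by rewrite /vge -PQ //; exact: rat_x.
have same z c : Frat z -> has_value P z (iota c) -> has_value Q z (iota c).
  move=> rz; rewrite !has_valueP /vge -PQ //.
  by have := ratD rz (rat_j (- c)); rewrite rmorphN.
have [a xa] : exists a, has_value P x (iota a).
  by apply: Prat rat_x _; move: Px; rewrite vgeE ?x_neq0.
have [b yb] : exists b, has_value P y (iota b).
  by apply: Prat rat_y _; move: (vge_y Px); rewrite vgeE ?y_neq0.
have P1 : at_point P (iota a) (iota b) by [].
apply: (at_point_uniq (at_point_curve P1) P1).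
by split; apply: same => //; [exact: rat_x|exact: rat_y].
Qed.

(** [local_repr] with [k] = F writes z as a power of x - a times a unit defined over F: the value is
    that of the unit, or 0. *)
Lemma rational_at_point P a b : at_point P (iota a) (iota b) ->
  rational_place iota x y P.
Proof.
move=> P1 z rz; have Pab := at_point_curve P1.
have kab : trace b = a ^+ N.
  by apply: (fmorph_inj iota); rewrite rmorph_trace rmorphXn.
have [->|z0] := eqVneq z 0; first by exists 0; left; rewrite !rmorph0.
have /ratP[u [h [h0 zE]]] := rz.
have u0 : evF u != 0 by apply: contraNneq z0 => u0; rewrite zE u0 mul0r.
have [n [w [k [w0 k0 E]]]] := local_repr jFE kab u0 h0.
have [xa yb] := P1; have [P1x Pord] := at_point_pval Pab P1.
have val_ev v : has_value P (evF v) (iota v.[b, a]).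
  rewrite (ev_extend jFE) -(horner2_map iota).
  exact: has_value_eval2.
have wk := has_valueM (val_ev w) (has_valueV (val_ev k) _).
rewrite fmorph_eq0 in wk; have {wk} := wk k0; set v := evF w / evF k => vwk.
have -> : z = (x - jF a) ^ n * v by rewrite zE E.
have v1 : P v = 0.
  have := has_value_neq0 vwk; rewrite mulf_neq0 ?fmorph_eq0 ?invr_eq0 ?fmorph_eq0 //.
  by move=> /(_ isT)[].
have v0 : v != 0.
  have := has_value_neq0 vwk; rewrite mulf_neq0 ?fmorph_eq0 ?invr_eq0 ?fmorph_eq0 //.
  by move=> /(_ isT)[].
have xa0 := Xsub_neq0 (iota a).
have Pz : P ((x - jF a) ^ n * v) = n.
  rewrite pvalM ?expfz_neq0 // v1 addr0; case: n {E} => n; first by rewrite pvalX P1x; lia.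
  by rewrite NegzE -exprnN pvalV pvalX P1x; lia.
rewrite Pz; case: n {E Pz} => [[|n]|//] _.
  by exists (w.[b, a] / k.[b, a]); rewrite expr0z mul1r fmorph_div.
exists 0; apply/has_valueP; rewrite !rmorph0 subr0.
rewrite -[1]addr0; apply: vgeM; last by rewrite vgeE // v1.
by rewrite vgeE ?expf_neq0 // pvalX P1x; lia.
Qed.

Lemma fixed_in_F (a : K) : a ^+ (q ^ r) = a -> exists c, a = iota c.
Proof.
move=> aq; have := congr1 (fun u => (map_poly iota u).[a]) (finField_genPoly F).
rewrite rmorphB rmorph_prod /= map_polyXn map_polyX !hornerE cardF aq subrr.
rewrite horner_prod => /esym/eqP/prodf_eq0[c _]; rewrite map_polyXsubC !hornerE.
by rewrite subr_eq0 => /eqP ->; exists c.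
Qed.

Lemma kaut_j (s : kaut j) c : val s (j c) = j c.
Proof. by have /asboolP := valP s; apply. Qed.

Lemma kaut_form (s : kaut j) : exists a f : F,
  [/\ a != 0, val s x = jF a * x & val s y = jF (a ^+ N) * y + jF f].
Proof.
have [a [f [a0 /fixed_in_F[a' aE] /fixed_in_F[f' fE] sx sy]]] := aut_form (kaut_j s).
exists a', f'; rewrite !jFE rmorphXn /= -aE -fE; split=> //.
by apply: contraNneq a0 => a'0; rewrite aE a'0 rmorph0.
Qed.

Lemma kaut_semilinear (s : kaut j) : semilinear (val s) 1%g.
Proof.
have [a [f [a0 sx sy]]] := kaut_form s; split.
  by exists 1%g; split=> c //; rewrite kaut_j.
by exists a, (a ^+ N), f; split=> //; exact: expf_neq0.
Qed.

Lemma kaut_eq (s s' : kaut j) : val s x = val s' x -> val s y = val s' y -> s = s'.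
Proof.
move=> sx sy; apply/val_inj/raut_eq => z; have [u [h [h0 ->]]] := ev_repr z.
have val_ev (t : kaut j) w : val t (ev w) = eval2 j (val t y) (val t x) w.
  rewrite (semilinear_eval2 (j' := j) (t := idfun)); last exact: kaut_j.
  congr eval2; rewrite map_poly_id // => c _ /=; exact: map_poly_id.
by rewrite [LHS]fmorph_div [RHS]fmorph_div /= !val_ev sx sy.
Qed.

(** A power of the Frobenius map makes sense on the algebraically closed field K, where it is onto,
    and then lifts to L. *)
Lemma coef_lift_ex (g : ring_aut F) : exists h : ring_aut L,
  [/\ semilinear h g, h x = x & h y = y].
Proof.
have d0 : (0 < e * r)%N by rewrite muln_gt0 e_gt0; lia.
have cardFp : #|F| = (p ^ (e * r))%N by rewrite cardF q_def expnM.
have [k gE] := finField_aut_Frobenius p_prime d0 cardFp g.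
have [t tE] := Frobenius_aut_exists k; have [h [hj hx hy]] := semilinear_lift t.
exists h; split=> //; split.
  by exists t; split=> // c; rewrite tE gE rmorphXn.
exists 1, 1, 0; rewrite oner_neq0 hx hy jFE !jFE rmorph0 !rmorph1.
by rewrite rmorph0 addr0 !mul1r.
Qed.

(* The lifts of the automorphisms of F do not form a group, but their         *)
(* restrictions to F(x, y) do.                                                *)
Definition coef_lift g := sval (cid (coef_lift_ex g)).

Lemma coef_lift_semilinear g : semilinear (coef_lift g) g.
Proof. by rewrite /coef_lift; case: cid => h []. Qed.
Lemma coef_lift_x g : coef_lift g x = x.
Proof. by rewrite /coef_lift; case: cid => h []. Qed.
Lemma coef_lift_y g : coef_lift g y = y.
Proof. by rewrite /coef_lift; case: cid => h []. Qed.
Lemma coef_lift_jF g c : coef_lift g (jF c) = jF (g c).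
Proof. exact: semilinear_jF (coef_lift_semilinear g). Qed.

Lemma coef_conj_subproof (s : kaut j) g :
  ((coef_lift g)^-1 * val s * coef_lift g)%g \in fixes_base j.
Proof.
apply/asboolP => c; rewrite /=.
have [[t [ht _]] _] := coef_lift_semilinear g.
have hK z : (coef_lift g)^-1%g (coef_lift g z) = z by exact: rautK.
have tVK z : t ((t^-1)%g z) = z by exact: rautVK.
have -> : raut_inv (coef_lift g) (j c) = j ((t^-1)%g c).
  by rewrite -{1}(tVK c) -ht; exact: hK.
by rewrite kaut_j ht tVK.
Qed.

(** Two lifts of g agree on F(x, y), which contains s x and s y, so the conjugate does not depend on
    the lift chosen; the laws of an action follow from this. *)
Definition coef_conj (s : kaut j) g : kaut j :=
  Sub ((coef_lift g)^-1 * val s * coef_lift g)%g (coef_conj_subproof s g).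

Lemma coef_conjE s g z :
  val (coef_conj s g) z = coef_lift g (val s ((coef_lift g)^-1%g z)).
Proof. by []. Qed.

Lemma coef_conj_x s g : val (coef_conj s g) x = coef_lift g (val s x).
Proof.
by rewrite coef_conjE -{1}(coef_lift_x g) [X in val s X]rautK.
Qed.

Lemma coef_conj_y s g : val (coef_conj s g) y = coef_lift g (val s y).
Proof.
by rewrite coef_conjE -{1}(coef_lift_y g) [X in val s X]rautK.
Qed.

Lemma kaut_rat (s : kaut j) z : Frat z -> Frat (val s z).
Proof. exact: semilinear_rat (kaut_semilinear s). Qed.

Lemma coef_lift_rat (g : ring_aut F) z : Frat z -> Frat (coef_lift g z).
Proof. exact: semilinear_rat (coef_lift_semilinear g). Qed.

Lemma coef_lift_id z : Frat z -> coef_lift 1%g z = z.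
Proof.
apply: (semilinear_eq (h' := 1%g) (coef_lift_semilinear 1%g)) => //.
- split; first by exists 1%g.
  exists 1, 1, 0; rewrite oner_neq0 !jFE rmorph0 !rmorph1; split=> //=.
    by rewrite mul1r.
  by rewrite rmorph0 mul1r addr0.
- exact: coef_lift_x.
exact: coef_lift_y.
Qed.

Lemma coef_liftM g h z : Frat z -> coef_lift (g * h)%g z = coef_lift h (coef_lift g z).
Proof.
apply: (semilinear_eq (h' := (coef_lift g * coef_lift h)%g)
  (coef_lift_semilinear (g * h)%g)).
- exact: semilinearM (coef_lift_semilinear g) (coef_lift_semilinear h).
- by rewrite /= !coef_lift_x.
by rewrite /= !coef_lift_y.
Qed.

Lemma coef_conjM g : {morph coef_conj^~ g : s s' / (s * s')%g}.
Proof.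
move=> s s'; apply/val_inj/raut_eq => z.
by rewrite /= [X in _ = coef_lift g (val s' X)]rautK.
Qed.

Lemma coef_conj1 s : coef_conj s 1%g = s.
Proof.
apply: kaut_eq; rewrite ?coef_conj_x ?coef_conj_y coef_lift_id //; apply: kaut_rat.
  exact: rat_x.
exact: rat_y.
Qed.

Lemma coef_conjA s g h : coef_conj s (g * h)%g = coef_conj (coef_conj s g) h.
Proof.
apply: kaut_eq; rewrite ?coef_conj_x ?coef_conj_y coef_liftM //; apply: kaut_rat.
  exact: rat_x.
exact: rat_y.
Qed.

Definition coef_action : right_action (kaut j) (ring_aut F) :=
  RightAction coef_conjM coef_conj1 coef_conjA.

Lemma coef_actionP : is_coef_action iota x y coef_action.
Proof.
move=> s g; rewrite -[coef_action s g]/(coef_conj s g) coef_conj_x coef_conj_y.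
have [a [f [a0 sx sy]]] := kaut_form s.
have gD z w : coef_lift g (z + w) = coef_lift g z + coef_lift g w by exact: rmorphD.
have gM z w : coef_lift g (z * w) = coef_lift g z * coef_lift g w by exact: rmorphM.
have e1 : eval2 (j \o iota) x y 1 = 1 by exact: (rmorph1 (eval2 jF x y)).
have m1 : map_poly (map_poly g) 1 = 1 :> {poly {poly F}} by exact: rmorph1.
split.
  exists (a%:P%:P * 'X), 1; rewrite m1 e1 !divr1 oner_neq0 sx; split=> //.
    by rewrite -[RHS]/(eval2 jF x y _) eval2M eval2C eval2X.
  rewrite gM coef_lift_jF coef_lift_x -[RHS]/(eval2 jF x y _).
  by rewrite rmorphM /= map_polyX !map_polyC /= map_polyC eval2M eval2C eval2X.
exists ((a ^+ N)%:P%:P * 'Y + f%:P%:P), 1; rewrite m1 e1 !divr1 oner_neq0 sy; split=> //.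
  by rewrite -[RHS]/(eval2 jF x y _) eval2D eval2M !eval2C eval2Y.
rewrite gD gM !coef_lift_jF coef_lift_y -[RHS]/(eval2 jF x y _).
rewrite rmorphD rmorphM /= !map_polyC /= map_polyX !map_polyC /=.
by rewrite eval2D eval2M !eval2C eval2Y.
Qed.

(** * Pullback of places along semilinear automorphisms *)

Section Pullback.
Variables (h : ring_aut L) (g : ring_aut F).
Hypothesis S : semilinear h g.

Lemma pullback_ex (Q : place j) : exists Q' : place j, forall z, Q' z = Q (h z).
Proof. by have [[t [ht _]] _] := S; exists (place_comp ht Q). Qed.

Section Place.
Variables Q Q' : place j.
Hypothesis QQ' : forall z, Q' z = Q (h z).

Lemma vge_pullback k z : vge Q' k z = vge Q k (h z).
Proof. by rewrite /vge QQ' fmorph_eq0. Qed.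

Lemma has_value_pullback z c :
  has_value Q' z (iota c) <-> has_value Q (h z) (iota (g c)).
Proof.
have hB a b : h (a - b) = h a - h b by exact: rmorphB.
have hj : h (j (iota c)) = j (iota (g c)) by exact: semilinear_jF.
by rewrite !has_valueP vge_pullback hB hj.
Qed.

Lemma pullback_rational : rational_place iota x y Q -> rational_place iota x y Q'.
Proof.
move=> Qrat z rz; rewrite QQ' => /(Qrat _ (semilinear_rat S rz))[c].
have hB a b : h (a - b) = h a - h b by exact: rmorphB.
have hj : h (j (iota ((g^-1)%g c))) = jF (g ((g^-1)%g c)) by exact: semilinear_jF.
have gV : g ((g^-1)%g c) = c by exact: rautVK.
by move=> hzc; exists ((g^-1)%g c); move: hzc; rewrite !has_valueP vge_pullback hB hj gV.
Qed.

Lemma pullback_x : Q' x = Q x.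
Proof.
have [_ [a [b [f [a0 _ hx _]]]]] := S.
by rewrite QQ' hx pvalM ?fmorph_eq0 ?x_neq0 // pvalC add0r.
Qed.

End Place.
End Pullback.

Lemma pullback_Omega h g (Q Q' : place j) : semilinear h g ->
  (forall z, Q' z = Q (h z)) -> Omega iota x y Q' <-> Omega iota x y Q.
Proof.
move=> S QQ'; rewrite /Omega /= (pullback_x S QQ'); split=> -[Qrat Qx]; split=> //.
  apply: (pullback_rational (semilinearV S) _ Qrat) => z.
  by rewrite QQ'; have -> : h ((h^-1)%g z) = z by exact: rautVK.
exact: (pullback_rational S QQ' Qrat).
Qed.

Lemma pullback_Theta h g (Q Q' : place j) : semilinear h g ->
  (forall z, Q' z = Q (h z)) -> Theta iota x y Q -> Theta iota x y Q'.
Proof.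
move=> S QQ' [Qrat QO]; split; first exact: (pullback_rational S QQ' Qrat).
by rewrite (pullback_Omega S QQ').
Qed.

(** The trace has degree M < q^r, so it is nonzero at some b in F; its value there is fixed by the
    q-th power map, so b can be divided by it. *)
Lemma trace1_ex : exists b : F, trace b = 1.
Proof.
have q1 := q_gt1; have pF : p \in [pchar F] by rewrite -(fmorph_pchar iota).
have [b b0] : exists b : F, trace b != 0.
  apply: contrapT => tr0; have [st tm] := size_trace F.
  have := @max_poly_roots F (trace 'X) (enum F) (monic_neq0 tm).
  rewrite enum_uniq st -cardE cardF => roots.
  have : (q ^ r < M.+1)%N.
    apply: roots => //; apply/allP => b _; apply: contrapT => rb; case: tr0; exists b.
    apply: contra_notN rb => /eqP tb; rewrite rootE -[X in X == _]/(horner_eval b _).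
    by rewrite rmorph_trace /= /horner_eval hornerX tb.
  by rewrite ltnS leq_exp2l //; lia.
have bF : b ^+ (q ^ r) = b by rewrite -cardF expf_card.
have tq : trace b ^+ q = trace b.
  have -> : trace b ^+ q = \sum_(i < r) b ^+ (q ^ i.+1).
    rewrite /trace; elim/big_ind2: _ => [|g1 g2 h1 h2 <- <-|i _].
    - by rewrite expr0n -[(q == 0)%N]negbK -lt0n (ltnW q1).
    - by rewrite exprDn_pchar // pchar_q_nat.
    - by rewrite -exprM -expnSr.
  rewrite /trace; move: bF; case: r r_ge3 => [//|t] _ bF.
  by rewrite big_ord_recr /= bF [in RHS]big_ord_recl expn0 expr1 addrC.
have tqi i : trace b ^+ (q ^ i) = trace b.
  by elim: i => [|i IHi]; rewrite ?expn0 ?expr1 // expnSr exprM IHi.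
exists (b / trace b); rewrite /trace -/(trace b).
under eq_bigr => i _ do rewrite exprMn exprVn tqi.
by rewrite -mulr_suml divff.
Qed.

(* At this point, of the form (1, b), the values of the images of x and y     *)
(* determine the automorphism.                                                *)
Lemma Theta_point_ex : exists (Q : place j) (b : F),
  Theta iota x y Q /\ at_point Q 1 (iota b).
Proof.
have [b tb] := trace1_ex; have Pab : trace (iota b) = 1 ^+ N.
  by rewrite -rmorph_trace tb rmorph1 expr1n.
have [Q Q1] := at_point_ex Pab; exists Q, b; split=> //.
have Q1' : at_point Q (iota 1) (iota b) by rewrite rmorph1.
split; first exact: rational_at_point Q1'.
case=> _; have [xa _] := Q1; have [_ ->] := has_value_neq0 xa (oner_neq0 _).
by rewrite ltxx.
Qed.

(** * Automorphisms of the code *)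

Section CodeAutomorphisms.
Variables (l n : nat) (P : 'I_n -> place j).
Hypotheses (P_inj : injective P) (P_Theta : range P = Theta iota x y).

Local Notation E := (Omega_divisor iota x y l).
Local Notation C := (AG_code iota x y P E).
Implicit Types u v : semidirect coef_action.

Definition field_aut u : ring_aut L := (val (sdl u) * coef_lift (sdr u))%g.

Lemma field_aut_semilinear u : semilinear (field_aut u) (sdr u).
Proof.
rewrite -[sdr u]mul1g; apply: semilinearM (coef_lift_semilinear _).
exact: kaut_semilinear.
Qed.

(** On F(x, y) the lift of g^-1 inverts the lift of g, which matches the twist in the product of the
    semidirect group. *)
Lemma field_autM u v z : Frat z ->
  field_aut (u * v)%g z = field_aut v (field_aut u z).
Proof.
move: u v => [s g] [t h] rz; rewrite -[LHS]/(coef_lift (g * h)%g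
  (val (coef_conj t (g^-1)%g) (val s z))) coef_conjE.
rewrite -[RHS]/(coef_lift h (val t (coef_lift g (val s z)))).
have rsz := kaut_rat s rz; set w := val s z in rsz *.
have -> : (coef_lift g^-1)^-1%g w = coef_lift g w.
  rewrite -[in LHS](coef_lift_id rsz) -(mulgV g) coef_liftM //; exact: rautK.
rewrite -coef_liftM; last by apply/kaut_rat/coef_lift_rat.
by rewrite mulgA mulVg mul1g.
Qed.

Lemma point_perm_ex u i : exists k, forall z, P k z = P i (field_aut u z).
Proof.
have S := field_aut_semilinear u; have [Q QE] := pullback_ex S (P i).
have : Theta iota x y Q.
  by apply: (pullback_Theta S QE); rewrite -P_Theta; exists i.
by rewrite -P_Theta => -[k _ kE]; exists k => z; rewrite kE QE.
Qed.

Definition point_map u i := sval (cid (point_perm_ex u i)).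

Lemma point_mapE u i z : P (point_map u i) z = P i (field_aut u z).
Proof. by rewrite /point_map; case: cid. Qed.

Lemma point_map_inj u : injective (point_map u).
Proof.
move=> i k E'; apply/P_inj/place_eq => z.
have <- : field_aut u ((field_aut u)^-1%g z) = z by exact: rautVK.
by rewrite -!point_mapE E'.
Qed.

Lemma P_rational i : rational_place iota x y (P i).
Proof. by have : Theta iota x y (P i) by [rewrite -P_Theta; exists i]; case. Qed.

Lemma point_mapM u v i : point_map (u * v)%g i = point_map u (point_map v i).
Proof.
apply/P_inj/rational_place_eq; [exact: P_rational|exact: P_rational|] => z rz.
by rewrite !point_mapE field_autM.
Qed.

Definition point_perm u : 'S_n := perm (@point_map_inj u).

Section Monomial.
Variables (a : {unit F}) (s : 'S_n).

Lemma scaled_perm_unitmx : val a *: perm_mx s^-1%g \in unitmx.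
Proof. by rewrite unitmxZ ?unitmx_perm // (valP a). Qed.

(** The inverse is taken so that right multiplication brings coordinate [s i] to position [i], as
    pullback of places requires. *)
Definition scaled_perm_GL : GL F n := Sub (val a *: perm_mx s^-1%g) scaled_perm_unitmx.

Lemma scaled_permE i k : (val a *: perm_mx s^-1%g) i k = val a *+ (i == s k).
Proof.
by rewrite !mxE mulr_natr (can2_eq (permKV s) (permK s)).
Qed.

Lemma scaled_perm_monomial : scaled_perm_GL \in @monomial F n.
Proof.
apply/monomial_mxP; exists s^-1%g => i k; rewrite /= scaled_permE.
rewrite -(can2_eq (permK s) (permKV s)) [s k == i]eq_sym.
have a0 : val a != 0 by rewrite -unitfE (valP a).
by case: (i == s k); rewrite ?mulr1n ?mulr0n ?eqxx.
Qed.

Definition scaled_perm : monomial_group F n := Sub scaled_perm_GL scaled_perm_monomial.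

Lemma mul_scaled_perm (w : 'rV[F]_n) i :
  (w *m val (val scaled_perm)) 0 i = val a * w 0 (s i).
Proof.
rewrite mxE (bigD1 (s i)) //= big1 => [|k ks].
  by rewrite scaled_permE eqxx mulr1n addr0 mulrC.
by rewrite scaled_permE (negPf ks) mulr0n mulr0.
Qed.

End Monomial.

Implicit Type w : semidirect (scalar_action coef_action).

Definition code_map w : semilinear_group F n :=
  SDPair (entrywise_action F n) (scaled_perm (sdl w) (point_perm (sdr w))) (sdr (sdr w)).

Lemma slact_code_map w c i : slact (code_map w) c 0 i =
  sdr (sdr w) (val (sdl w) * c 0 (point_map (sdr w) i)).
Proof. by rewrite /slact mxE /= mul_scaled_perm permE. Qed.

(** The image of the codeword of f is the codeword of g(a) h(f), a function over F again in L(G)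
    because Omega is stable under pullback along h. *)
Lemma code_map_stabiliser w : code_map w \in code_stabiliser C.
Proof.
apply/asboolP => c [f [[frat fE] fc]]; set u := sdr w.
have S := field_aut_semilinear u; set h := field_aut u in S.
set a := sdr u (val (sdl w)).
have a0 : a != 0 by rewrite fmorph_eq0 -unitfE (valP (sdl w)).
exists (jF a * h f); split.
  split; first by apply: ratM; [exact: rat_j | exact: semilinear_rat S frat].
  have [->|f0] := eqVneq f 0; first by left; rewrite rmorph0 mulr0.
  right=> Q; have [Q' QE] := pullback_ex S Q.
  have ja0 : jF a != 0 by rewrite fmorph_eq0.
  have hf0 : h f != 0 by rewrite fmorph_eq0.
  rewrite (pvalM Q ja0 hf0) [Q (jF a)]pvalC add0r -QE.
  have -> : E Q = E Q'.
    rewrite /Omega_divisor; congr (if _ then _ else _).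
    by apply/asboolP/asboolP; rewrite (pullback_Omega S QE).
  by case: fE f0 => [->|]; rewrite ?eqxx.
move=> i; rewrite slact_code_map rmorphM -/a -/u.
have -> : iota (a * sdr u (c 0 (point_map u i))) =
          iota a * iota (sdr u (c 0 (point_map u i))) by exact: rmorphM.
apply: has_valueM; first exact: has_valueC.
by apply/(has_value_pullback S (point_mapE u i)); exact: fc.
Qed.

Definition code_aut_map w : code_aut C := Sub (code_map w) (code_map_stabiliser w).

Lemma code_aut_mapM : {morph code_aut_map : w w' / (w * w')%g}.
Proof.
move=> w w'; apply: val_inj; set u := sdr w; set u' := sdr w'.
set a := sdl w; set b := sdl w'; set g := (sdr u)^-1%g.
suff E : scaled_perm (a * conj_scalar b u^-1)%g (point_perm (u * u')%g) =
    (scaled_perm a (point_perm u) * conj_monomial (scaled_perm b (point_perm u')) g)%g.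
  exact: (congr1 (fun m => SDPair (entrywise_action F n) m (sdr u * sdr u')%g) E).
apply/val_inj/val_inj/matrixP => i k; rewrite [LHS]scaled_permE.
have bE m : val (val (conj_monomial (scaled_perm b (point_perm u')) g)) m k =
    g (val b *+ (m == point_perm u' k)) by rewrite mxE scaled_permE.
rewrite [RHS]mxE (bigD1 (point_perm u' k)) //= big1 => [|m mk]; last first.
  by rewrite bE (negPf mk) mulr0n rmorph0 mulr0.
rewrite addr0 bE scaled_permE eqxx mulr1n !permE point_mapM.
by rewrite mulrnAl.
Qed.

Lemma field_aut_value u (Q R : place j) a b f c : at_point Q 1 (iota c) ->
  (forall z, R z = Q (field_aut u z)) ->
  val (sdl u) x = jF a * x -> val (sdl u) y = jF b * y + jF f ->
  has_value R x (iota a) /\ has_value R y (iota (b * (sdr u)^-1%g c + f)).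
Proof.
move=> [Qx Qy] RE sx sy; have S := field_aut_semilinear u; set g := sdr u in S *.
have gD (z t : L) : coef_lift g (z + t) = coef_lift g z + coef_lift g t by exact: rmorphD.
have gM (z t : L) : coef_lift g (z * t) = coef_lift g z * coef_lift g t by exact: rmorphM.
have gVK : g (g^-1%g c) = c by exact: rautVK.
split; apply/(has_value_pullback S RE).
  rewrite -[field_aut u x]/(coef_lift g (val (sdl u) x)) sx gM coef_lift_jF coef_lift_x.
  by rewrite -[iota _]mulr1; apply: has_valueM (has_valueC _ _) Qx.
rewrite -[field_aut u y]/(coef_lift g (val (sdl u) y)) sy gD gM !coef_lift_jF coef_lift_y.
have -> : iota (g (b * g^-1%g c + f)) = iota (g b) * iota c + iota (g f).
  by rewrite rmorphD rmorphM /= gVK rmorphD rmorphM.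
by apply: has_valueD; [apply: has_valueM Qy |]; exact: has_valueC.
Qed.

Lemma code_aut_map_inj : injective code_aut_map.
Proof.
move=> [a [s g]] [b [t h]] /(congr1 val) E.
have gh : g = h by exact: (congr1 (fun m : semilinear_group F n => sdr m) E).
rewrite -{}gh {h} in E *; set u := SDPair coef_action s g in E *.
set v := SDPair coef_action t g in E *.
have ME i k : val a *+ (i == point_map u k) = val b *+ (i == point_map v k).
  have /matrixP/(_ i k) := congr1 (fun m : semilinear_group F n => val (val (sdl m))) E.
  by rewrite !scaled_permE !permE.
have [Q [c [QT Q1]]] := Theta_point_ex.
have [i _ iQ] : range P Q by rewrite P_Theta.
have a0 : val a != 0 by rewrite -unitfE (valP a).
(* Column i of the first matrix has the nonzero entry a in row [point_map u i], so the second matrix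
   cannot vanish there; the same entry then gives a = b. *)
have uv : point_map u i = point_map v i.
  have := ME (point_map u i) i; rewrite eqxx mulr1n; case: eqP => // _ aE.
  by rewrite aE mulr0n eqxx in a0.
have ab : a = b.
  by apply: val_inj; have := ME (point_map u i) i; rewrite -uv eqxx !mulr1n.
rewrite -ab; congr (SDPair _ _ (SDPair _ _ _)).
have Ru z : P (point_map u i) z = Q (field_aut u z) by rewrite point_mapE iQ.
have Rv z : P (point_map u i) z = Q (field_aut v z) by rewrite uv point_mapE iQ.
(* The common image of the place at (1, c) has x-coordinate a1 = a2 and y-coordinate a1^N g^-1(c) +
   f1, which then gives f1 = f2. *)
have [a1 [f1 [_ sx sy]]] := kaut_form s; have [a2 [f2 [_ tx ty]]] := kaut_form t.
have [ux uy] := @field_aut_value u _ _ _ _ _ _ Q1 Ru sx sy.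
have [vx vy] := @field_aut_value v _ _ _ _ _ _ Q1 Rv tx ty.
have a12 : a1 = a2 by exact: (fmorph_inj iota) (has_value_uniq ux vx).
have f12 : f1 = f2.
  have := fmorph_inj iota (has_value_uniq uy vy); rewrite a12; exact: addrI.
by apply: kaut_eq; rewrite ?sx ?sy ?tx ?ty a12 // f12.
Qed.

Lemma code_aut_embedding :
  exists phi : {multiplicative semidirect (scalar_action coef_action) -> code_aut C},
    injective phi.
Proof.
pose phi_multiplicative := isMultiplicative.Build _ _ code_aut_map code_aut_mapM.
pose phi : {multiplicative _ -> _} := HB.pack code_aut_map phi_multiplicative.
by exists phi; exact: code_aut_map_inj.
Qed.

End CodeAutomorphisms.
End NormTrace.

Theorem proposition4p5
  (p e q l r : nat) (p_prime : prime p) (e_gt0 : (0 < e)%N) (q_def : q = (p ^ e)%N)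
  (r_ge3 : (3 <= r)%N)
  (F : finFieldType) (cardF : #|F| = (q ^ r)%N)
  (K : closedFieldType) (iota : {rmorphism F -> K})
  (algK : forall z : K, algebraicOver iota z)
  (L : fieldType) (j : {rmorphism K -> L}) (x y : L)
  (ffL : is_function_field j (norm_trace_poly K q r) x y)
  (n : nat) (P : 'I_n -> place j) (P_inj : injective P)
  (P_Theta : range P = Theta iota x y) :
  exists A : right_action (kaut j) (ring_aut F),
    is_coef_action iota x y A /\
    exists phi : {multiplicative semidirect (scalar_action A) ->
                    code_aut (AG_code iota x y P (Omega_divisor iota x y l))},
      injective phi.
Proof.
have charF : p \in [pchar F].
  by apply: (card_finPcharP (n := (e * r)%N)) p_prime; rewrite cardF q_def expnM.
have charK : p \in [pchar K] by rewrite (fmorph_pchar iota).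
exists (coef_action p_prime e_gt0 q_def r_ge3 charK ffL iota cardF); split.
  exact: coef_actionP.
exact: code_aut_embedding.
Qed.
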